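(* Let $X_n$ be the number of occupied seats at the end of the random unfriendly seating process started from the empty $2\times n$ seat configuration $\mathscr{X}_n$. Let $\mu:=1-\frac{e^{-1}}{2}$ and $\sigma:=\sqrt{\tfrac34}\,e^{-1}$. Then, as $n\to\infty$, \[ \sup_{x\in\mathbb{R}}\left|\mathbb{P}\left(\frac{X_n-\mu n}{\sigma\sqrt n}\le x\right)-\Phi(x)\right|=O\left(n^{-1/2}\right), \] and, uniformly for $x=o(n^{1/6})$, \[ \mathbb{P}\left(X_n=\left\lfloor\mu n+x\sigma\sqrt n\right\rfloor\right)=\frac{e^{-x^2/2}}{\sqrt{2\pi n}\,\sigma}\left(1+O\left((1+|x|^3)n^{-1/2}\right)\right). \]
   Context: A seat configuration is a finite set $S$ of seats $(r,c)$ with row $r\in\{\text{top},\text{bottom}\}$ and column $c\in\mathbb{Z}$. Two seats are neighbors if they lie in the same row in consecutive columns, or in the same column in opposite rows. The random unfriendly seating process started from $S$: at each step, a seat is chosen uniformly at random among the currently available seats (initially all seats of $S$ are available); it becomes occupied, and it together with all its neighbors in $S$ becomes unavailable; choices are made until no seat is available. $\mathscr{X}_n$ is the configuration with $2n$ seats: both rows have columns $1,\dots,n$. $\Phi$ is the standard normal distribution function. ''Uniformly for $x=o(n^{1/6})$'' means: for every sequence $\varepsilon_n\to0$ of positive reals, the estimate holds with an $O$-constant that is uniform over all real $x$ with $|x|\le\varepsilon_n n^{1/6}$. *)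

(* Defs.v *)
(* MathComp-Analysis, over an arbitrary R : realType. *)
From HB Require Import structures.
From mathcomp Require Import all_boot all_order all_algebra finmap.
From mathcomp Require Import all_classical all_reals all_analysis.
Import Order.TTheory GRing.Theory Num.Theory.
Import numFieldNormedType.Exports.

Set Implicit Arguments.
Unset Strict Implicit.
Unset Printing Implicit Defensive.

Local Open Scope fset_scope.
Local Open Scope ring_scope.

(* A seat is a pair (row, column); the row is true for top, false for bottom. *)
Definition seat : Type := (bool * int)%type.

Definition neighbor (s t : seat) : bool :=
  ((s.1 == t.1) && (`|s.2 - t.2| == 1)) || ((s.1 != t.1) && (s.2 == t.2)).

Definition available_after (A : {fset seat}) (s : seat) : {fset seat} :=
  [fset t in A | (t != s) && ~~ neighbor s t].

(* Probability that the final occupied set satisfies E when the seats of O are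
   already occupied and those of A are the available ones, by conditioning on
   the next choice.  The available set shrinks at every step, so k is only a
   recursion bound: its value is irrelevant as soon as #|` A| <= k. *)
Fixpoint seating_prob_from (R : realType) (k : nat) (O A : {fset seat})
    (E : pred {fset seat}) : R :=
  if k is k'.+1 then
    if A == fset0 then (E O)%:R
    else (#|` A|%:R)^-1 *
      \sum_(s <- A) seating_prob_from R k' (s |` O) (available_after A s) E
  else (E O)%:R.

(* Probability that the set of seats occupied at the end of the process started
   from the configuration S satisfies E. *)
Definition seating_prob (R : realType) (S : {fset seat})
    (E : pred {fset seat}) : R :=
  seating_prob_from R #|` S| fset0 S E.

Lemma card_available_after (A : {fset seat}) (s : seat) :
  s \in A -> (#|` available_after A s| < #|` A|)%N.
Proof.
move=> sA; apply: fproper_ltn_card; rewrite fproperEneq; apply/andP; split.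
  by apply/eqP => /fsetP/(_ s); rewrite !inE eqxx sA.
by apply/fsubsetP => t; rewrite !inE => /andP[].
Qed.

Lemma seating_prob_from_bound (R : realType) (k : nat) (O A : {fset seat})
    (E : pred {fset seat}) : (#|` A| <= k)%N ->
  seating_prob_from R k O A E = seating_prob_from R #|` A| O A E.
Proof.
have [m] := ubnP #|` A|; elim: m k O A => // m IHm [|k] O A.
  by move=> _; rewrite leqn0 => /eqP ->.
rewrite ltnS => Am Ak.
have [->|A0] := eqVneq A fset0; first by rewrite cardfs0 /= ?eqxx.
have := A0; rewrite -cardfs_gt0.
case EA : #|` A| => [//|j] _ /=; rewrite (negbTE A0); congr (_ * _).
apply: eq_big_seq => s sA; have := card_available_after sA.
rewrite EA ltnS => sj; have jk : (j <= k)%N by rewrite -ltnS -EA.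
have jm : (j < m)%N by rewrite -EA.
by rewrite IHm ?[RHS]IHm // ?(leq_trans sj) // (leq_ltn_trans sj).
Qed.

Lemma seating_prob_fromE (R : realType) (O A : {fset seat})
    (E : pred {fset seat}) : A != fset0 ->
  seating_prob_from R #|` A| O A E =
  (#|` A|%:R)^-1 * \sum_(s <- A)
    seating_prob_from R #|` available_after A s| (s |` O)
      (available_after A s) E.
Proof.
move=> A0; have := A0; rewrite -cardfs_gt0.
case EA : #|` A| => [//|j] _ /=; rewrite (negbTE A0) EA; congr (_ * _).
apply: eq_big_seq => s sA; have := card_available_after sA.
by rewrite EA ltnS => sj; rewrite seating_prob_from_bound.
Qed.

Lemma seating_prob_total (R : realType) (S : {fset seat}) :
  seating_prob R S xpredT = 1.
Proof.
rewrite /seating_prob; move: #|` S| fset0 => k O.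
elim: k O S => [|k IHk] O A //=; case: eqP => // /eqP A0.
under eq_bigr do rewrite IHk.
rewrite big_const_seq count_predT iter_addr addr0 mulVf //.
by rewrite pnatr_eq0 -lt0n cardfs_gt0.
Qed.

Definition empty_ladder (n : nat) : {fset seat} :=
  [fset (r, Posz c) | r in [:: true; false], c in iota 1 n].

Definition Phi (R : realType) (x : R) : R :=
  fine (normal_prob (0 : R) 1 `]-oo, x]%classic).

Definition mu (R : realType) : R := 1 - expR (- 1) / 2.
Definition sigma (R : realType) : R := Num.sqrt (3 / 4) * expR (- 1).

(* Main.v *)
(* The first occupied seat cuts the ladder into independent pieces, so the
   generating functions v |-> E v^X of the ladder and of the ladders missing one
   or two corner seats satisfy quadratic recurrences.  These have an explicit
   solution: with v = e^z, beta = (1 - e^-z) / 2 and psi(X) = e^-X - 1 + X, the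
   series for two missing corners is 2 v (1 - beta) / (1 - v x + beta psi(v x)),
   a function of x with one dominant pole.  The ratios of consecutive
   coefficients of 1 / (1 - X + beta psi(X)) converge geometrically, whence the
   quasi-power E e^(z X_n) = e^(n (mu z + sigma^2 z^2 / 2) + O(|z| + n |z|^3))
   near z = 0.  Away from the real axis the recurrences have nonnegative
   coefficients and only involve v and the initial value 1 + v, so they are
   majorised by the same explicit solution at |v| and |1 + v|; the strict
   inequality |1 + v| < 1 + |v| then gives Gaussian decay in t = Im z for
   |t| <= pi.  Fourier inversion along the line Re z = x / (sigma sqrt n) gives
   the local limit theorem for |x|^3 <= sqrt n, and summing it over the integers
   in this range gives the Berry-Esseen bound. *)

Require Import Defs.
From HB Require Import structures.
From mathcomp Require Import all_boot all_order all_algebra finmap.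
From mathcomp Require Import all_classical all_reals all_analysis.
From mathcomp Require Import complex zify ring lra.
Import Order.TTheory GRing.Theory Num.Theory.
Import numFieldNormedType.Exports.

Set Implicit Arguments.
Unset Strict Implicit.
Unset Printing Implicit Defensive.

Local Open Scope ring_scope.


(** * The process and its generating functions *)

Section GeneratingFunctions.
Local Open Scope fset_scope.
Local Open Scope ring_scope.

(** The dominant pole is never located. In the recurrence of the coefficients [f n] of
    [1 / (1 - X + beta psi(X))] the weights decay factorially, so for small [beta] the ratios
    [f n.+1 / f n] stay near 1, and a bootstrap on quotients of coefficients expands them to second
    order in [beta]; multiplying these ratios gives the quasi-power.

    The parameter [beta] stays free throughout: the initial value [2u(1 - beta)] can then be
    prescribed independently of [u]. The same series is the exact solution when this value is
    [1 + v], and a majorant when [u = |v|] and the value is an upper bound of [|1 + v|]. In the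
    majorant [beta] grows by a multiple of [t^2], which lowers the growth rate by a multiple of
    [t^2].

    All errors are of order [|z| + n |z|^3], and [|x|^3 <= sqrt n] is the range in which the saddle
    [s] keeps [n |s|^3] bounded. For larger [x] nothing local is available; there the distribution
    function is controlled by the total mass 1 and by the normal tails. *)

Lemma neighbor_sym (s t : seat) : neighbor s t = neighbor t s.
Proof. by rewrite /neighbor distrC (eq_sym s.1) (eq_sym s.2). Qed.

(** The future of the process depends on the available seats alone, so the occupied set of
    [seating_prob_from] is dropped and each choice contributes a factor [v]. As there, [k] only
    bounds the recursion. *)
Fixpoint occupied_pgf_from (K : numFieldType) (v : K) (k : nat)
    (A : {fset seat}) : K :=
  if k is k'.+1 then
    if A == fset0 then 1
    else v / #|` A|%:R *
      \sum_(s <- A) occupied_pgf_from v k' (available_after A s)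
  else 1.

Definition occupied_pgf (K : numFieldType) (v : K) (A : {fset seat}) : K :=
  occupied_pgf_from v #|` A| A.

Lemma occupied_pgf_from_bound (K : numFieldType) (v : K) k (A : {fset seat}) :
  (#|` A| <= k)%N -> occupied_pgf_from v k A = occupied_pgf v A.
Proof.
rewrite /occupied_pgf; have [m] := ubnP #|` A|; elim: m k A => // m IHm [|k] A.
  by move=> _; rewrite leqn0 => /eqP ->.
rewrite ltnS => Am Ak.
have [->|A0] := eqVneq A fset0; first by rewrite cardfs0 /= ?eqxx.
have := A0; rewrite -cardfs_gt0.
case EA : #|` A| => [//|j] _ /=; rewrite (negbTE A0) EA; congr (_ * _).
apply: eq_big_seq => s sA; have := card_available_after sA.
rewrite EA ltnS => sj; have jk : (j <= k)%N by rewrite -ltnS -EA.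
have jm : (j < m)%N by rewrite -EA.
by rewrite IHm ?[RHS]IHm // ?(leq_trans sj) // (leq_ltn_trans sj).
Qed.

Lemma occupied_pgf0 (K : numFieldType) (v : K) : occupied_pgf v fset0 = 1.
Proof. by rewrite /occupied_pgf cardfs0. Qed.

Lemma occupied_pgfE (K : numFieldType) (v : K) (A : {fset seat}) :
  #|` A|%:R * occupied_pgf v A =
  v * \sum_(s <- A) occupied_pgf v (available_after A s).
Proof.
have [->|A0] := eqVneq A fset0.
  by rewrite cardfs0 mul0r big_seq_fset0 mulr0.
have := A0; rewrite -cardfs_gt0 => Ap.
rewrite {1}/occupied_pgf; case EA : #|` A| Ap => [//|j] _ /=.
rewrite (negbTE A0) EA mulrA mulrCA divff ?pnatr_eq0// mulr1.
congr (_ * _); apply: eq_big_seq => s sA; have := card_available_after sA.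
by rewrite EA ltnS => sj; rewrite occupied_pgf_from_bound.
Qed.

Lemma occupied_pgf_imfset (K : numFieldType) (v : K) (g : seat -> seat) (A : {fset seat}) :
  injective g -> (forall s t, neighbor (g s) (g t) = neighbor s t) ->
  occupied_pgf v (g @` A) = occupied_pgf v A.
Proof.
move=> gI gN; have [m] := ubnP #|` A|; elim: m A => // m IHm A.
rewrite ltnS => Am.
have [->|A0] := eqVneq A fset0; first by rewrite imfset0.
have cA : #|` g @` A|%fset = #|` A| by rewrite card_imfset.
have A1 : (#|` A|%:R : K) != 0 by rewrite pnatr_eq0 cardfs_eq0.
apply: (mulfI A1); rewrite -{1}cA !occupied_pgfE; congr (_ * _).
rewrite big_imfset /=; last by move=> ? ? _ _; exact: gI.
apply: eq_big_seq => s sA; rewrite -(IHm (available_after A s)); last first.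
  exact: leq_trans (card_available_after sA) Am.
congr occupied_pgf; apply/fsetP => t; rewrite !inE /=.
apply/andP/imfsetP => [[/imfsetP[/= t' t'A ->]]|[/= t' + ->]].
  by rewrite gN (inj_eq gI) => h; exists t' => //; rewrite !inE /= t'A.
by rewrite !inE /= => /and3P[h1 h2 h3]; rewrite gN (inj_eq gI) h2 h3 in_imfset.
Qed.

Lemma big_fsetU_disjoint (K : nmodType) (A B : {fset seat}) (F : seat -> K) :
  [disjoint A & B] ->
  \sum_(s <- A `|` B) F s = \sum_(s <- A) F s + \sum_(s <- B) F s.
Proof.
move=> dAB; rewrite -big_cat; apply: perm_big; apply: uniq_perm.
- exact: fset_uniq.
- rewrite cat_uniq !fset_uniq /= andbT; apply/hasPn => s sB; apply/negP => sA.
  by have /fdisjointP/(_ _ sA) := dAB; rewrite sB.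
- by move=> s; rewrite inE mem_cat.
Qed.

(** Independence of separated parts: the next seat falls in [A] or in [B] with odds given by their
    sizes and leaves the other part intact, so both sides satisfy the same recurrence. Induction is
    on the total number of seats. *)
Lemma occupied_pgfU (K : numFieldType) (v : K) (A B : {fset seat}) :
  {in A & B, forall s t, (s != t) && ~~ neighbor s t} ->
  occupied_pgf v (A `|` B) = occupied_pgf v A * occupied_pgf v B.
Proof.
have [m] := ubnP (#|` A| + #|` B|); elim: m A B => // m IHm A B.
rewrite ltnS => ABm AB.
have [A0|A0] := eqVneq A fset0; first by rewrite A0 fset0U occupied_pgf0 mul1r.
have dAB : [disjoint A & B].
  apply/fdisjointP => s sA; apply/negP => sB.
  by have := AB s s sA sB; rewrite eqxx.
have cAB : #|` A `|` B| = (#|` A| + #|` B|)%N.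
  by rewrite cardfsU (eqP dAB) cardfs0 subn0.
have AB0 : (#|` A `|` B|%:R : K) != 0.
  by rewrite pnatr_eq0 cAB addn_eq0 cardfs_eq0 (negbTE A0).
apply: (mulfI AB0); rewrite occupied_pgfE big_fsetU_disjoint //= cAB natrD mulrDl.
rewrite mulrDr [in RHS]mulrA occupied_pgfE [X in _ = _ + X]mulrCA occupied_pgfE.
congr (_ + _); last first.
  rewrite mulrCA [in RHS]mulr_sumr; congr (_ * _).
  apply: eq_big_seq => s sB.
  have -> : available_after (A `|` B) s = A `|` available_after B s.
    apply/fsetP => t; rewrite !inE; case tA : (t \in A) => //=.
    have /andP[h1 h2] := AB t s tA sB; rewrite h1 neighbor_sym h2.
    by [].
  rewrite IHm//; first by apply: leq_trans ABm; rewrite ltn_add2l card_available_after.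
  by move=> x y xA; rewrite !inE => /and3P[yB _ _]; exact: AB.
rewrite -mulrA mulr_suml; congr (_ * _); apply: eq_big_seq => s sA.
have -> : available_after (A `|` B) s = available_after A s `|` B.
  apply/fsetP => t; rewrite !inE; case tB : (t \in B); last by rewrite !orbF.
  by have /andP[h1 h2] := AB s t sA tB; rewrite eq_sym h1 h2 !orbT.
rewrite IHm//; first by apply: leq_trans ABm; rewrite ltn_add2r card_available_after.
by move=> x y; rewrite !inE => /and3P[xA _ _] yB; exact: AB.
Qed.

(** * Law of the number of occupied seats *)

Section CardDistribution.
Variable R : realType.

Lemma seating_prob_from_ge0 k (O A : {fset seat}) E : 0 <= seating_prob_from R k O A E.
Proof.
elim: k O A => [|k IHk] O A /=; first exact: ler0n.
case: ifP => _; first exact: ler0n.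
by rewrite mulr_ge0 ?invr_ge0 ?ler0n// sumr_ge0.
Qed.

Lemma seating_prob_from_card k (O A : {fset seat}) (e : pred nat) (N : nat) :
  (#|` O| + #|` A| < N)%N ->
  seating_prob_from R k O A (fun X => e #|` X|) =
  \sum_(j < N | e j) seating_prob_from R k O A (fun X => #|` X| == j).
Proof.
have base m : (m < N)%N -> (e m)%:R = \sum_(j < N | e j) (m == j)%:R :> R.
  move=> mN; rewrite big_mkcond (bigD1 (Ordinal mN)) //= eqxx.
  rewrite big1 ?addr0 => [|j]; first by case: (e m).
  rewrite -val_eqE /= eq_sym => /negbTE ->; by case: (e j).
elim: k O A => [|k IHk] O A ON /=.
  by rewrite base// (leq_ltn_trans _ ON)// leq_addr.
case: ifP => [_|/negbT A0].
  by rewrite base// (leq_ltn_trans _ ON)// leq_addr.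
rewrite -mulr_sumr exchange_big /=; congr (_ * _); apply: eq_big_seq => s sA.
rewrite IHk// (leq_ltn_trans _ ON)//.
have := card_available_after sA; have := cardfsU1 s O.
by case: (s \notin O) => /= ->; lia.
Qed.

(** Probabilities are real while [v] will be complex, hence the morphism [f]. Disjointness of [O]
    and [A] makes every step raise the number of occupied seats by exactly one. *)
Lemma seating_prob_from_pgf (K : numFieldType) (f : {rmorphism R -> K}) (v : K)
    k (O A : {fset seat}) (N : nat) :
  (#|` O| + #|` A| < N)%N -> [disjoint O & A] ->
  \sum_(j < N) f (seating_prob_from R k O A (fun X => #|` X| == j)) * v ^+ j
  = v ^+ #|` O| * occupied_pgf_from v k A.
Proof.
have base m : (m < N)%N ->
    \sum_(j < N) f (m == j)%:R * v ^+ j = v ^+ m.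
  move=> mN; rewrite (bigD1 (Ordinal mN)) //= eqxx rmorph1 mul1r.
  rewrite big1 ?addr0// => j; rewrite -val_eqE /= eq_sym => /negbTE ->.
  by rewrite rmorph0 mul0r.
elim: k O A => [|k IHk] O A ON dOA /=; first by rewrite base ?mulr1// (leq_ltn_trans _ ON)// leq_addr.
case: ifP => [A0|/negbT A0]; first by rewrite base ?mulr1// (leq_ltn_trans _ ON)// leq_addr.
under eq_bigr do rewrite rmorphM rmorph_sum fmorphV rmorph_nat /= -mulrA mulr_suml.
rewrite -mulr_sumr exchange_big /=.
have step s : s \in A ->
    \sum_(j < N) f (seating_prob_from R k (s |` O) (available_after A s)
                     (fun X => #|` X| == j)) * v ^+ j =
    v ^+ #|` O|.+1 * occupied_pgf_from v k (available_after A s).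
  move=> sA; have sO : s \notin O.
    by apply/negP => sO; have /fdisjointP/(_ _ sO) := dOA; rewrite sA.
  rewrite IHk ?cardfsU1 ?sO//.
    by rewrite (leq_ltn_trans _ ON)//; have := card_available_after sA; lia.
  apply/fdisjointP => t; rewrite !inE; case: eqP => [->|_] /=; first by rewrite ?andbF.
  by move=> tO; have /fdisjointP/(_ _ tO)/negbTE -> := dOA.
rewrite (eq_big_seq _ step) -mulr_sumr exprS; ring.
Qed.

End CardDistribution.

(** The test is there because [absz] would turn the negative length of a badly ordered interval into
    a positive one. *)
Definition int_interval (a b : int) : seq int :=
  [seq a + k%:Z | k <- iota 0 (if a <= b then absz (b - a + 1) else 0)].

Lemma mem_int_interval (a b c : int) : (c \in int_interval a b) = (a <= c <= b).
Proof.
apply/mapP/idP => [[k]|/andP[ac cb]].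
  by rewrite mem_iota => + ->; case: ifP; lia.
by exists (absz (c - a)); [rewrite mem_iota; case: ifP|]; lia.
Qed.

Lemma uniq_int_interval (a b : int) : uniq (int_interval a b).
Proof. by rewrite map_inj_uniq ?iota_uniq// => i j; lia. Qed.

Lemma big_int_interval (K : nmodType) (F : int -> K) (a b : int) (n : nat) :
  b = a + n%:Z - 1 ->
  \sum_(c <- int_interval a b) F c = \sum_(i < n) F (a + i%:Z).
Proof.
move=> ->; rewrite big_map; case: n => [|n]; last first.
  rewrite ifT; last by lia.
  have -> : absz (a + n.+1%:Z - 1 - a + 1) = n.+1 by lia.
  by rewrite -[iota 0 n.+1]/(index_iota 0 n.+1) big_mkord.
by rewrite ifF ?big_nil ?big_ord0//; lia.
Qed.

Definition two_rows (a b a' b' : int) : {fset seat} :=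
  [fset (true, c) | c in int_interval a b] `|`
  [fset (false, c) | c in int_interval a' b'].

Lemma in_two_rows a b a' b' (s : seat) : (s \in two_rows a b a' b') =
  if s.1 then a <= s.2 <= b else a' <= s.2 <= b'.
Proof.
rewrite in_fsetU; case: s => r c /=.
apply/orP/idP => [[/imfsetP|/imfsetP]|] /=.
- by case=> x /=; rewrite mem_int_interval => h [-> ->].
- by case=> x /=; rewrite mem_int_interval => h [-> ->].
- case: r => h; [left|right]; apply/imfsetP; exists c => //=;
    by rewrite mem_int_interval.
Qed.

Lemma big_two_rows (K : nmodType) (F : seat -> K) a b a' b' :
  \sum_(s <- two_rows a b a' b') F s =
  \sum_(c <- int_interval a b) F (true, c) +
  \sum_(c <- int_interval a' b') F (false, c).
Proof.
rewrite big_fsetU_disjoint.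
  by congr (_ + _); (rewrite big_imfset /=; last by move=> ? ? _ _ []); rewrite undup_id ?uniq_int_interval.
apply/fdisjointP => s /imfsetP[x _ ->] /=; apply/negP => /imfsetP[y _].
by [].
Qed.

Lemma in_available_after (A : {fset seat}) s t :
  (t \in available_after A s) = [&& t \in A, t != s & ~~ neighbor s t].
Proof. by rewrite !inE. Qed.

(** * Recurrences for ladders with missing corners *)

Section Shapes.
Variables (K : numFieldType) (v : K).
Let T a b a' b' := occupied_pgf v (two_rows a b a' b').

Lemma two_rows_pgf_empty a b a' b' : b < a -> b' < a' -> T a b a' b' = 1.
Proof.
move=> ba ba'; rewrite /T (_ : two_rows _ _ _ _ = fset0) ?occupied_pgf0//.
by apply/fsetP => -[r c]; rewrite in_two_rows /= inE; case: r; lia.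
Qed.

Lemma two_rows_pgf_swap a b a' b' : T a b a' b' = T a' b' a b.
Proof.
pose g (s : seat) : seat := (~~ s.1, s.2).
have gK : involutive g by case=> r c; rewrite /g /= negbK.
rewrite /T -(@occupied_pgf_imfset _ _ g) //.
- congr occupied_pgf; apply/fsetP => s; rewrite in_two_rows.
  rewrite -{1}[s]gK [LHS]mem_imfset; last exact: can_inj gK.
  by rewrite in_two_rows /=; case: s => -[].
- exact: can_inj gK.
- by case=> r c [r' c']; rewrite /neighbor /=; case: r; case: r'.
Qed.

Lemma two_rows_pgf_shift (d : int) a b a' b' x y x' y' :
  a = x + d -> b = y + d -> a' = x' + d -> b' = y' + d ->
  T a b a' b' = T x y x' y'.
Proof.
move=> -> -> -> ->; pose g (s : seat) : seat := (s.1, s.2 + d).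
pose g' (s : seat) : seat := (s.1, s.2 - d).
have gK : cancel g g' by case=> r c; rewrite /g /g' /= addrK.
have g'K : cancel g' g by case=> r c; rewrite /g /g' /= subrK.
rewrite /T -(@occupied_pgf_imfset _ _ g (two_rows x _ _ _)) //.
- congr occupied_pgf; apply/fsetP => s.
  rewrite -{2}[s]g'K [RHS]mem_imfset; last exact: can_inj gK.
  by rewrite !in_two_rows /=; case: s => -[] c /=; lia.
- exact: can_inj gK.
- by case=> r c [r' c']; rewrite /neighbor /=; lia.
Qed.

Lemma two_rows_pgf_flip a b a' b' : T a b a' b' = T (- b) (- a) (- b') (- a').
Proof.
pose g (s : seat) : seat := (s.1, - s.2).
have gK : involutive g by case=> r c; rewrite /g /= opprK.
rewrite /T -(@occupied_pgf_imfset _ _ g (two_rows a _ _ _)) //.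
- congr occupied_pgf; apply/fsetP => s.
  rewrite -{1}[s]gK [LHS]mem_imfset; last exact: can_inj gK.
  by rewrite !in_two_rows /=; case: s => -[] c /=; lia.
- exact: can_inj gK.
- by case=> r c [r' c']; rewrite /neighbor /=; lia.
Qed.

(** Occupying column [c] of one row removes columns [c - 1] to [c + 1] there and column [c] of the
    other row; what remains is two pieces without mutual neighbors, and [occupied_pgfU] applies. The
    hypotheses keep [c - 1] and [c + 1] from overshooting the ends of the other row, so that the
    pieces contain no foreign seat. *)
Lemma two_rows_pgf_split a b a' b' :
  `|a - a'| <= 1 -> `|b - b'| <= 1 ->
  #|` two_rows a b a' b'|%:R * T a b a' b' =
  v * (\sum_(c <- int_interval a b)
         T a (c - 2) a' (c - 1) * T (c + 2) b (c + 1) b' +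
       \sum_(c <- int_interval a' b')
         T a (c - 1) a' (c - 2) * T (c + 1) b (c + 2) b').
Proof.
move=> ha hb; rewrite /T occupied_pgfE big_two_rows; congr (_ * (_ + _)).
  apply: eq_big_seq => c; rewrite mem_int_interval => hc.
  rewrite -occupied_pgfU; last first.
    move=> [r x] [r' y]; rewrite !in_two_rows /neighbor /= xpair_eqE.
    by case: r; case: r' => /=; lia.
  congr occupied_pgf; apply/fsetP => -[r x].
  rewrite in_available_after in_fsetU !in_two_rows /neighbor /= xpair_eqE.
  by case: r => /=; lia.
apply: eq_big_seq => c; rewrite mem_int_interval => hc.
rewrite -occupied_pgfU; last first.
  move=> [r x] [r' y]; rewrite !in_two_rows /neighbor /= xpair_eqE.
  by case: r; case: r' => /=; lia.
congr occupied_pgf; apply/fsetP => -[r x].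
rewrite in_available_after in_fsetU !in_two_rows /neighbor /= xpair_eqE.
by case: r => /=; lia.
Qed.

Lemma card_two_rows (n n' : nat) a b a' b' :
  b = a + n%:Z - 1 -> b' = a' + n'%:Z - 1 ->
  #|` two_rows a b a' b'| = (n + n')%N.
Proof.
move=> hb hb'; rewrite -sum1_size big_two_rows.
by rewrite (big_int_interval _ hb) (big_int_interval _ hb') !sum_nat_const !card_ord !muln1.
Qed.

Definition full_pgf (n : nat) : K := T 1 n%:Z 1 n%:Z.
Definition one_corner_pgf (m : nat) : K := T 1 m%:Z 1 (m%:Z - 1).
(** The shape has [m + 1] columns. For [m = 0] its two missing corners coincide and a single seat is
    left, which is the source of the [v] in the initial value [1 + v]. *)
Definition same_row_pgf (m : nat) : K := T 1 (m%:Z + 1) 2 m%:Z.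
Definition opposite_row_pgf (m : nat) : K := T 1 m%:Z 2 (m%:Z + 1).
(* The recurrences of the two shapes mix; those of their sum close up. *)
Definition two_corners_pgf (m : nat) : K := same_row_pgf m + opposite_row_pgf m.

(** By symmetry the row of the first seat is immaterial, which cancels the factor 2 in the number
    [2n] of seats. On either side of it a piece with one missing corner is left. *)
Lemma full_pgfE n :
  n%:R * full_pgf n =
  v * \sum_(i < n) one_corner_pgf i * one_corner_pgf (n.-1 - i).
Proof.
have := @two_rows_pgf_split 1 n%:Z 1 n%:Z.
rewrite !subrr normr0 (@card_two_rows n n); [|lia|lia] => /(_ isT isT).
rewrite !(@big_int_interval _ _ 1 n%:Z n); [|lia|lia].
set s := (X in _ = _ * X -> _); set u := \sum_(i < n) _.
have -> : s = 2 * u.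
  rewrite mulr_natl mulr2n; congr (_ + _); apply: eq_bigr => -[i lti] _ /=.
    congr (_ * _); first by rewrite two_rows_pgf_swap; apply: (@two_rows_pgf_shift 0); lia.
    rewrite two_rows_pgf_flip two_rows_pgf_swap.
    by apply: (@two_rows_pgf_shift (- n%:Z - 1)); lia.
  congr (_ * _); first by apply: (@two_rows_pgf_shift 0); lia.
  by rewrite two_rows_pgf_flip; apply: (@two_rows_pgf_shift (- n%:Z - 1)); lia.
rewrite -/(full_pgf n) natrD => h.
have h2 : (2 : K) != 0 by rewrite pnatr_eq0.
by apply: (mulfI h2); rewrite [RHS]mulrCA -h; ring.
Qed.

(** The first seat leaves a one-corner piece on its left and a two-corner piece on its right: of
    opposite-row type if the seat is in the longer row, of same-row type otherwise. The last seat of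
    the longer row has nothing on its right and gives the separate term. *)
Lemma one_corner_pgfE m :
  (2 * m + 1)%N%:R * one_corner_pgf m.+1 =
  v * one_corner_pgf m +
  v * \sum_(i < m) one_corner_pgf i * two_corners_pgf (m.-1 - i).
Proof.
have := @two_rows_pgf_split 1 m.+1%:Z 1 (m.+1%:Z - 1) ltac:(lia) ltac:(lia).
rewrite (@card_two_rows m.+1 m); [|lia|lia].
rewrite (@big_int_interval _ _ 1 _ m.+1); last by lia.
rewrite (@big_int_interval _ _ 1 _ m); last by lia.
rewrite big_ord_recr /= -/(one_corner_pgf m.+1).
rewrite [X in v * (_ + X + _)](_ : _ = one_corner_pgf m); last first.
  rewrite [X in _ * X]two_rows_pgf_empty ?mulr1; [|lia|lia].
  by rewrite two_rows_pgf_swap; apply: (@two_rows_pgf_shift 0); lia.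
set s1 := \sum_(i < m) _; set s2 := \sum_(i < m) _.
have -> : (m.+1 + m = 2 * m + 1)%N by lia.
move=> ->; rewrite -mulrDr addrAC addrC; congr (_ * (_ + _)).
rewrite -big_split; apply: eq_bigr => -[i lti] _ /=; rewrite addrC /two_corners_pgf mulrDr.
congr (_ * _ + _ * _).
- by apply: (@two_rows_pgf_shift 0); lia.
- by apply: (@two_rows_pgf_shift (1 + i%:Z)); lia.
- by rewrite two_rows_pgf_swap; apply: (@two_rows_pgf_shift 0); lia.
- by rewrite two_rows_pgf_swap; apply: (@two_rows_pgf_shift (1 + i%:Z)); lia.
Qed.

Lemma same_row_pgfE m :
  (2 * m.+1)%N%:R * same_row_pgf m.+1 = v * (2 * opposite_row_pgf m +
   \sum_(i < m) (opposite_row_pgf i * opposite_row_pgf (m.-1 - i) +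
                 same_row_pgf i * same_row_pgf (m.-1 - i))).
Proof.
have := @two_rows_pgf_split 1 (m.+1%:Z + 1) 2 m.+1%:Z ltac:(lia) ltac:(lia).
rewrite (@card_two_rows m.+2 m); [|lia|lia].
rewrite (@big_int_interval _ _ 1 _ m.+2); last by lia.
rewrite (@big_int_interval _ _ 2 _ m); last by lia.
rewrite big_ord_recr big_ord_recl /= -/(same_row_pgf m.+1).
rewrite [X in v * (X + _ + _ + _)](_ : _ = opposite_row_pgf m); last first.
  rewrite two_rows_pgf_empty ?mul1r; [|lia|lia].
  by rewrite two_rows_pgf_swap; apply: (@two_rows_pgf_shift 1); lia.
rewrite [X in v * (_ + X + _)](_ : _ = opposite_row_pgf m); last first.
  rewrite [X in _ * X]two_rows_pgf_empty ?mulr1; [|lia|lia].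
  by apply: (@two_rows_pgf_shift 0); lia.
have -> : (m.+2 + m = 2 * m.+1)%N by lia.
move=> ->; congr (_ * _); rewrite big_split /= mulr_natl mulr2n.
rewrite -!addrA; congr (_ + _); rewrite addrCA; congr (_ + (_ + _)).
  apply: eq_bigr => -[i lti] _ /=; rewrite /bump ?add1n; congr (_ * _).
    by apply: (@two_rows_pgf_shift 0); lia.
  by rewrite two_rows_pgf_swap; apply: (@two_rows_pgf_shift (2 + i%:Z)); lia.
apply: eq_bigr => -[i lti] _ /=; rewrite /bump ?add1n; congr (_ * _).
  by apply: (@two_rows_pgf_shift 0); lia.
by apply: (@two_rows_pgf_shift (2 + i%:Z)); lia.
Qed.

Lemma opposite_row_pgfE m :
  (2 * m.+1)%N%:R * opposite_row_pgf m.+1 = v * (2 * same_row_pgf m +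
   \sum_(i < m) (opposite_row_pgf i * same_row_pgf (m.-1 - i) +
                 same_row_pgf i * opposite_row_pgf (m.-1 - i))).
Proof.
have := @two_rows_pgf_split 1 m.+1%:Z 2 (m.+1%:Z + 1) ltac:(lia) ltac:(lia).
rewrite (@card_two_rows m.+1 m.+1); [|lia|lia].
rewrite (@big_int_interval _ _ 1 _ m.+1); last by lia.
rewrite (@big_int_interval _ _ 2 _ m.+1); last by lia.
rewrite big_ord_recl big_ord_recr /= -/(opposite_row_pgf m.+1).
rewrite [X in v * (X + _ + _)](_ : _ = same_row_pgf m); last first.
  rewrite two_rows_pgf_empty ?mul1r; [|lia|lia].
  by rewrite two_rows_pgf_swap; apply: (@two_rows_pgf_shift 1); lia.
rewrite [X in v * (_ + (_ + X))](_ : _ = same_row_pgf m); last first.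
  rewrite [X in _ * X]two_rows_pgf_empty ?mulr1; [|lia|lia].
  by apply: (@two_rows_pgf_shift 0); lia.
have -> : (m.+1 + m.+1 = 2 * m.+1)%N by lia.
move=> ->; congr (_ * _); rewrite big_split /= mulr_natl mulr2n.
rewrite -!addrA; congr (_ + _); rewrite addrA [RHS]addrC; congr (_ + _ + _).
  apply: eq_bigr => -[i lti] _ /=; rewrite /bump ?add1n; congr (_ * _).
    by apply: (@two_rows_pgf_shift 0); lia.
  by rewrite two_rows_pgf_swap; apply: (@two_rows_pgf_shift (2 + i%:Z)); lia.
apply: eq_bigr => -[i lti] _ /=; rewrite /bump ?add1n; congr (_ * _).
  by apply: (@two_rows_pgf_shift 0); lia.
by apply: (@two_rows_pgf_shift (2 + i%:Z)); lia.
Qed.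

Lemma two_corners_pgfE m :
  (2 * m.+1)%N%:R * two_corners_pgf m.+1 =
  2 * v * two_corners_pgf m +
  v * \sum_(i < m) two_corners_pgf i * two_corners_pgf (m.-1 - i).
Proof.
rewrite mulrDr same_row_pgfE opposite_row_pgfE -mulrDr addrACA -big_split /=.
rewrite mulrDr /two_corners_pgf; congr (_ + _); first by ring.
by congr (_ * _); apply: eq_bigr => i _ /=; ring.
Qed.

Lemma one_corner_pgf0 : one_corner_pgf 0 = 1.
Proof. by apply: two_rows_pgf_empty; lia. Qed.

Lemma two_corners_pgf0 : two_corners_pgf 0 = 1 + v.
Proof.
rewrite /two_corners_pgf [RHS]addrC; congr (_ + _); last first.
  by apply: two_rows_pgf_empty; lia.
(* The bottom interval [[2, 0]] is replaced by [[2, 1]], equally empty but of the form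
   [b' = a' + 0 - 1] that [card_two_rows] and [big_int_interval] ask for. *)
have -> : same_row_pgf 0 = T 1 1%:Z 2 1%:Z.
  by congr occupied_pgf; apply/fsetP => -[[] c]; rewrite !in_two_rows /=; lia.
have := @two_rows_pgf_split 1 1%:Z 2 1%:Z ltac:(lia) ltac:(lia).
rewrite (@card_two_rows 1 0)//.
rewrite (@big_int_interval _ _ 1 _ 1); last by lia.
rewrite (@big_int_interval _ _ 2 _ 0); last by lia.
rewrite big_ord1 big_ord0 addr0 mul1r /= => ->.
rewrite !two_rows_pgf_empty; [by rewrite !mulr1|lia..].
Qed.
End Shapes.

End GeneratingFunctions.

(** * Solution of the recurrences by formal power series *)

Definition fps (K : Type) : Type := nat -> K.

Section FormalPowerSeries.
Variable K : fieldType.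
Implicit Types a b c : fps K.

HB.instance Definition _ := gen_eqMixin (fps K).
HB.instance Definition _ := gen_choiceMixin (fps K).

Definition fps_add a b : fps K := fun n => a n + b n.
Definition fps_opp a : fps K := fun n => - a n.
Definition fps_const (x : K) : fps K := fun n => if n is 0 then x else 0.
Definition fps_mul a b : fps K := fun n => \sum_(i < n.+1) a i * b (n - i)%N.
Definition fps_X : fps K := fun n => (n == 1)%:R.

Lemma fps_addA : associative fps_add.
Proof. by move=> a b c; apply/funext => n; rewrite /fps_add addrA. Qed.
Lemma fps_addC : commutative fps_add.
Proof. by move=> a b; apply/funext => n; rewrite /fps_add addrC. Qed.
Lemma fps_add0 : left_id (fps_const 0) fps_add.
Proof. by move=> a; apply/funext => -[|n]; rewrite /fps_add /= add0r. Qed.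
Lemma fps_addN : left_inverse (fps_const 0) fps_opp fps_add.
Proof. by move=> a; apply/funext => -[|n]; rewrite /fps_add /fps_opp /= addNr. Qed.

HB.instance Definition _ :=
  GRing.isZmodule.Build (fps K) fps_addA fps_addC fps_add0 fps_addN.

Let trunc N a : {poly K} := \poly_(i < N.+1) a i.

(** Coefficient [n] of a product involves finitely many coefficients, so commutativity and
    associativity are inherited from polynomials. *)
Let fps_mul_trunc N a b n : (n <= N)%N ->
  fps_mul a b n = (trunc N a * trunc N b)`_n.
Proof.
move=> nN; rewrite coefM; apply: eq_bigr => -[i /= lti] _.
by rewrite !coef_poly !ifT//; lia.
Qed.

Lemma fps_mulC : commutative fps_mul.
Proof. by move=> a b; apply/funext => n; rewrite !(@fps_mul_trunc n) // mulrC. Qed.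

Lemma fps_mulA : associative fps_mul.
Proof.
move=> a b c; apply/funext => n.
transitivity ((trunc n a * (trunc n b * trunc n c))`_n).
  rewrite coefM; apply: eq_bigr => -[i /= lti] _.
  by rewrite coef_poly lti (@fps_mul_trunc n)//; lia.
rewrite mulrA coefM; apply: eq_bigr => -[i /= lti] _.
rewrite (@fps_mul_trunc n); last by lia.
by rewrite [(trunc n c)`__]coef_poly ifT//; lia.
Qed.

Lemma fps_mul1 : left_id (fps_const 1) fps_mul.
Proof.
move=> a; apply/funext => n; rewrite /fps_mul big_ord_recl /= mul1r subn0.
by rewrite big1 ?addr0// => i _; rewrite mul0r.
Qed.

Lemma fps_mulDl : left_distributive fps_mul fps_add.
Proof.
move=> a b c; apply/funext => n; rewrite /fps_mul /fps_add -big_split /=.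
by apply: eq_bigr => i _; rewrite mulrDl.
Qed.

Lemma fps_1neq0 : fps_const 1 != fps_const 0.
Proof. by apply/eqP => /(congr1 (@^~ 0%N)) /eqP; rewrite /= oner_eq0. Qed.

HB.instance Definition _ := GRing.Zmodule_isComNzRing.Build (fps K)
  fps_mulA fps_mulC fps_mul1 fps_mulDl fps_1neq0.

Lemma coefpsD a b n : (a + b) n = a n + b n. Proof. by []. Qed.
Lemma coefpsN a n : (- a) n = - a n. Proof. by []. Qed.
Lemma coefps1 n : (1 : fps K) n = (n == 0)%:R. Proof. by case: n. Qed.
Lemma coefpsM a b n : (a * b) n = \sum_(i < n.+1) a i * b (n - i)%N.
Proof. by []. Qed.
Lemma coefpsMC x b n : (fps_const x * b) n = x * b n.
Proof.
rewrite coefpsM big_ord_recl /= subn0 big1 ?addr0// => i _.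
by rewrite mul0r.
Qed.
Lemma coefpsMX0 b : (fps_X * b) 0%N = 0.
Proof. by rewrite coefpsM big_ord1 /fps_X mul0r. Qed.
Lemma coefpsMXS b n : (fps_X * b) n.+1 = b n.
Proof.
rewrite coefpsM big_ord_recl {1}/fps_X /= mul0r add0r big_ord_recl.
rewrite {1}/fps_X /= mul1r subn1 big1 ?addr0// => i _.
by rewrite {1}/fps_X /= mul0r.
Qed.

Lemma coefps_natr m b n : (m%:R * b) n = m%:R * b n.
Proof.
suff -> : m%:R = fps_const m%:R by rewrite coefpsMC.
apply/funext; elim: m => [|m IH] n'; first by case: n'.
by rewrite -natr1 coefpsD IH; case: n' => [|n'] /=; rewrite ?natr1 ?addr0.
Qed.

(** The operator [X d/dX]: a derivation that keeps indices in place, as the left-hand sides of the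
    recurrences do. *)
Definition fps_euler a : fps K := fun n => n%:R * a n.

Lemma fps_eulerD a b : fps_euler (a + b) = fps_euler a + fps_euler b.
Proof. by apply/funext => n; rewrite /fps_euler !coefpsD mulrDr. Qed.

Lemma fps_eulerC x : fps_euler (fps_const x) = 0.
Proof. by apply/funext => -[|n]; rewrite /fps_euler /= ?mul0r ?mulr0. Qed.

Lemma fps_eulerX : fps_euler fps_X = fps_X.
Proof.
by apply/funext => -[|[|n]]; rewrite /fps_euler /fps_X /= ?mulr0 ?mulr1.
Qed.

Lemma fps_eulerM a b : fps_euler (a * b) = fps_euler a * b + a * fps_euler b.
Proof.
apply/funext => n; rewrite /fps_euler coefpsD !coefpsM mulr_sumr -big_split /=.
apply: eq_bigr => -[i /= lti] _.
have -> : n%:R = i%:R + (n - i)%:R :> K by rewrite -natrD subnKC.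
by rewrite mulrDl -!mulrA; congr (_ + _); rewrite mulrCA.
Qed.

(** The latest coefficient comes first, so that entry [i] of the list is exactly the one that
    convolution pairs with [a i.+1]. *)
Fixpoint fps_inv_rev_coefs a (n : nat) : seq K :=
  if n is n'.+1 then
    let s := fps_inv_rev_coefs a n' in
    - \sum_(i < n'.+1) a i.+1 * s`_i :: s
  else [:: 1].

(* An inverse only when [a 0 = 1]: the constant coefficient is never read. *)
Definition fps_inv a : fps K := fun n => head 0 (fps_inv_rev_coefs a n).

Lemma fps_inv0 a : fps_inv a 0%N = 1. Proof. by []. Qed.

Lemma fps_invS a n :
  fps_inv a n.+1 = - \sum_(i < n.+1) a i.+1 * fps_inv a (n - i)%N.
Proof.
rewrite /fps_inv /=; congr (- _); apply: eq_bigr => -[i /= lti] _.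
congr (_ * _); elim: n i lti => [|n IH] [|i]//= lti.
by rewrite IH// subSS.
Qed.

Lemma mulfps_inv a : a 0%N = 1 -> a * fps_inv a = 1.
Proof.
move=> a0; apply/funext => -[|n]; rewrite coefpsM.
  by rewrite big_ord1 a0 mul1r.
rewrite big_ord_recl a0 mul1r fps_invS /=.
by rewrite addrC; apply/eqP; rewrite subr_eq0; apply/eqP/eq_bigr.
Qed.

End FormalPowerSeries.

(** * Explicit solution of the recurrences *)

Section LadderSeries.
Variables (K : numFieldType).

Definition psi_coef : fps K :=
  fun n => if (n < 2)%N then 0 else (-1) ^+ n / n`!%:R.

Definition denom (beta : K) : fps K :=
  1 - fps_X K + fps_const beta * psi_coef.

Definition recip (beta : K) : fps K := fps_inv (denom beta).

(** Coefficients of the power series solution [C] of [2 X C' = (1 - X) C - psi] with [C(0) = 0].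
    Inserting [Q = N / D], with [D] the series [denom beta], into the equation for one missing
    corner leaves [2 X N' = (1 - X) N - D], which [N = 1 + beta C] solves with a [C] that does not
    depend on [beta]. *)
Fixpoint corr_coef (n : nat) : K :=
  if n is n'.+1 then - (corr_coef n' + psi_coef n) / (2 * n' + 1)%N%:R else 0.

Definition corr : fps K := corr_coef.

Definition numer (beta : K) : fps K := 1 + fps_const beta * corr.

Lemma denom0 beta : denom beta 0%N = 1.
Proof. by rewrite /denom !coefpsD coefpsN coefps1 coefpsMC /psi_coef mulr0 subr0 addr0. Qed.

Lemma mul_denom_recip beta : denom beta * recip beta = 1.
Proof. exact: mulfps_inv (denom0 beta). Qed.

Lemma euler_psi :
  fps_euler psi_coef = - fps_X K * psi_coef + fps_X K * fps_X K.
Proof.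
apply/funext => -[|[|[|n]]].
- by rewrite /fps_euler coefpsD mulNr coefpsN !coefpsMX0 mul0r oppr0 addr0.
- by rewrite /fps_euler coefpsD mulNr coefpsN !coefpsMXS /fps_X /psi_coef /= mulr0 oppr0 addr0.
- rewrite /fps_euler coefpsD mulNr coefpsN !coefpsMXS /fps_X /psi_coef /=.
  by rewrite sqrrN expr1n oppr0 add0r mul1r divff// pnatr_eq0.
- rewrite /fps_euler coefpsD mulNr coefpsN !coefpsMXS /fps_X /psi_coef /= addr0.
  have h : (n.+2`!%:R : K) != 0 by rewrite pnatr_eq0 -lt0n fact_gt0.
  have h' : (n.+3%:R : K) != 0 by rewrite pnatr_eq0.
  rewrite factS natrM exprS; move: h h'.
  move: (_`!%:R) (_.+3%:R) => F N h h'; field; by rewrite h h'.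
Qed.

(** The series for two missing corners obeys a Riccati equation, which becomes linear for its
    reciprocal. This is the linear equation; it follows from [psi' = X - psi]. *)
Lemma euler_denom beta : fps_euler (denom beta) =
  - fps_X K * denom beta - (1 - fps_const beta) * fps_X K * fps_X K.
Proof.
have E1 : fps_euler (1 : fps K) = 0 by exact: fps_eulerC.
have EN : fps_euler (- fps_X K) = - fps_X K.
  by apply/funext => n; rewrite /fps_euler coefpsN mulrN -/(fps_euler _ _) -{2}[fps_X K]fps_eulerX.
rewrite /denom !fps_eulerD E1 EN fps_eulerM fps_eulerC euler_psi.
ring.
Qed.

Lemma euler_recip beta : fps_euler (recip beta) =
  fps_X K * recip beta
  + (1 - fps_const beta) * fps_X K * fps_X K * recip beta * recip beta.
Proof.
have h := mul_denom_recip beta.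
have : fps_euler (denom beta * recip beta) = 0 by rewrite h fps_eulerC.
rewrite fps_eulerM euler_denom => /(congr1 (fun s => recip beta * s)).
rewrite mulr0; set D := denom beta in h *; set f := recip beta in h *.
set e := fps_euler f; set b := fps_const beta; set X := fps_X K => H.
have H2 : e * (D * f) = X * f * (D * f) + (1 - b) * X * X * f * f.
  by apply/eqP; rewrite -subr_eq0 -H; apply/eqP; ring.
by move: H2; rewrite h !mulr1.
Qed.

Lemma euler_numer beta : 2 * fps_euler (numer beta) =
  (1 - fps_X K) * numer beta - denom beta.
Proof.
have E1 : fps_euler (1 : fps K) = 0 by exact: fps_eulerC.
have EC : 2 * fps_euler corr = (1 - fps_X K) * corr - psi_coef.
  apply/funext => n; rewrite coefps_natr /fps_euler !coefpsD coefpsN mulrBl mul1r coefpsD coefpsN.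
  case: n => [|n]; first by rewrite coefpsMX0 /psi_coef /= mul0r mulr0 !subr0.
  rewrite coefpsMXS /=.
  have h' : ((2 * n + 1)%N%:R : K) != 0 by rewrite pnatr_eq0; lia.
  have e : (2 * n + 1)%N%:R = 2 * n.+1%:R - 1 :> K by rewrite natrD natrM -natr1; ring.
  rewrite e in h' *; move: (n.+1%:R) h' => N h'; field; exact: h'.
rewrite /numer fps_eulerD E1 fps_eulerM fps_eulerC mul0r !add0r mulrCA EC /denom.
ring.
Qed.

Definition one_corner_series beta : fps K := numer beta * recip beta.

Lemma euler_one_corner beta : 2 * fps_euler (one_corner_series beta) =
  one_corner_series beta - 1 + fps_X K * one_corner_series beta
  + fps_const (2 * (1 - beta)) * (fps_X K * (fps_X K * (one_corner_series beta * recip beta))).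
Proof.
have h := mul_denom_recip beta; have hn := euler_numer beta.
rewrite /one_corner_series fps_eulerM mulrDr mulrA hn euler_recip.
have -> : fps_const (2 * (1 - beta)) = 2 * (1 - fps_const beta) :> fps K.
  apply/funext => n; rewrite coefps_natr coefpsD coefps1 coefpsN.
  by case: n => [|n] //=; rewrite subrr mulr0.
rewrite [((1 - _) * _ - _) * _]mulrBl h; ring.
Qed.

(* For the generating functions Q(z) and S(z) this is
   [2 z Q' = Q - 1 + u z Q + u z^2 Q S] and [2 S' = 2 u S + u z S^2], whose
   solution is S = 2 u (1 - beta) / (1 - u z + beta psi(u z)), with
   psi(X) = e^-X - 1 + X and [a = 2 u (1 - beta)]. *)
Definition ladder_rec (u a : K) (Q S : nat -> K) :=
  [/\ Q 0%N = 1, S 0%N = a,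
   forall m, (2 * m + 1)%N%:R * Q m.+1 =
     u * Q m + u * \sum_(i < m) Q i * S (m.-1 - i)%N &
   forall m, (2 * m.+1)%N%:R * S m.+1 =
     2 * u * S m + u * \sum_(i < m) S i * S (m.-1 - i)%N].

Lemma coefps_XX (g : fps K) m :
  (fps_X K * (fps_X K * g)) m.+1 = if m is m'.+1 then g m' else 0.
Proof. by rewrite coefpsMXS; case: m => [|m]; rewrite ?coefpsMX0 ?coefpsMXS. Qed.

(** The dilation of [X] by [u] supplies the factors [u] of the recurrences. Since [beta] is
    arbitrary, every initial value of [S] is reached when [u] is nonzero. *)
Lemma ladder_rec_series (u beta : K) :
  ladder_rec u (2 * u * (1 - beta))
    (fun m => u ^+ m * one_corner_series beta m)
    (fun m => 2 * u * (1 - beta) * u ^+ m * recip beta m).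
Proof.
split.
- rewrite expr0 mul1r /one_corner_series coefpsM big_ord1.
  by rewrite /numer coefpsD coefps1 coefpsMC /recip fps_inv0 mulr1 [corr _]/= mulr0 addr0.
- by rewrite /recip fps_inv0 !mulr1.
- move=> m.
  have := congr1 (@^~ m.+1) (euler_one_corner beta).
  rewrite /= coefps_natr !coefpsD coefpsN coefps1 subr0 coefpsMXS coefpsMC coefps_XX /fps_euler.
  set Q := one_corner_series beta => H.
  have {}H : (2 * m + 1)%N%:R * Q m.+1 = Q m + 2 * (1 - beta) *
      (if m is m'.+1 then (Q * recip beta) m' else 0).
    have -> : (2 * m + 1)%N%:R = 2 * m.+1%:R - 1 :> K.
      by rewrite natrD natrM -natr1; ring.
    transitivity (2 * (m.+1%:R * Q m.+1) - Q m.+1); first by ring.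
    rewrite H. set c := (X in _ * X). ring.
  rewrite mulrCA H mulrDr exprS mulrA; congr (_ + _).
  case: m {H} => [|m]; first by rewrite big_ord0 !mulr0.
  rewrite coefpsM !mulr_sumr; apply: eq_bigr => -[i /= lti] _.
  have -> : u ^+ m.+1 = u * u ^+ i * u ^+ (m - i).
    by rewrite -mulrA -exprD subnKC// exprS.
  by ring.
- move=> m.
  have := congr1 (@^~ m.+1) (euler_recip beta).
  have -> : (1 - fps_const beta) * fps_X K * fps_X K * recip beta * recip beta =
     fps_const (1 - beta) * (fps_X K * (fps_X K * (recip beta * recip beta))).
    have -> : fps_const (1 - beta) = 1 - fps_const beta :> fps K.
      apply/funext => n; rewrite coefpsD coefps1 coefpsN.
      by case: n => [|n] //=; rewrite subrr.
    ring.
  rewrite coefpsD coefpsMXS coefpsMC coefps_XX /fps_euler.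
  set f := recip beta => H.
  rewrite [(2 * _)%:R]natrM.
  transitivity (2 * (2 * u * (1 - beta)) * u ^+ m.+1 * (m.+1%:R * f m.+1)); first by ring.
  rewrite H exprS mulrDr; congr (_ + _); first by ring.
  case: m {H} => [|m]; first by rewrite big_ord0 !mulr0.
  rewrite coefpsM !mulr_sumr; apply: eq_bigr => -[i /= lti] _.
  have -> : u ^+ m.+1 = u * u ^+ i * u ^+ (m - i).
    by rewrite -mulrA -exprD subnKC// exprS.
  by ring.
Qed.

Lemma ladder_rec_majorant (u a : K) Q S (u' a' : K) Q' S' :
  ladder_rec u a Q S -> ladder_rec u' a' Q' S' ->
  `|u| <= u' -> `|a| <= a' ->
  forall m, `|Q m| <= Q' m /\ `|S m| <= S' m.
Proof.
move=> [q0 s0 qr sr] [q0' s0' qr' sr'] uu aa m.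
elim/ltn_ind: m => -[|m] IH; first by rewrite q0 q0' s0 s0' normr1.
have conv (f f' g g' : nat -> K) : (forall k, (k <= m)%N -> `|f k| <= f' k) ->
   (forall k, (k <= m)%N -> `|g k| <= g' k) ->
   `|\sum_(i < m) f i * g (m.-1 - i)%N| <= \sum_(i < m) f' i * g' (m.-1 - i)%N.
  move=> hf hg; apply: le_trans (ler_norm_sum _ _ _) _; apply: ler_sum => -[i /= lti] _.
  by rewrite normrM ler_pM// ?hf ?hg//; lia.
have hQ k : (k <= m)%N -> `|Q k| <= Q' k by move=> km; have [] := IH k km.
have hS k : (k <= m)%N -> `|S k| <= S' k by move=> km; have [] := IH k km.
split.
- have p : 0 < (2 * m + 1)%N%:R :> K by rewrite ltr0n; lia.
  rewrite -(ler_pM2l p) qr' -[X in X * `|_|]ger0_norm ?ler0n// -normrM qr.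
  apply: le_trans (ler_normD _ _) _; rewrite !normrM; apply: lerD.
    by rewrite ler_pM// hQ.
  by rewrite ler_pM//; exact: conv.
- have p : 0 < (2 * m.+1)%N%:R :> K by rewrite ltr0n; lia.
  rewrite -(ler_pM2l p) sr' -[X in X * `|_|]ger0_norm ?ler0n// -normrM sr.
  apply: le_trans (ler_normD _ _) _; rewrite !normrM; apply: lerD.
    by rewrite normr_nat ler_pM ?mulr_ge0 ?hS// ler_wpM2l.
  by rewrite ler_pM//; exact: conv.
Qed.

Lemma ladder_rec_unique (u a : K) Q S Q' S' :
  ladder_rec u a Q S -> ladder_rec u a Q' S' ->
  forall m, Q m = Q' m /\ S m = S' m.
Proof.
move=> [q0 s0 qr sr] [q0' s0' qr' sr'] m.
elim/ltn_ind: m => -[|m] IH; first by rewrite q0 q0' s0 s0'.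
have hQ k : (k <= m)%N -> Q k = Q' k by move=> km; have [] := IH k km.
have hS k : (k <= m)%N -> S k = S' k by move=> km; have [] := IH k km.
split.
- have p : (2 * m + 1)%N%:R != 0 :> K by rewrite pnatr_eq0; lia.
  apply: (mulfI p); rewrite qr qr' hQ//; congr (_ + _ * _).
  by apply: eq_bigr => -[i /= lti] _; rewrite hQ ?hS//; lia.
- have p : (2 * m.+1)%N%:R != 0 :> K by rewrite pnatr_eq0; lia.
  apply: (mulfI p); rewrite sr sr' hS//; congr (_ + _ * _).
  by apply: eq_bigr => -[i /= lti] _; rewrite !hS//; lia.
Qed.

End LadderSeries.

(** * Quasi-powers near the origin *)

Section ComplexModulus.
Local Open Scope complex_scope.
Variable R : realType.
Implicit Types x y z : R[i].

(** The norm of [R[i]] is itself an element of [R[i]]; the estimates below are between real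
    numbers. *)
Definition cabs (z : R[i]) : R := Normc.normc z.

Lemma cabs0 : cabs 0 = 0. Proof. exact: Normc.normc0. Qed.
Lemma cabs1 : cabs 1 = 1. Proof. exact: Normc.normc1. Qed.
Lemma cabs_norm z : `|z| = (cabs z)%:C.
Proof. by case: z => a b; rewrite normc_def. Qed.
Lemma cabs_ge0 z : 0 <= cabs z.
Proof. by case: z => a b; rewrite sqrtr_ge0. Qed.
Lemma cabsM x y : cabs (x * y) = cabs x * cabs y. Proof. exact: Normc.normcM. Qed.
Lemma cabsV x : cabs x^-1 = (cabs x)^-1. Proof. exact: Normc.normcV. Qed.
Lemma cabsN x : cabs (- x) = cabs x. Proof. exact: normcN. Qed.
Lemma cabsX x n : cabs (x ^+ n) = cabs x ^+ n.
Proof. by elim: n => [|n IH]; rewrite ?cabs1// !exprS cabsM IH. Qed.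
Lemma cabsD x y : cabs (x + y) <= cabs x + cabs y. Proof. exact: le_normcD. Qed.
Lemma cabsB x y : cabs (x - y) <= cabs x + cabs y.
Proof. by rewrite -(cabsN y) cabsD. Qed.
Lemma cabs_distC x y : cabs (x - y) = cabs (y - x).
Proof. by rewrite -cabsN opprB. Qed.
Lemma cabs_subl x y : cabs x - cabs y <= cabs (x - y).
Proof. by rewrite lerBlDr -{1}(subrK y x) cabsD. Qed.
Lemma cabs_gt0 x : (0 < cabs x) = (x != 0).
Proof.
rewrite lt0r cabs_ge0 andbT; congr (~~ _).
by apply/eqP/eqP => [/Normc.eq0_normc//|->]; exact: cabs0.
Qed.
Lemma cabs_real (a : R) : cabs a%:C = `|a|.
Proof. by rewrite /cabs /= expr0n addr0 sqrtr_sqr. Qed.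
Lemma cabs_nat n : cabs n%:R = n%:R.
Proof. by rewrite -(rmorph_nat (real_complex R)) cabs_real normr_nat. Qed.
Lemma cabs_sum (I : Type) (r : seq I) (P : pred I) (F : I -> R[i]) :
  cabs (\sum_(i <- r | P i) F i) <= \sum_(i <- r | P i) cabs (F i).
Proof.
elim/big_ind2: _ => [|x a y b ha hb|//]; first by rewrite cabs0.
by apply: le_trans (cabsD _ _) _; exact: lerD.
Qed.
Lemma Re_le_cabs z : `|complex.Re z| <= cabs z.
Proof. by case: z => a b /=; rewrite -sqrtr_sqr ler_wsqrtr// lerDl sqr_ge0. Qed.
Lemma Im_le_cabs z : `|complex.Im z| <= cabs z.
Proof. by case: z => a b /=; rewrite -sqrtr_sqr ler_wsqrtr// lerDr sqr_ge0. Qed.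
Lemma cabs_le_ReIm (a b : R) : cabs (a +i* b) <= `|a| + `|b|.
Proof.
rewrite -[leRHS]ger0_norm ?addr_ge0// -sqrtr_sqr ler_wsqrtr//.
rewrite sqrrD !real_normK ?num_real// addrAC lerDl.
by rewrite mulrn_wge0// mulr_ge0.
Qed.

End ComplexModulus.


(** * Taylor estimates for the real and complex exponential *)

Section SeriesTail.
Local Open Scope classical_set_scope.
Local Open Scope ring_scope.
Variable R : realType.

Lemma ge0_lerXn2r (a c : R) n : 0 <= a -> a <= c -> a ^+ n <= c ^+ n.
Proof. by move=> a0 ac; apply: lerXn2r; rewrite ?nnegrE// (le_trans a0). Qed.

Lemma fact_ge_expn2 n : (2 ^ n <= 2 * n`!)%N.
Proof.
elim: n => [|[|n] IH] //; rewrite expnS factS.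
by move: IH; move: (2 ^ n.+1)%N (n.+1`!) => e f; nia.
Qed.

Lemma inv_fact_le n : (n`!%:R : R)^-1 <= 2 * 2^-1 ^+ n.
Proof.
rewrite exprVn ler_pdivlMr ?exprn_gt0// ler_pdivrMl ?ltr0n ?fact_gt0//.
by rewrite -natrX mulrC -natrM ler_nat fact_ge_expn2.
Qed.

Lemma series_tail_le (a : R^nat) (l c : R) (n : nat) :
  series a @ \oo --> l ->
  (forall k, (n <= k)%N -> `|a k| <= c * 2^-1 ^+ k) ->
  `|l - series a n| <= 2 * c * 2^-1 ^+ n.
Proof.
move=> al hc.
have c0 : 0 <= c.
  have := le_trans (normr_ge0 _) (hc n (leqnn n)).
  by rewrite pmulr_lge0// exprn_gt0.
have geo m : \sum_(n <= k < n + m) c * 2^-1 ^+ k <= 2 * c * 2^-1 ^+ n - 2 * c * 2^-1 ^+ (n + m).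
  elim: m => [|m IH]; first by rewrite addn0 big_geq// subrr.
  rewrite addnS big_nat_recr ?leq_addr//=.
  have := lerD IH (lexx (c * 2^-1 ^+ (n + m))).
  by rewrite (exprS _ (n + m)); lra.
have fin m : (n <= m)%N -> `|series a m - series a n| <= 2 * c * 2^-1 ^+ n.
  move=> nm; rewrite sub_series nm; apply: le_trans (ler_norm_sum _ _ _) _.
  have := geo (m - n)%N; rewrite subnKC// => h.
  apply: le_trans (_ : _ <= \sum_(n <= k < m) c * 2^-1 ^+ k) _.
    by rewrite !big_nat; apply: ler_sum => k /andP[nk _]; exact: hc.
  by apply: le_trans h _; rewrite gerBl !mulr_ge0// exprn_ge0.
have cv : (fun m => `|series a m - series a n|) @ \oo --> `|l - series a n|.
  by apply: cvg_norm; apply: cvgB => //; exact: cvg_cst.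
apply: (cvgr_to_le cv).
near=> m; apply: fin; near: m; exact: nbhs_infty_ge.
Unshelve. all: by end_near.
Qed.

Lemma expR_cvg (x : R) : series (exp_coeff x) @ \oo --> expR x.
Proof. exact: is_cvg_series_exp_coeff. Qed.

Lemma exp_partial_sum_le (c : R) n : 0 <= c ->
  \sum_(k < n) c ^+ k / k`!%:R <= expR c.
Proof.
move=> c0; rewrite -(big_mkord xpredT (fun k => c ^+ k / k`!%:R)).
have h : nondecreasing_seq (series (exp_coeff c)).
  by apply: nondecreasing_series => k _ _; exact: exp_coeff_ge0.
exact: nondecreasing_cvgn_le h (is_cvg_series_exp_coeff c) n.
Qed.

Lemma series_tail3 (a : R^nat) (l x : R) : `|x| <= 1 ->
  series a @ \oo --> l ->
  (forall k, `|a k| <= `|x| ^+ k / k`!%:R) ->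
  `|l - (a 0%N + a 1%N + a 2%N)| <= `|x| ^+ 3.
Proof.
move=> x1 al ha.
have -> : a 0%N + a 1%N + a 2%N = series a 3.
  by rewrite /series /= big_mkord !big_ord_recr big_ord0 /= add0r.
apply: le_trans (@series_tail_le a l (2 * `|x| ^+ 3) 3 al _) _ => [k k3|].
  apply: le_trans (ha k) _.
  have xk : `|x| ^+ k <= `|x| ^+ 3 by rewrite ler_wiXn2l.
  apply: (@le_trans _ _ (`|x| ^+ 3 * (2 * 2^-1 ^+ k))).
    by apply: ler_pM; rewrite ?exprn_ge0 ?invr_ge0 ?inv_fact_le.
  by rewrite mulrA [_ * 2]mulrC.
have p : 0 <= `|x| ^+ 3 by rewrite exprn_ge0.
rewrite !exprS expr0; move: p; lra.
Qed.
End SeriesTail.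

Section ComplexExponential.
Local Open Scope complex_scope.
Variable R : realType.
Implicit Types z w : R[i].

Lemma cos_cvg (x : R) : (series (cos_coeff x) @ \oo --> cos x)%classic.
Proof. by rewrite unlock; exact: is_cvg_series_cos_coeff. Qed.

Lemma sin_cvg (x : R) : (series (sin_coeff x) @ \oo --> sin x)%classic.
Proof. by rewrite unlock; exact: is_cvg_series_sin_coeff. Qed.

Lemma expR_taylor2 (x : R) : `|x| <= 1 ->
  `|expR x - (1 + x + x ^+ 2 / 2)| <= `|x| ^+ 3.
Proof.
move=> x1; have := series_tail3 x1 (@expR_cvg R x).
rewrite /exp_coeff /= expr0 expr1 !divr1; apply => k.
by rewrite normrM normrX normfV normr_nat.
Qed.

Lemma cos_taylor2 (x : R) : `|x| <= 1 ->
  `|cos x - (1 - x ^+ 2 / 2)| <= `|x| ^+ 3.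
Proof.
move=> x1; have := series_tail3 x1 (@cos_cvg x).
have -> : cos_coeff x 0%N + cos_coeff x 1%N + cos_coeff x 2%N = 1 - x ^+ 2 / 2.
  rewrite /cos_coeff /= -?exprnP; by rewrite !factS fact0 ?muln1; field.
apply => k.
rewrite /cos_coeff /= -?exprnP !normrM normfV normr_nat normrX normr_nat normrX normrN1.
rewrite expr1n mulr1 -mulrA ler_piMl ?mulr_ge0 ?invr_ge0 ?exprn_ge0//.
by case: (odd k).
Qed.

Lemma sin_taylor2 (x : R) : `|x| <= 1 -> `|sin x - x| <= `|x| ^+ 3.
Proof.
move=> x1; have := series_tail3 x1 (@sin_cvg x).
have -> : sin_coeff x 0%N + sin_coeff x 1%N + sin_coeff x 2%N = x.
  rewrite /sin_coeff /= -?exprnP; by rewrite !factS fact0  ?muln1; field.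
apply => k.
rewrite /sin_coeff /= -?exprnP !normrM normfV normr_nat normrX normr_nat normrX normrN1.
rewrite expr1n mulr1 -mulrA ler_piMl ?mulr_ge0 ?invr_ge0 ?exprn_ge0//.
by case: (odd k).
Qed.

Definition cexp z : R[i] :=
  (expR (complex.Re z))%:C * (cos (complex.Im z) +i* sin (complex.Im z)).

Lemma cexpD z w : cexp (z + w) = cexp z * cexp w.
Proof.
case: z w => a b [c d]; rewrite /cexp /= expRD cosD sinD.
by apply/eqP; rewrite eq_complex /=; apply/andP; split; apply/eqP; ring.
Qed.

Lemma cexp_real (x : R) : cexp x%:C = (expR x)%:C.
Proof. by rewrite /cexp /= cos0 sin0 mulr1. Qed.

Lemma cexp0 : cexp 0 = 1.
Proof. by rewrite (cexp_real 0) expR0. Qed.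

Lemma cexpX z n : cexp z ^+ n = cexp (n%:R * z).
Proof.
elim: n => [|n IH]; first by rewrite mul0r cexp0.
by rewrite exprS IH -cexpD -natr1 mulrDl mul1r addrC.
Qed.

Lemma cabs_cexp z : cabs (cexp z) = expR (complex.Re z).
Proof.
rewrite /cexp cabsM cabs_real ger0_norm ?expR_ge0// /cabs /=.
by rewrite cos2Dsin2 sqrtr1 mulr1.
Qed.

Lemma cexp_neq0 z : cexp z != 0.
Proof. by rewrite -cabs_gt0 cabs_cexp expR_gt0. Qed.

Lemma cexpN z : cexp (- z) = (cexp z)^-1.
Proof.
by apply: (mulfI (cexp_neq0 z)); rewrite -cexpD subrr cexp0 divff ?cexp_neq0.
Qed.

Lemma cexp_taylor2 z : cabs z <= 1 ->
  cabs (cexp z - (1 + z + z ^+ 2 / 2)) <= 10 * cabs z ^+ 3.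
Proof.
case: z => x y; set z := x +i* y; set t := cabs z => t1.
have t0 : 0 <= t := cabs_ge0 z.
have xt : `|x| <= t := Re_le_cabs z.
have yt : `|y| <= t := Im_le_cabs z.
have := expR_taylor2 (le_trans xt t1); set ex := expR x.
have := cos_taylor2 (le_trans yt t1); set cy := cos y.
have := sin_taylor2 (le_trans yt t1); set sy := sin y.
have x3 : `|x| ^+ 3 <= t ^+ 3 by rewrite lerXn2r// nnegrE.
have y3 : `|y| ^+ 3 <= t ^+ 3 by rewrite lerXn2r// nnegrE.
set r3 := sy - y; set r2 := cy - _; set r1 := ex - _.
move=> /le_trans/(_ y3) h3 /le_trans/(_ y3) h2 /le_trans/(_ x3) h1.
have e2 : (2^-1 : R[i]) = (2^-1 : R)%:C by rewrite fmorphV rmorph_nat.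
(* Multiplying the real Taylor polynomials of [expR x] and of [cos y], [sin y] reproduces
   [1 + z + z^2 / 2] up to monomials of degree 3 and 4; these and the terms carrying [r1], [r2],
   [r3] form the remainder. *)
have -> : cexp z - (1 + z + z ^+ 2 / 2) =
  (- x * y ^+ 2 / 2 - x ^+ 2 * y ^+ 2 / 4 + r1 * cy + r2 * (1 + x + x ^+ 2 / 2))
  +i* (x ^+ 2 * y / 2 + r1 * sy + r3 * (1 + x + x ^+ 2 / 2)).
  rewrite /z e2 expr2; apply/eqP; rewrite eq_complex /=; apply/andP; split; apply/eqP.
    by rewrite -/ex -/cy -/sy /r1 /r2; field.
  by rewrite -/ex -/cy -/sy /r1 /r3; field.
apply: le_trans (cabs_le_ReIm _ _) _.
have t3 : 0 <= t ^+ 3 by rewrite exprn_ge0.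
have cy1 : `|cy| <= 1 by rewrite ler_norml cos_geN1 cos_le1.
have sy1 : `|sy| <= 1 by rewrite ler_norml sin_geN1 sin_le1.
have prod (p q a b : R) : `|p| <= a -> `|q| <= b -> `|p * q| <= a * b.
  by move=> ha hb; rewrite normrM ler_pM.
have xx : `|x ^+ 2| <= t ^+ 2 by rewrite normrX lerXn2r// nnegrE.
have yy : `|y ^+ 2| <= t ^+ 2 by rewrite normrX lerXn2r// nnegrE.
have t2 : t ^+ 2 <= 1 by rewrite exprn_ile1.
have p0 : `|1 + x + x ^+ 2 / 2| <= 5 / 2.
  move: xt xx; rewrite !ler_norml => /andP[? ?] /andP[? ?]; apply/andP; split; lra.
have p1 := prod _ _ _ _ xt yy.
have p2 := prod _ _ _ _ xx yy.
have p3 := prod _ _ _ _ h1 cy1.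
have p4 := prod _ _ _ _ h2 p0.
have p5 := prod _ _ _ _ xx yt.
have p6 := prod _ _ _ _ h1 sy1.
have p7 := prod _ _ _ _ h3 p0.
have e : t ^+ 2 * t ^+ 2 <= t ^+ 3 by rewrite -exprD (exprS _ 3) ler_piMl.
have e' : t * t ^+ 2 = t ^+ 3 by rewrite -exprS.
have e'' : t ^+ 2 * t = t ^+ 3 by rewrite mulrC -exprS.
rewrite (_ : 10 * t ^+ 3 = 5 * t ^+ 3 + 5 * t ^+ 3); last by ring.
rewrite e' in p1; rewrite e'' in p5; have p2' := le_trans p2 e.
rewrite !mulNr.
apply: lerD; rewrite ler_norml.
  move: p1 p2' p3 p4; rewrite !ler_norml => /andP[? ?] /andP[? ?] /andP[? ?] /andP[? ?].
  by apply/andP; split; lra.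
move: p5 p6 p7; rewrite !ler_norml => /andP[? ?] /andP[? ?] /andP[? ?].
by apply/andP; split; lra.
Qed.

Lemma cexp_sub1 z : cabs z <= 1 -> cabs (cexp z - 1) <= 12 * cabs z.
Proof.
move=> z1; have := cexp_taylor2 z1; have h0 := cabs_ge0 z.
set t := cabs z in z1 h0 *; set w := _ - _ => hw.
have -> : cexp z - 1 = w + (z + z ^+ 2 / 2) by rewrite /w; ring.
apply: le_trans (cabsD _ _) _.
have h : cabs (z + z ^+ 2 / 2) <= t + t ^+ 2.
  apply: le_trans (cabsD _ _) _; rewrite lerD2l cabsM cabsX cabsV cabs_nat.
  by rewrite ler_piMr ?exprn_ge0// invf_le1// ler1n.
have e2 : t ^+ 2 <= t by rewrite expr2 ler_piMl.
have e3 : t ^+ 3 <= t by rewrite exprS ler_piMr// exprn_ile1.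
by lra.
Qed.

End ComplexExponential.

(** * Ratios of consecutive coefficients of the reciprocal series *)

Section RatioAsymptotics.
Local Open Scope complex_scope.
Variable R : realType.
Local Notation C := R[i].

Definition einv : R := expR (-1).

Lemma einv_ge0 : 0 <= einv. Proof. exact: expR_ge0. Qed.
Lemma einv_le1 : einv <= 1. Proof. by rewrite /einv -[leRHS]expR0 ler_expR; lra. Qed.

Let alt_fact_sum_tail n :
  `|einv - \sum_(k < n) (-1) ^+ k / k`!%:R| <= 4 * 2^-1 ^+ n.
Proof.
have := @series_tail_le R (exp_coeff (-1)) einv 2 n (@expR_cvg R (-1)).
rewrite (_ : series (exp_coeff (-1)) n = \sum_(k < n) (-1) ^+ k / k`!%:R); last first.
  by rewrite /series /= big_mkord.
have -> : 2 * 2 = 4 :> R by rewrite -natrM.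
apply => k nk.
rewrite /exp_coeff /= normrM normrX normrN1 expr1n mul1r normfV normr_nat.
exact: inv_fact_le.
Qed.

(** The coefficient of [X^(j+2)] in [psi], hence the weight of [f (n.-1 - j)] in the recurrence of
    [f n.+1]. *)
Definition psi2 (j : nat) : R := (-1) ^+ j / j.+2`!%:R.

(** The full sum is [psi(1) = 1/e]. *)
Let psi2_sum_tail n : `|\sum_(j < n) psi2 j - einv| <= 4 * 2^-1 ^+ n.
Proof.
rewrite distrC; have := alt_fact_sum_tail n.+2.
rewrite !big_ord_recl /= /bump /= !add1n expr0 expr1 fact0 factS fact0 muln1 !divr1.
rewrite addrA subrr add0r (eq_bigr (fun j : 'I_n => psi2 j)) => [h|j _]; last first.
  by rewrite /psi2 /bump !add1n !exprS; congr (_ / _); ring.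
apply: le_trans h _; have h0 : 0 <= 2^-1 ^+ n :> R by rewrite exprn_ge0.
by rewrite !exprS; lra.
Qed.

(** The full sum is [psi'(1) - psi(1) = 1 - 2/e], since [j + 1] is one less than the exponent
    [j + 2]. *)
Let psi2_wsum_tail n :
  `|\sum_(j < n) j.+1%:R * psi2 j - (1 - 2 * einv)| <= 8 * 2^-1 ^+ n.
Proof.
have e : \sum_(j < n) j.+1%:R * psi2 j =
    1 - \sum_(k < n.+1) (-1) ^+ k / k`!%:R - \sum_(j < n) psi2 j.
  rewrite big_ord_recl /= expr0 fact0 divr1 opprD addrA subrr add0r -!sumrN -big_split /=.
  apply: eq_bigr => j _; rewrite /psi2 /bump !add1n exprS (factS j.+1) natrM.
  have h : (j.+1`!%:R : R) != 0 by rewrite pnatr_eq0 -lt0n fact_gt0.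
  have h' : (j.+2%:R : R) != 0 by rewrite pnatr_eq0.
  have -> : j.+1%:R = j.+2%:R - 1 :> R by rewrite -[j.+2%:R]natr1; ring.
  move: (j.+1`!%:R) (j.+2%:R) h h' => F N h h'; field; by rewrite h h'.
have := alt_fact_sum_tail n.+1; have := psi2_sum_tail n; rewrite e.
move: (\sum_(j < n) _) (\sum_(j < n.+1) _) => a c.
have : 0 <= 2^-1 ^+ n :> R by rewrite exprn_ge0.
rewrite exprS !ler_norml => ? /andP[? ?] /andP[? ?]; apply/andP; split; lra.
Qed.

Variable beta : C.
Let b := cabs beta.
Let f := recip beta.
Let x := beta * einv%:C.

Let psi2E j : psi_coef C j.+2 = (psi2 j)%:C.
Proof.
rewrite /psi_coef /psi2 /= rmorphM rmorphXn rmorphN1 fmorphV rmorph_nat.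
by rewrite !exprS; congr (_ / _); ring.
Qed.

Let recip_rec n : f n.+1 =
  f n - beta * \sum_(j < n) (psi2 j)%:C * f (n.-1 - j)%N.
Proof.
rewrite /f /recip fps_invS big_ord_recl /= subn0.
have -> : denom beta 1%N = -1.
  rewrite /denom !coefpsD coefpsN coefps1 coefpsMC /psi_coef /fps_X /=.
  by rewrite mulr0 sub0r addr0.
rewrite opprD mulN1r opprK mulr_sumr; congr (_ - _); apply: eq_bigr => -[j /= lj] _.
rewrite /bump /= add1n.
have -> : denom beta j.+2 = beta * (psi2 j)%:C.
  by rewrite /denom !coefpsD coefpsN coefps1 coefpsMC psi2E /fps_X /= subr0 add0r.
by rewrite mulrA; congr (_ * fps_inv _ _); lia.
Qed.

(** The factorials in [psi2] absorb any geometric growth, so bounds on quotients that are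
    exponential in the distance [m] still cost only a constant. *)
Let weighted_sum n (G : nat -> C) (M c : R) : 0 <= M -> 1 <= c ->
  (forall j, (j < n)%N -> cabs (G j) <= M * c ^+ j.+1) ->
  cabs (\sum_(j < n) (psi2 j)%:C * G j) <= M * expR c.
Proof.
move=> M0 c1 hG; apply: le_trans (cabs_sum _ _ _) _.
have c0 : 0 <= c by exact: le_trans c1.
apply: (@le_trans _ _ (M * \sum_(k < n.+2) c ^+ k / k`!%:R)); last first.
  by rewrite ler_wpM2l// exp_partial_sum_le.
rewrite mulr_sumr !big_ord_recl /= !addrA -[leLHS]add0r lerD//.
  by rewrite addr_ge0// ?mulr_ge0 ?invr_ge0// exprn_ge0.
apply: ler_sum => -[j /= lj] _; rewrite /bump /= !add1n cabsM cabs_real.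
rewrite /psi2 normrM normrX normrN1 expr1n mul1r normfV normr_nat.
rewrite mulrA mulrC ler_wpM2r ?invr_ge0//.
apply: le_trans (hG _ lj) _; rewrite ler_wpM2l// ler_weXn2l//.
Qed.

(** Chosen so that [b * expR 2 <= 1/2]. With past quotients growing like [2^m], [weighted_sum] then
    puts the next ratio within [1/2] of 1. *)
Definition ratio_radius : R := (2 * expR 2)^-1.

Hypothesis b_small : b <= ratio_radius.

Let b0 : 0 <= b. Proof. exact: cabs_ge0. Qed.

Let bexp2 : b * expR 2 <= 2^-1.
Proof.
have := b_small; rewrite /ratio_radius invfM => h.
by rewrite -ler_pdivlMr ?expR_gt0.
Qed.

Let b1 : b <= 1.
Proof.
have h : 1 <= expR 2 :> R by rewrite -[leLHS]expR0 ler_expR.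
have := bexp2; have : b <= b * expR 2 by rewrite ler_peMr.
by lra.
Qed.

(** A self-sustaining bound: quotients at most [2^m] force [|f n.+1 / f n - 1| <= 1/2], so [f n.+1]
    is nonzero and one step back costs at most a factor 2, which extends the bound to [n.+1]. *)
Lemma recip_quot_bound n : f n != 0 /\
  forall m, (m <= n)%N -> cabs (f (n - m)%N / f n) <= 2 ^+ m.
Proof.
elim: n => [|n [fn IH]].
  split=> [|m]; first by rewrite /f /recip fps_inv0 oner_neq0.
  by rewrite leqn0 => /eqP ->; rewrite expr0 divff ?cabs1// /f /recip fps_inv0 oner_neq0.
have r1 : cabs (f n.+1 / f n - 1) <= 2^-1.
  have -> : f n.+1 / f n - 1 =
    - (beta * \sum_(j < n) (psi2 j)%:C * (f (n.-1 - j)%N / f n)).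
    rewrite recip_rec mulrBl divff// addrAC subrr sub0r; congr (- _).
    by rewrite -mulrA mulr_suml; congr (_ * _); apply: eq_bigr => j _; rewrite mulrA.
  rewrite cabsN cabsM; apply: le_trans bexp2; rewrite ler_wpM2l//.
  rewrite -[leRHS]mul1r.
  apply: (@weighted_sum n (fun j => f (n.-1 - j)%N / f n) 1 2) => [||j lj];
    rewrite ?ler01 ?ler1n//.
  rewrite mul1r (_ : (n.-1 - j)%N = (n - j.+1)%N); last by lia.
  exact: IH.
have r2 : 2^-1 <= cabs (f n.+1 / f n).
  have := cabs_subl 1 (f n.+1 / f n).
  by rewrite cabs1 (cabs_distC 1); lra.
have fn1 : f n.+1 != 0.
  apply/eqP => h; move: r2; rewrite h mul0r cabs0; lra.
split=> // -[|m] lm; first by rewrite subn0 divff// cabs1.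
have -> : f (n.+1 - m.+1)%N / f n.+1 = (f n.+1 / f n)^-1 * (f (n - m)%N / f n).
  by rewrite subSS; field; rewrite fn fn1.
rewrite cabsM exprS; apply: ler_pM; rewrite ?cabs_ge0 ?IH//.
by rewrite cabsV -[2]invrK lef_pV2 ?posrE ?cabs_gt0 ?mulf_neq0 ?invr_eq0// invr_gt0.
Qed.

Lemma recip_neq0 n : f n != 0. Proof. by case: (recip_quot_bound n). Qed.

Let quot_bound n m : (m <= n)%N -> cabs (f (n - m)%N / f n) <= 2 ^+ m.
Proof. by case: (recip_quot_bound n) => _; apply. Qed.

Let quot_bound1 n : cabs (f n / f n.+1) <= 2.
Proof. by have := @quot_bound n.+1 1 isT; rewrite subn1 expr1. Qed.

Let ratio_rec n : f n.+1 / f n =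
  1 - beta * \sum_(j < n) (psi2 j)%:C * (f (n - j.+1)%N / f n).
Proof.
rewrite recip_rec mulrBl divff ?recip_neq0//; congr (_ - _).
rewrite -mulrA mulr_suml; congr (_ * _); apply: eq_bigr => j _.
by rewrite mulrA; congr (_ * f _ * _); have := ltn_ord j; lia.
Qed.

Let quotS n m : (m < n)%N -> f (n - m.+1)%N / f n =
  f (n - m.+1)%N / f (n - m.+1).+1 * (f (n - m)%N / f n).
Proof.
move=> mn; have -> : (n - m.+1).+1 = (n - m)%N by lia.
by field; rewrite !recip_neq0.
Qed.

Let E2 : R := expR 2.
(** The bootstrap gains a factor [b] per round: from bounded quotients to quotients [1 + O(b)], then
    [1 + m x + O(b^2)], and finally to ratios known up to [O(b^3)]. Each round inserts its estimate
    into [ratio_rec]; the terms [b * 2^-n] come from cutting the sum over [psi2] at [n]. *)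
Let quot_sub1 n m : (m <= n)%N ->
  cabs (f (n - m)%N / f n - 1) <= 2 ^+ m * (2 * E2 * b).
Proof.
have hq i : cabs (f i / f i.+1 - 1) <= 2 * E2 * b.
  have fi := recip_neq0 i; have fi1 := recip_neq0 i.+1.
  have -> : f i / f i.+1 - 1 = - (f i / f i.+1) * (f i.+1 / f i - 1).
    by field; rewrite fi fi1.
  rewrite cabsM cabsN -mulrA; apply: ler_pM; rewrite ?cabs_ge0 ?quot_bound1//.
  rewrite ratio_rec addrAC subrr sub0r cabsN cabsM mulrC ler_wpM2r//.
  rewrite -[leRHS]mul1r; apply: (@weighted_sum i (fun j => f (i - j.+1)%N / f i) 1 2) => [||j lj];
    by rewrite ?ler01 ?ler1n// mul1r quot_bound.
suff H : (m <= n)%N -> cabs (f (n - m)%N / f n - 1) <= (2 ^+ m - 1) * (2 * E2 * b).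
  move=> mn; apply: le_trans (H mn) _; rewrite ler_wpM2r ?gerBl//.
  by rewrite !mulr_ge0// /E2 expR_ge0.
elim: m => [|m IH] mn; first by rewrite subn0 divff ?recip_neq0// subrr cabs0 expr0 subrr mul0r.
rewrite (quotS mn); set q := _ / _; set g := _ / _.
have -> : q * g - 1 = q * (g - 1) + (q - 1) by ring.
apply: le_trans (cabsD _ _) _; rewrite cabsM.
apply: (@le_trans _ _ (2 * ((2 ^+ m - 1) * (2 * E2 * b)) + 2 * E2 * b)).
  by rewrite lerD ?hq// ler_pM ?cabs_ge0 ?quot_bound1// IH// ltnW.
by rewrite exprS; lra.
Qed.

Let C1 : R := 4 + 2 * E2 * E2.

Let einvE : cabs (einv%:C : C) <= 1.
Proof. by rewrite cabs_real ger0_norm ?einv_ge0 ?einv_le1. Qed.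

Let half_ge0 n : 0 <= 2^-1 ^+ n :> R. Proof. by rewrite exprn_ge0. Qed.

Let ratio_first n :
  cabs (f n.+1 / f n - (1 - x)) <= C1 * (b ^+ 2 + b * 2^-1 ^+ n).
Proof.
rewrite ratio_rec.
have -> : 1 - beta * (\sum_(j < n) (psi2 j)%:C * (f (n - j.+1)%N / f n)) - (1 - x) =
  - beta * (\sum_(j < n) (psi2 j)%:C * (f (n - j.+1)%N / f n - 1)
            + (\sum_(j < n) psi2 j - einv)%:C).
  under [in RHS]eq_bigr do rewrite mulrBr mulr1.
  by rewrite big_split /= sumrN rmorphB rmorph_sum /= /x; ring.
rewrite cabsM cabsN -/b expr2 -mulrDr mulrCA ler_wpM2l//.
apply: le_trans (cabsD _ _) _.
have h1 : cabs (\sum_(j < n) (psi2 j)%:C * (f (n - j.+1)%N / f n - 1)) <=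
    2 * E2 * b * E2.
  apply: (@weighted_sum n (fun j => f (n - j.+1)%N / f n - 1) (2 * E2 * b) 2) => [||j lj]; rewrite ?ler1n//.
    by rewrite !mulr_ge0// /E2 expR_ge0.
  by rewrite [leRHS]mulrC quot_sub1.
have h2 := psi2_sum_tail n; rewrite -cabs_real in h2.
apply: le_trans (lerD h1 h2) _.
rewrite /C1 mulrDl !mulrDr.
have p1 : 0 <= 4 * b by rewrite mulr_ge0.
have p2 : 0 <= 2 * E2 * E2 * 2^-1 ^+ n by rewrite !mulr_ge0// /E2 expR_ge0.
by lra.
Qed.

Let C2 : R := 2 + 4 * C1.

Let C1_ge0 : 0 <= C1. Proof. by rewrite /C1 addr_ge0// !mulr_ge0// /E2 expR_ge0. Qed.

Let x_le : cabs x <= b.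
Proof. by rewrite /x cabsM ler_piMr. Qed.

Let quot_first n :
  cabs (f n / f n.+1 - (1 + x)) <= C2 * (b ^+ 2 + b * 2^-1 ^+ n).
Proof.
have fi := recip_neq0 n; have fi1 := recip_neq0 n.+1.
have := ratio_first n; set e := _ - (1 - x) => he.
have -> : f n / f n.+1 - (1 + x) = f n / f n.+1 * (x ^+ 2 - e * (1 + x)).
  by rewrite /e; field; rewrite fi fi1.
rewrite cabsM.
have D0 : 0 <= b ^+ 2 + b * 2^-1 ^+ n by rewrite addr_ge0// ?exprn_ge0// mulr_ge0.
have h : cabs (x ^+ 2 - e * (1 + x)) <= b ^+ 2 + C1 * (b ^+ 2 + b * 2^-1 ^+ n) * 2.
  apply: le_trans (cabsB _ _) _; rewrite cabsX [cabs (e * _)]cabsM; apply: lerD.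
    by apply: ge0_lerXn2r; [exact: cabs_ge0|exact: x_le].
  apply: ler_pM; rewrite ?cabs_ge0//; apply: le_trans (cabsD _ _) _.
  by rewrite cabs1; have := x_le; have := b1; lra.
apply: le_trans (ler_pM (cabs_ge0 _) (cabs_ge0 _) (quot_bound1 n) h) _.
rewrite /C2 mulrDl.
have p : 0 <= b * 2^-1 ^+ n by rewrite mulr_ge0.
by lra.
Qed.

(** Steps [n - m] to [n - 1] are chained. The factor [4^m] leaves room for a factor 2 per step and
    for the terms linear in [m]; [2^m] accounts for the truncation error [2^-(n - m)] of the oldest
    step. *)
Let quot_second n m : (m <= n)%N ->
  cabs (f (n - m)%N / f n - (1 + m%:R * x)) <=
    4 ^+ m * ((C2 + 1) * (b ^+ 2 + b * 2^-1 ^+ n * 2 ^+ m)).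
Proof.
have C20 : 0 <= C2 by rewrite /C2 addr_ge0// mulr_ge0.
have C21 : 0 <= C2 + 1 by exact: addr_ge0.
have bn0 : 0 <= b * 2^-1 ^+ n by rewrite mulr_ge0.
have b20 : 0 <= b ^+ 2 by rewrite exprn_ge0.
elim: m => [|m IH] mn.
  rewrite subn0 divff ?recip_neq0// mul0r addr0 subrr cabs0.
  by rewrite expr0 mul1r mulr_ge0// addr_ge0// mulr_ge0.
have {}IH := IH (ltnW mn).
rewrite (quotS mn); set q := _ / f (_.+1); set g := _ / _ in IH *.
have -> : q * g - (1 + m.+1%:R * x) =
    q * (g - (1 + m%:R * x)) + (q - (1 + x)) * (1 + m%:R * x) + m%:R * x ^+ 2.
  by rewrite -natr1; ring.
set D := b ^+ 2 + b * 2^-1 ^+ n * 2 ^+ m.+1.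
have hD : b ^+ 2 + b * 2^-1 ^+ n * 2 ^+ m <= D.
  by rewrite lerD2l ler_wpM2l// ler_weXn2l// ler1n.
have D0 : 0 <= D by rewrite addr_ge0// mulr_ge0// exprn_ge0.
have h1 : cabs (q * (g - (1 + m%:R * x))) <= 2 * (4 ^+ m * ((C2 + 1) * D)).
  rewrite cabsM; apply: ler_pM; rewrite ?cabs_ge0 ?quot_bound1//.
  by apply: le_trans IH _; rewrite !ler_wpM2l ?exprn_ge0 ?C21 ?hD.
have h2 : cabs (q - (1 + x)) <= C2 * D.
  apply: le_trans (quot_first _) _; rewrite ler_wpM2l// lerD2l -mulrA ler_wpM2l//.
  rewrite -{2}(subnK mn) exprD -mulrA -exprMn mulVf// expr1n mulr1.
  by [].
have m4 : m.+1%:R <= 2 * 4 ^+ m :> R.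
  elim: (m) => [|k hk]; first by rewrite expr0 mulr1 ler1n.
  have : 1 <= k.+1%:R :> R by rewrite ler1n.
  by rewrite -natr1 exprS; lra.
have mx : cabs (1 + m%:R * x) <= m.+1%:R.
  apply: le_trans (cabsD _ _) _; rewrite cabs1 cabsM cabs_nat -natr1 addrC lerD2r.
  by rewrite ler_piMr// (le_trans x_le).
have h3 : cabs (m%:R * x ^+ 2) <= m.+1%:R * D.
  rewrite cabsM cabs_nat cabsX; apply: ler_pM; rewrite ?exprn_ge0 ?cabs_ge0 ?ler_nat//.
  apply: (@le_trans _ _ (b ^+ 2)); first by apply: ge0_lerXn2r; [exact: cabs_ge0|exact: x_le].
  by rewrite lerDl mulr_ge0// exprn_ge0.
apply: le_trans (cabsD _ _) _.
apply: le_trans (lerD (cabsD _ _) (lexx _)) _.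
have h4 : cabs ((q - (1 + x)) * (1 + m%:R * x)) <= C2 * D * m.+1%:R.
  by rewrite cabsM; apply: ler_pM; rewrite ?cabs_ge0.
apply: le_trans (lerD (lerD h1 h4) h3) _.
have h5 : m.+1%:R * ((C2 + 1) * D) <= 2 * 4 ^+ m * ((C2 + 1) * D).
  by rewrite ler_wpM2r// mulr_ge0.
rewrite exprS.
have e : C2 * D * m.+1%:R + m.+1%:R * D = m.+1%:R * ((C2 + 1) * D) by ring.
by rewrite -addrA e; lra.
Qed.

(* Second-order expansion in [beta]: f_(n-m) / f_n is close to 1 + m beta / e,
   \sum_j psi2 j = 1/e and \sum_j (j+1) psi2 j = 1 - 2/e. *)
Definition rho : C := 1 - beta * einv%:C - beta ^+ 2 * (einv * (1 - 2 * einv))%:C.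

(** The 8 is the growth [4 * 2] per step in [quot_second], and 12 adds the constants 4 and 8 of the
    two truncated sums. *)
Definition ratio_const : R := (C2 + 1) * expR 8 + 12.

Lemma recip_ratio n :
  cabs (f n.+1 / f n - rho) <= ratio_const * (b ^+ 3 + b * 2^-1 ^+ n).
Proof.
rewrite ratio_rec.
have -> : 1 - beta * (\sum_(j < n) (psi2 j)%:C * (f (n - j.+1)%N / f n)) - rho =
  - beta * (\sum_(j < n) (psi2 j)%:C * (f (n - j.+1)%N / f n - (1 + j.+1%:R * x))
            + (\sum_(j < n) psi2 j - einv)%:C
            + x * (\sum_(j < n) j.+1%:R * psi2 j - (1 - 2 * einv))%:C).
  under [in RHS]eq_bigr do rewrite mulrBr mulrDr mulr1.
  rewrite big_split /= sumrN big_split /=.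
  have -> : \sum_(j < n) (psi2 j)%:C * (j.+1%:R * x) =
      x * (\sum_(j < n) j.+1%:R * psi2 j)%:C.
    rewrite rmorph_sum mulr_sumr; apply: eq_bigr => j _ /=.
    by rewrite [(_%:R * _)%:C]rmorphM rmorph_nat; ring.
  have -> : \sum_(j < n) (psi2 j)%:C = (\sum_(j < n) psi2 j)%:C.
    by rewrite rmorph_sum.
  move: (\sum_(j < n) psi2 j) (\sum_(j < n) _ * psi2 j) => A B.
  rewrite /x /rho !(rmorphB, rmorphM) rmorph_nat rmorph1.
  by ring.
have bn0 : 0 <= b * 2^-1 ^+ n by rewrite mulr_ge0.
have b20 : 0 <= b ^+ 2 by rewrite exprn_ge0.
have C20 : 0 <= C2 by rewrite /C2 addr_ge0// mulr_ge0.
have C21 : 0 <= C2 + 1 by exact: addr_ge0.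
rewrite cabsM cabsN -/b (exprS _ 2) -mulrDr mulrCA ler_wpM2l//.
have h1 : cabs (\sum_(j < n) (psi2 j)%:C * (f (n - j.+1)%N / f n - (1 + j.+1%:R * x)))
    <= (C2 + 1) * (b ^+ 2 + b * 2^-1 ^+ n) * expR 8.
  apply: (@weighted_sum n (fun j => f (n - j.+1)%N / f n - (1 + j.+1%:R * x))) => [||j lj].
  - by rewrite mulr_ge0 ?C21 ?addr_ge0.
  - by rewrite ler1n.
  - apply: le_trans (quot_second lj) _.
    have -> : (8 : R) = 4 * 2 by rewrite -natrM.
    rewrite exprMn mulrCA -[leRHS]mulrA ler_wpM2l ?C21// [leRHS]mulrCA ler_wpM2l ?exprn_ge0//.
    by rewrite mulrDl lerD2r ler_peMr// exprn_ege1// ler1n.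
have h2 := psi2_sum_tail n; rewrite -cabs_real in h2.
have h3 : cabs (x * (\sum_(j < n) j.+1%:R * psi2 j - (1 - 2 * einv))%:C) <= 8 * 2^-1 ^+ n.
  rewrite cabsM -[leRHS]mul1r; apply: ler_pM; rewrite ?cabs_ge0 ?(le_trans x_le)//.
  by rewrite cabs_real psi2_wsum_tail.
apply: le_trans (cabsD _ _) _.
apply: le_trans (lerD (cabsD _ _) (lexx _)) _.
apply: le_trans (lerD (lerD h1 h2) h3) _.
rewrite /ratio_const [leRHS]mulrDl -addrA; apply: lerD.
  rewrite -mulrA (mulrC _ (expR 8)) mulrA ler_wpM2l ?mulr_ge0 ?expR_ge0 ?C21//.
  by rewrite lerD2l ler_piMl.
by have := half_ge0 n; lra.
Qed.

End RatioAsymptotics.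

(** * Expansion of the growth rate near the origin *)

Section CumulantExpansion.
Local Open Scope complex_scope.
Variable R : realType.
Local Notation C := R[i].
Implicit Types (z : C) (n m : nat).

Definition var : R := 3 / 4 * einv R ^+ 2.

Lemma var_gt0 : 0 < var.
Proof. by rewrite /var mulr_gt0 ?exprn_gt0 ?expR_gt0//; lra. Qed.

Lemma var_le1 : var <= 1.
Proof.
have h : einv R ^+ 2 <= 1 by rewrite exprn_ile1 ?einv_ge0 ?einv_le1.
by rewrite /var; lra.
Qed.

Lemma mu_itv : 2^-1 <= mu R <= 1.
Proof.
rewrite /mu -/(einv R); have := einv_ge0 R; have := einv_le1 R.
by move=> ? ?; apply/andP; split; lra.
Qed.

Definition cumulant z : C := (mu R)%:C * z + (var / 2)%:C * z ^+ 2.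

Definition tilt z : C := (1 - cexp (- z)) / 2.

Let cabs_half z : cabs (z / 2) = cabs z / 2.
Proof. by rewrite cabsM cabsV cabs_nat. Qed.

Lemma cabs_tilt z : cabs z <= 1 -> cabs (tilt z) <= 6 * cabs z.
Proof.
move=> z1; rewrite /tilt cabs_half cabs_distC.
have := @cexp_sub1 R (- z); rewrite cabsN => /(_ z1); lra.
Qed.

Let cabs_realM (a : R) (w : C) (c : R) : `|a| <= c -> cabs (a%:C * w) <= c * cabs w.
Proof. by move=> h; rewrite cabsM cabs_real ler_wpM2r ?cabs_ge0. Qed.

Lemma cabs_cumulant z : cabs z <= 1 -> cabs (cumulant z) <= 2 * cabs z.
Proof.
move=> z1; apply: le_trans (cabsD _ _) _.
have h1 : cabs ((mu R)%:C * z) <= 1 * cabs z.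
  by apply: cabs_realM; have := mu_itv; rewrite ler_norml => /andP[? ?]; apply/andP; split; lra.
have h2 : cabs ((var / 2)%:C * z ^+ 2) <= 1 * cabs (z ^+ 2).
  apply: cabs_realM; have := var_gt0; have := var_le1 => ? ?.
  by rewrite ler_norml; apply/andP; split; lra.
have h3 : cabs (z ^+ 2) <= cabs z.
  by rewrite cabsX expr2 ler_piMl ?cabs_ge0.
by lra.
Qed.

Let curv : R := einv R * (1 - 2 * einv R).

Let curv_le1 : `|curv| <= 1.
Proof.
rewrite /curv normrM -[leRHS]mulr1; have := einv_ge0 R; have := einv_le1 R => h1 h0.
by apply: ler_pM => //; rewrite ler_norml; apply/andP; split; lra.
Qed.

Let cabs_rho (w : C) : cabs w <= 1 -> cabs (rho w) <= 3.
Proof.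
move=> w1; rewrite /rho -/curv; apply: le_trans (cabsB _ _) _.
apply: le_trans (lerD (cabsB _ _) (lexx _)) _; rewrite cabs1.
have h1 : cabs (w * (einv R)%:C) <= 1.
  by rewrite cabsM mulr_ile1 ?cabs_ge0// cabs_real ger0_norm ?einv_ge0 ?einv_le1.
have h2 : cabs (w ^+ 2 * curv%:C) <= 1.
  by rewrite cabsM mulr_ile1 ?cabs_ge0// ?cabs_real// cabsX exprn_ile1 ?cabs_ge0.
by lra.
Qed.

(** This is where [mu] and [sigma] come from. As [beta = z/2 - z^2/4 + O(z^3)], the sum of [z] and
    [log(1 - beta/e - beta^2 (1/e)(1 - 2/e))] is [(1 - 1/(2e)) z + (3/(8 e^2)) z^2 + O(z^3)], and
    [3/(8 e^2)] is half of [var]. *)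
Lemma mul_cexp_rho z : cabs z <= 6^-1 ->
  cabs (cexp z * rho (tilt z) - cexp (cumulant z)) <= 200 * cabs z ^+ 3.
Proof.
move=> z6; have z0 := cabs_ge0 z.
have z1 : cabs z <= 1 by lra.
have := cexp_taylor2 z1; set p := 1 + z + z ^+ 2 / 2; set r := cexp z - p => hr.
have := @cexp_taylor2 R (- z); rewrite cabsN => /(_ z1).
set r' := cexp (- z) - _ => hr'.
have l1 : cabs (cumulant z) <= 1 by have := cabs_cumulant z1; lra.
have := cexp_taylor2 l1; set r'' := cexp (cumulant z) - _ => hr''.
have t1 : cabs (tilt z) <= 1 by have := cabs_tilt z1; lra.
set q := z / 2 - z ^+ 2 / 4.
have tE : tilt z = q - r' / 2 by rewrite /tilt /q /r'; field.
have q1 : cabs q <= 1.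
  apply: le_trans (cabsB _ _) _; rewrite cabs_half cabsM cabsV cabs_nat cabsX.
  have : cabs z ^+ 2 <= 1 by rewrite exprn_ile1.
  by lra.
(* [p] and [q] are the Taylor polynomials of [cexp z] and [tilt z]. Once the three remainders are
   split off, the last term is the difference of [p * rho q] and the quadratic Taylor polynomial at
   [cumulant z], whose degrees 0, 1, 2 cancel. *)
have -> : cexp z * rho (tilt z) - cexp (cumulant z) =
   r * rho (tilt z)
   + r' / 2 * (p * ((einv R)%:C + curv%:C * (tilt z + q)))
   - r''
   + z ^+ 3 * (- (mu R * var / 2)%:C
      + (einv R / 8 + curv / 16 - var ^+ 2 / 8)%:C * z
      + (curv / 16)%:C * z ^+ 2 - (curv / 32)%:C * z ^+ 3).
  have -> : r'' = cexp (cumulant z) - (1 + cumulant z + cumulant z ^+ 2 / 2) by [].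
  have -> : r' / 2 = q - tilt z by rewrite tE; ring.
  have -> : cexp z = p + r by rewrite /r; ring.
  rewrite /rho -/curv /cumulant /p /q /curv /var /mu -/(einv R).
  rewrite !(rmorphB, rmorphD, rmorphM, rmorphXn, fmorphV, rmorph_nat, rmorph1) /=.
  by field.
have t3 : 0 <= cabs z ^+ 3 by rewrite exprn_ge0.
apply: le_trans (cabsD _ _) _; apply: le_trans (lerD (cabsB _ _) (lexx _)) _.
apply: le_trans (lerD (lerD (cabsD _ _) (lexx _)) (lexx _)) _.
have h1 : cabs (r * rho (tilt z)) <= 10 * cabs z ^+ 3 * 3.
  by rewrite cabsM; apply: ler_pM; rewrite ?cabs_ge0 ?cabs_rho.
have h2 : cabs (r' / 2 * (p * ((einv R)%:C + curv%:C * (tilt z + q)))) <=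
    10 * cabs z ^+ 3 / 2 * (3 * 3).
  rewrite cabsM cabs_half; apply: ler_pM; [by rewrite divr_ge0 ?cabs_ge0|exact: cabs_ge0|lra|].
  rewrite cabsM; apply: ler_pM; rewrite ?cabs_ge0//.
    rewrite /p; apply: le_trans (cabsD _ _) _; apply: le_trans (lerD (cabsD _ _) (lexx _)) _.
    rewrite cabs1 cabs_half cabsX; have : cabs z ^+ 2 <= 1 by rewrite exprn_ile1.
    by lra.
  apply: le_trans (cabsD _ _) _; rewrite cabs_real ger0_norm ?einv_ge0//.
  have := cabs_realM (tilt z + q) curv_le1; have := cabsD (tilt z) q; have := einv_le1 R.
  by lra.
have h3 : cabs r'' <= 80 * cabs z ^+ 3.
  apply: le_trans hr'' _; have := ge0_lerXn2r 3 (cabs_ge0 _) (cabs_cumulant z1).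
  rewrite exprMn; have -> : (2 : R) ^+ 3 = 8 by ring.
  by lra.
set w := _ - (curv / 32)%:C * _.
have h4 : cabs w <= 4.
  have zn k : cabs (z ^+ k) <= 1 by rewrite cabsX exprn_ile1.
  have cz (a : R) k : `|a| <= 1 -> cabs (a%:C * z ^+ k) <= 1.
    by move=> h; rewrite cabsM cabs_real mulr_ile1 ?normr_ge0 ?cabs_ge0.
  rewrite /w; apply: le_trans (cabsB _ _) _; apply: le_trans (lerD (cabsD _ _) (lexx _)) _.
  apply: le_trans (lerD (lerD (cabsD _ _) (lexx _)) (lexx _)) _.
  have := einv_ge0 R; have := einv_le1 R; have := var_gt0; have := var_le1; have := curv_le1.
  rewrite ler_norml => /andP[? ?] v1 v0 ? ?; have /andP[? ?] := mu_itv.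
  have hv : 0 <= var ^+ 2 <= 1 by rewrite exprn_ge0 ?exprn_ile1// ltW.
  have hm : 0 <= mu R * var <= 1 by apply/andP; split; [apply: mulr_ge0|apply: mulr_ile1]; lra.
  have a1 : cabs (- (mu R * var / 2)%:C) <= 1.
    by rewrite cabsN cabs_real ler_norml; apply/andP; split; lra.
  have a2 : cabs ((einv R / 8 + curv / 16 - var ^+ 2 / 8)%:C * z) <= 1.
    by rewrite -[z]expr1; apply: cz; rewrite ler_norml; apply/andP; split; lra.
  have a3 : cabs ((curv / 16)%:C * z ^+ 2) <= 1.
    by apply: cz; rewrite ler_norml; apply/andP; split; lra.
  have a4 : cabs ((curv / 32)%:C * z ^+ 3) <= 1.
    by apply: cz; rewrite ler_norml; apply/andP; split; lra.
  by lra.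
have h5 : cabs (z ^+ 3 * w) <= cabs z ^+ 3 * 4.
  by rewrite cabsM cabsX ler_wpM2l.
by lra.
Qed.

End CumulantExpansion.

(** * Quasi-powers for one missing corner and for the full ladder *)

Section QuasiPowers.
Local Open Scope complex_scope.
Variable R : realType.
Local Notation C := R[i].
Implicit Types (z beta : C) (n m : nat).

Lemma prod1p_sub1 m (eps : nat -> C) :
  cabs (\prod_(i < m) (1 + eps i) - 1) <= expR (\sum_(i < m) cabs (eps i)) - 1.
Proof.
elim: m => [|m IH]; first by rewrite !big_ord0 expR0 !subrr cabs0.
rewrite !big_ord_recr /=; set P := \prod_(i < m) _ in IH *.
set S := \sum_(i < m) _ in IH *; set e := eps m.
have -> : P * (1 + e) - 1 = (P - 1) * (1 + e) + e by ring.
have e0 := cabs_ge0 e.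
apply: (@le_trans _ _ ((expR S - 1) * (1 + cabs e) + cabs e)).
  apply: le_trans (cabsD _ _) _; rewrite lerD2r cabsM; apply: ler_pM; rewrite ?cabs_ge0//.
  by apply: le_trans (cabsD _ _) _; rewrite cabs1.
have h : expR S * (1 + cabs e) <= expR (S + cabs e).
  by rewrite expRD ler_wpM2l ?expR_ge0// expR_ge1Dx.
by lra.
Qed.

Lemma expR_sub1_le (y : R) : expR y - 1 <= y * expR y.
Proof.
have := expR_ge1Dx (- y) => h.
have := ler_wpM2r (expR_ge0 y) h.
by rewrite -expRD addNr expR0; lra.
Qed.

Lemma cabs_cexp_le3 z : cabs z <= 6^-1 -> cabs (cexp z) <= 3.
Proof.
move=> z6; have z1 : cabs z <= 1 by lra.
have := cabsD (cexp z - 1) 1; rewrite subrK cabs1; have := cexp_sub1 z1; lra.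
Qed.

(** The 6 is the constant of [cabs_tilt]. *)
Definition quasi_radius : R := ratio_radius R / 6.

Lemma quasi_radius_gt0 : 0 < quasi_radius.
Proof. by rewrite divr_gt0// invr_gt0 mulr_gt0// expR_gt0. Qed.

Lemma quasi_radius_le : quasi_radius <= 12^-1.
Proof.
rewrite /quasi_radius /ratio_radius.
have h : (2 * expR 2 : R)^-1 <= 2^-1.
  rewrite lef_pV2 ?posrE ?mulr_gt0 ?expR_gt0//.
  by rewrite ler_peMr// -[leLHS]expR0 ler_expR.
by lra.
Qed.

Lemma tilt_radius z : cabs z <= quasi_radius -> cabs (tilt z) <= ratio_radius R.
Proof.
move=> zr; have := quasi_radius_le; move: zr; rewrite /quasi_radius => zr rr.
by have := @cabs_tilt R z; lra.
Qed.

(** Relative error of replacing one growth factor by [cexp (cumulant z)]. The product of the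
    [1 + eps z i] telescopes to the whole quasi-power in [pow_recip]. *)
Let eps z n : C :=
  cexp z * (recip (tilt z) n.+1 / recip (tilt z) n) * cexp (- cumulant z) - 1.

(** 5 bounds [cexp (- cumulant z)], 200 is the constant of [mul_cexp_rho], 3 bounds [cexp z], and
    [216 = 6^3] converts [cabs (tilt z) ^+ 3]. *)
Let K0 : R := 5 * (200 + 216 * 3 * ratio_const R).

Lemma ratio_const_ge0 : 0 <= ratio_const R.
Proof. by rewrite /ratio_const !addr_ge0 ?mulr_ge0 ?addr_ge0 ?mulr_ge0 ?expR_ge0. Qed.

Let eps_le z n : cabs z <= quasi_radius ->
  cabs (eps z n) <= K0 * (cabs z ^+ 3 + cabs z * 2^-1 ^+ n).
Proof.
move=> zr; have z0 := cabs_ge0 z; have z12 := le_trans zr quasi_radius_le.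
have z6 : cabs z <= 6^-1 by lra.
have z1 : cabs z <= 1 by lra.
have hv := cabs_cexp_le3 z6.
have hr := recip_ratio (tilt_radius zr) n.
have hm := mul_cexp_rho z6.
set r := _ / _ in hr.
have -> : eps z n = cexp (- cumulant z) *
   (cexp z * (r - rho (tilt z)) + (cexp z * rho (tilt z) - cexp (cumulant z))).
  have cc : cexp (- cumulant z) * cexp (cumulant z) = 1 by rewrite -cexpD addNr cexp0.
  rewrite /eps -/r; move: cc r {hv hr hm}.
  move: (cexp (- _)) (cexp (cumulant _)) (cexp z) (rho _) => a b c d ab r.
  by rewrite -ab; ring.
rewrite cabsM /K0 -mulrA.
have hc : cabs (cexp (- cumulant z)) <= 5.
  have := @cexp_sub1 R (- cumulant z); rewrite cabsN.
  have := cabs_cumulant z1; have := cabsD (cexp (- cumulant z) - 1) 1.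
  by rewrite subrK cabs1; lra.
apply: ler_pM; rewrite ?cabs_ge0//.
apply: le_trans (cabsD _ _) _; rewrite cabsM.
have ht := cabs_tilt z1; have p0 : 0 <= 2^-1 ^+ n :> R by rewrite exprn_ge0.
have ht3 : cabs (tilt z) ^+ 3 <= 216 * cabs z ^+ 3.
  have := ge0_lerXn2r 3 (cabs_ge0 _) ht; rewrite exprMn.
  by have -> : (6 : R) ^+ 3 = 216 by ring.
set c := ratio_const R in hr *; have c0 : 0 <= c := ratio_const_ge0.
have hq : cabs (r - rho (tilt z)) <= c * (216 * cabs z ^+ 3 + 6 * cabs z * 2^-1 ^+ n).
  by apply: le_trans hr _; rewrite ler_wpM2l// lerD// ler_wpM2r.
have hq2 : cabs (r - rho (tilt z)) <= c * (216 * (cabs z ^+ 3 + cabs z * 2^-1 ^+ n)).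
  apply: le_trans hq _; rewrite ler_wpM2l// mulrDr lerD2l -mulrA ler_wpM2r ?mulr_ge0//.
  lra.
apply: le_trans (lerD (ler_pM (cabs_ge0 _) (cabs_ge0 _) hv hq2) hm) _.
have : 0 <= cabs z * 2^-1 ^+ n by rewrite mulr_ge0.
by lra.
Qed.

Let pow_recip z m : cabs z <= quasi_radius ->
  cexp z ^+ m * recip (tilt z) m * cexp (- (m%:R * cumulant z)) =
  \prod_(i < m) (1 + eps z i).
Proof.
move=> zr; elim: m => [|m IH].
  by rewrite big_ord0 expr0 mul0r oppr0 cexp0 /recip fps_inv0 !mulr1.
rewrite big_ord_recr /= -IH /eps addrC subrK -natr1 mulrDl mul1r opprD cexpD exprS.
have := recip_neq0 (tilt_radius zr) m => h.
by field.
Qed.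

Lemma cabs_psi_coef n : cabs (psi_coef C n) <= (n`!%:R)^-1.
Proof.
rewrite /psi_coef; case: ifP => _; first by rewrite cabs0 invr_ge0.
by rewrite cabsM cabsX cabsN cabs1 expr1n mul1r cabsV cabs_nat.
Qed.

Lemma cabs_corr n : cabs (corr C n) <= (n`!%:R)^-1.
Proof.
have corrS k : corr C k.+1 = - (corr C k + psi_coef C k.+1) / (2 * k + 1)%N%:R by [].
elim: n => [|[|n] IH].
- by rewrite [corr C 0%N]/(0 : C) cabs0 invr_ge0.
- by rewrite corrS [corr C 0%N]/(0 : C) [psi_coef C 1]/(0 : C) addr0 oppr0 mul0r cabs0 invr_ge0.
- have := cabs_psi_coef n.+2; move: IH.
  rewrite corrS; set a := corr C n.+1; set p := psi_coef C n.+2 => ha hp.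
  rewrite cabsM cabsN cabsV cabs_nat ler_pdivrMr ?ltr0n; last by lia.
  apply: le_trans (cabsD _ _) _; apply: le_trans (lerD ha hp) _.
  rewrite (factS n.+1) natrM invfM.
  have F0 : 0 < (n.+1`!%:R : R)^-1 by rewrite invr_gt0 ltr0n fact_gt0.
  have e : (n.+1`!%:R : R)^-1 = n.+2%:R * (n.+2%:R^-1 * (n.+1`!%:R)^-1).
    by rewrite mulrA divff ?mul1r// pnatr_eq0.
  rewrite {1}e -[X in _ + X <= _]mul1r -mulrDl mulrC ler_wpM2l ?mulr_ge0 ?invr_ge0//.
  by rewrite natr1 ler_nat; lia.
Qed.

(** Multiplying by the numerator changes coefficients only by a factor [1 + O(beta)]: the factorial
    decay of [corr] beats the growth [2^i] of the quotients. *)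
Lemma one_corner_ratio beta m : cabs beta <= ratio_radius R ->
  cabs (one_corner_series beta m / recip beta m - 1) <= expR 2 * cabs beta.
Proof.
move=> hb; have [fm qb] := recip_quot_bound hb m.
have e : one_corner_series beta m / recip beta m - 1 =
    beta * \sum_(i < m) corr C i.+1 * (recip beta (m - i.+1)%N / recip beta m).
  rewrite /one_corner_series coefpsM big_ord_recl /= mulrDl subn0.
  have -> : numer beta 0%N = 1.
    by rewrite /numer coefpsD coefps1 coefpsMC /corr /= mulr0 addr0.
  rewrite mul1r divff// addrAC subrr add0r mulr_suml mulr_sumr.
  apply: eq_bigr => i _; rewrite /bump /= add1n.
  by rewrite /numer coefpsD coefps1 coefpsMC add0r !mulrA.
rewrite e cabsM mulrC ler_wpM2r ?cabs_ge0//.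
apply: le_trans (cabs_sum _ _ _) _.
apply: le_trans (exp_partial_sum_le m.+1 (ler0n R 2)).
rewrite big_ord_recl /= -[leLHS]add0r lerD//.
apply: ler_sum => -[i /= im] _; rewrite /bump /= add1n cabsM mulrC.
by apply: ler_pM; rewrite ?cabs_ge0 ?qb//; exact: (cabs_corr i.+1).
Qed.

(** Among the one-step errors [|z|^3 + |z| 2^-i], the geometric part sums to at most [2 |z|]; only
    the cubic part accumulates with [m]. The bound [T] keeps the exponential of the summed errors
    bounded. *)
Lemma one_corner_quasi_power (T : R) : 0 <= T -> exists2 K : R, 0 <= K &
  forall z m, cabs z <= quasi_radius -> m%:R * cabs z ^+ 3 <= T ->
  cabs (cexp z ^+ m * one_corner_series (tilt z) m
        * cexp (- (m%:R * cumulant z)) - 1) <= K * (cabs z + m%:R * cabs z ^+ 3).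
Proof.
move=> T0; have K00 : 0 <= K0.
  by rewrite /K0 !mulr_ge0// addr_ge0// !mulr_ge0// ratio_const_ge0.
pose M : R := expR (K0 * (2 * (T + 1))).
have M0 : 0 <= M by exact: expR_ge0.
have E0 : 0 <= expR 2 :> R by exact: expR_ge0.
exists (2 * K0 * M + 6 * expR 2 * (1 + 2 * K0 * M * (T + 1))).
  by rewrite !(addr_ge0, mulr_ge0).
move=> z m zr mT; have z0 := cabs_ge0 z.
have z12 := le_trans zr quasi_radius_le.
have z1 : cabs z <= 1 by lra.
set X := cabs z + m%:R * cabs z ^+ 3.
have X0 : 0 <= X by rewrite addr_ge0// mulr_ge0// exprn_ge0.
have hS : \sum_(i < m) cabs (eps z i) <= K0 * (2 * X).
  apply: (@le_trans _ _ (K0 * \sum_(i < m) (cabs z ^+ 3 + cabs z * 2^-1 ^+ i))).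
    by rewrite mulr_sumr; apply: ler_sum => i _; exact: eps_le.
  rewrite ler_wpM2l// big_split /= sumr_const card_ord -mulr_sumr -[_ *+ m]mulr_natl.
  have hg : \sum_(i < m) 2^-1 ^+ i <= 2 :> R.
    suff : \sum_(i < m) 2^-1 ^+ i = 2 - 2 * 2^-1 ^+ m :> R.
      by move=> ->; rewrite gerBl mulr_ge0 ?exprn_ge0.
    elim: (m) => [|k IHk]; first by rewrite big_ord0 expr0 mulr1 subrr.
    by rewrite big_ord_recr /= IHk exprS; lra.
  have := ler_wpM2l z0 hg; have : 0 <= m%:R * cabs z ^+ 3 by rewrite mulr_ge0// exprn_ge0.
  by rewrite /X; lra.
have XT : X <= T + 1 by rewrite /X; lra.
have hA : cabs (\prod_(i < m) (1 + eps z i) - 1) <= 2 * K0 * M * X.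
  apply: le_trans (prod1p_sub1 _ _) _; apply: le_trans (expR_sub1_le _) _.
  have -> : 2 * K0 * M * X = K0 * (2 * X) * M by ring.
  apply: ler_pM; rewrite ?expR_ge0 ?hS//; first by apply: sumr_ge0 => i _; exact: cabs_ge0.
  by rewrite /M ler_expR; apply: le_trans hS _; rewrite ler_wpM2l// ler_wpM2l.
have hB := one_corner_ratio m (tilt_radius zr).
have := recip_neq0 (tilt_radius zr) m => f0.
have := pow_recip m zr; set P := \prod_(i < m) _ in hA * => hP.
set B := one_corner_series _ _ / _ - 1 in hB.
have -> : cexp z ^+ m * one_corner_series (tilt z) m * cexp (- (m%:R * cumulant z)) - 1
   = (P - 1) + B * (1 + (P - 1)).
  rewrite -hP /B; move: (one_corner_series _ _) (cexp (- _)) (cexp z ^+ m) f0.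
  by move: (recip _ _) => f q a c f0; field.
have hB' : cabs B <= 6 * expR 2 * X.
  apply: le_trans hB _; have ht := cabs_tilt z1.
  apply: (@le_trans _ _ (expR 2 * (6 * cabs z))); first by rewrite ler_wpM2l.
  have : cabs z <= X by rewrite lerDl mulr_ge0// exprn_ge0.
  by move=> /(ler_wpM2l E0); lra.
apply: le_trans (cabsD _ _) _; rewrite [leRHS]mulrDl; apply: lerD => //.
rewrite cabsM [leRHS]mulrAC; apply: ler_pM; rewrite ?cabs_ge0//.
apply: le_trans (cabsD _ _) _; rewrite cabs1 lerD2l; apply: le_trans hA _.
by rewrite ler_wpM2l// mulr_ge0// mulr_ge0.
Qed.

Lemma ladder_pgf_rec (K : numFieldType) (v : K) :
  ladder_rec v (1 + v) (one_corner_pgf v) (two_corners_pgf v).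
Proof.
split; [exact: one_corner_pgf0|exact: two_corners_pgf0|exact: one_corner_pgfE|].
exact: two_corners_pgfE.
Qed.

Lemma ladder_tilt_rec z : ladder_rec (cexp z) (1 + cexp z)
  (fun m => cexp z ^+ m * one_corner_series (tilt z) m)
  (fun m => (1 + cexp z) * cexp z ^+ m * recip (tilt z) m).
Proof.
have := ladder_rec_series (cexp z) (tilt z).
have -> : 2 * cexp z * (1 - tilt z) = 1 + cexp z.
  by rewrite /tilt cexpN; have := cexp_neq0 z; move: (cexp z) => v v0; field.
by [].
Qed.

(** By [full_pgfE] the value is [v] times an average of [n] products whose indices add up to
    [n - 1], so all of them have the same main term. The missing step is made up by
    [cexp (z - cumulant z)], which is [1 + O(|z|)]. *)
Lemma full_quasi_power (T : R) : 0 <= T -> exists2 K : R, 0 <= K &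
  forall z n, (0 < n)%N -> cabs z <= quasi_radius -> n%:R * cabs z ^+ 3 <= T ->
  cabs (full_pgf (cexp z) n * cexp (- (n%:R * cumulant z)) - 1) <=
    K * (cabs z + n%:R * cabs z ^+ 3).
Proof.
move=> T0; have [K K0' hK] := one_corner_quasi_power T0.
pose M := 2 * K + K * K * (T + 1).
have M0 : 0 <= M by rewrite !(addr_ge0, mulr_ge0).
exists (M + 12 * (1 + M * (T + 1))); first by rewrite !(addr_ge0, mulr_ge0).
move=> z n n0 zr nT; have z0 := cabs_ge0 z; have z12 := le_trans zr quasi_radius_le.
have z1 : cabs z <= 1 by lra.
set X := cabs z + n%:R * cabs z ^+ 3.
have X0 : 0 <= X by rewrite addr_ge0// mulr_ge0// exprn_ge0.
have XT : X <= T + 1 by rewrite /X; lra.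
pose Q i := one_corner_pgf (cexp z) i * cexp (- (i%:R * cumulant z)).
have hQ i : (i <= n)%N -> cabs (Q i - 1) <= K * X.
  move=> i_n; have i3 : i%:R * cabs z ^+ 3 <= n%:R * cabs z ^+ 3.
    by rewrite ler_wpM2r ?exprn_ge0// ler_nat.
  have := hK z i zr (le_trans i3 nT); rewrite /Q.
  have [-> _] := ladder_rec_unique (ladder_pgf_rec (cexp z)) (ladder_tilt_rec z) i.
  by move=> /le_trans; apply; rewrite ler_wpM2l// lerD2l.
have e : full_pgf (cexp z) n * cexp (- (n%:R * cumulant z)) - 1 =
   n%:R^-1 * \sum_(i < n) (cexp (z - cumulant z) * (Q i * Q (n.-1 - i)%N) - 1).
  have nC : (n%:R : C) != 0 by rewrite pnatr_eq0 -lt0n.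
  apply: (mulfI nC); rewrite [RHS]mulrA divff// mul1r mulrBr mulr1 mulrA full_pgfE.
  rewrite sumrB sumr_const card_ord; congr (_ - _).
  rewrite -mulrA mulr_suml !mulr_sumr; apply: eq_bigr => -[i /= lti] _; rewrite /Q.
  have -> : cexp (z - cumulant z) = cexp z * cexp (- cumulant z) by rewrite cexpD.
  have -> : cexp (- (n%:R * cumulant z)) = cexp (- cumulant z) *
      cexp (- (i%:R * cumulant z)) * cexp (- ((n.-1 - i)%:R * cumulant z)).
    rewrite -!cexpD; congr cexp.
    have -> : n%:R = 1 + i%:R + (n.-1 - i)%:R :> C by rewrite -[1 in RHS]/(1%:R) -!natrD; congr (_%:R); lia.
    by ring.
  by ring.
have hzl : cabs (cexp (z - cumulant z) - 1) <= 12 * X.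
  have hc : cabs (z - cumulant z) <= cabs z.
    have -> : z - cumulant z = ((einv R / 2)%:C - (var R / 2)%:C * z) * z.
      rewrite /cumulant /mu -/(einv R) !(rmorphB, rmorphM, fmorphV, rmorph_nat, rmorph1) /=.
      by field.
    rewrite cabsM ler_piMl//; apply: le_trans (cabsB _ _) _; rewrite cabsM !cabs_real.
    have := einv_ge0 R; have := einv_le1 R; have := var_gt0 R; have := var_le1 R => ? ? ? ?.
    rewrite !ger0_norm ?divr_ge0//; last by lra.
    have : var R / 2 * cabs z <= 2^-1 * 1 by apply: ler_pM => //; lra.
    by lra.
  have := @cexp_sub1 R (z - cumulant z) (le_trans hc z1).
  have : cabs z <= X by rewrite lerDl mulr_ge0// exprn_ge0.
  by lra.
have hQQ i : (i < n)%N -> cabs (Q i * Q (n.-1 - i)%N - 1) <= M * X.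
  move=> lti.
  have h1 := hQ i (ltnW lti); have h2 : cabs (Q (n.-1 - i)%N - 1) <= K * X by apply: hQ; lia.
  set a := Q i in h1 *; set c := Q _ in h2 *.
  have -> : a * c - 1 = (a - 1) + (c - 1) + (a - 1) * (c - 1) by ring.
  apply: le_trans (cabsD _ _) _; apply: le_trans (lerD (cabsD _ _) (lexx _)) _.
  rewrite cabsM.
  have h3 := ler_pM (cabs_ge0 _) (cabs_ge0 _) h1 h2.
  have h4 : K * X * (K * X) <= K * K * (T + 1) * X.
    have -> : K * X * (K * X) = K * K * X * X by ring.
    by rewrite ler_wpM2r// ler_wpM2l// mulr_ge0.
  by rewrite /M; lra.
rewrite e cabsM cabsV cabs_nat ler_pdivrMl ?ltr0n//.
apply: le_trans (cabs_sum _ _ _) _.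
rewrite [leRHS]mulr_natl -[X in _ *+ X]card_ord -sumr_const.
apply: ler_sum => -[i /= lti] _.
set a := cexp _ in hzl *; have := hQQ i lti; set c := Q i * _ => hc.
have -> : a * c - 1 = (c - 1) + (a - 1) * (1 + (c - 1)) by ring.
apply: le_trans (cabsD _ _) _; rewrite [leRHS]mulrDl; apply: lerD => //.
rewrite cabsM [leRHS]mulrAC; apply: ler_pM; rewrite ?cabs_ge0//.
apply: le_trans (cabsD _ _) _; rewrite cabs1 lerD2l; apply: le_trans hc _.
by rewrite ler_wpM2l.
Qed.

End QuasiPowers.

(** * Bounds on the full period *)

Section TrigonometricBounds.
Local Open Scope complex_scope.
Variable R : realType.
Local Notation C := R[i].
Implicit Types s t : R.

Lemma pi_lt4 : pi < 4 :> R.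
Proof. by have := @pihalf_lt2 R; lra. Qed.

(** Taylor gives [t^2 / 4] up to [1/4]. Beyond, monotonicity keeps [1 - cos t] above its lower bound
    [1/64] at [1/4], while [t^2 / 16 <= 1]. *)
Lemma one_minus_cos_ge t : `|t| <= pi -> t ^+ 2 / 16 / 64 <= 1 - cos t.
Proof.
move=> tpi; have pi4 := pi_lt4.
wlog t0 : t tpi / 0 <= t => [hw|].
  have [/hw->//|/ltW tn] := leP 0 t.
  by rewrite -sqrrN -cosN; apply: hw; rewrite ?normrN// oppr_ge0.
rewrite ger0_norm// in tpi.
have small (y : R) : 0 <= y <= 4^-1 -> y ^+ 2 / 4 <= 1 - cos y.
  move=> /andP[y0 y4]; have y1 : `|y| <= 1 by rewrite ger0_norm//; lra.
  have := cos_taylor2 y1; rewrite (ger0_norm y0) ler_norml => /andP[_ h].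
  have : y ^+ 3 <= 4^-1 * y ^+ 2 by rewrite exprS ler_wpM2r// exprn_ge0.
  lra.
have [t4|t4] := leP t 4^-1.
  have := small t; rewrite t0 t4 => /(_ isT).
  have : 0 <= t ^+ 2 by rewrite exprn_ge0.
  lra.
have h := small 4^-1; rewrite lexx andbT in h.
have {}h : (4^-1 : R) ^+ 2 / 4 <= 1 - cos (4^-1) by apply: h; rewrite invr_ge0.
have hc : cos t <= cos (4^-1).
  have pi2 := @pi_ge2 R.
  have i1 : t \in `[0, pi] by rewrite in_itv /= t0 tpi.
  have i2 : 4^-1 \in `[0, pi : R] by rewrite in_itv /=; apply/andP; split; lra.
  by apply: ltW; rewrite ltr_cos.
have : t ^+ 2 <= 4 ^+ 2 by apply: ge0_lerXn2r; lra.
rewrite expr2 in h; lra.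
Qed.

(** With [u = expR s], [|1 + v|^2 = (1 + u)^2 - 2u (1 - cos t)]. As [(1 + u)^2 <= 9] and [2u >= 1],
    it suffices that [18 kappa t^2 <= 1 - cos t]; the [1/32] in the bound on [kappa] leaves slack
    over [1/18]. *)
Lemma cabs_add1_cexp_le s t (kappa : R) : 2^-1 <= expR s <= 2 -> `|t| <= pi ->
  0 <= kappa <= 32^-1 / 16 / 64 ->
  cabs (1 + cexp (s +i* t)) <= (1 + expR s) * (1 - kappa * t ^+ 2).
Proof.
move=> /andP[u0 u1] tpi /andP[k0 k1].
have hc := one_minus_cos_ge tpi; set u := expR s in u0 u1 *.
have t2 : 0 <= t ^+ 2 <= 16.
  rewrite exprn_even_ge0//= -(real_normK (num_real t)).
  have -> : (16 : R) = 4 ^+ 2 by ring.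
  by apply: ge0_lerXn2r => //; have := pi_lt4; lra.
have kt : 0 <= kappa * t ^+ 2 <= 1.
  case/andP: t2 => a c; rewrite mulr_ge0//=.
  by apply: le_trans (ler_pM _ _ k1 c) _ => //; lra.
have r0 : 0 <= (1 + u) * (1 - kappa * t ^+ 2).
  by apply: mulr_ge0; [lra|case/andP: kt; lra].
rewrite -(ger0_norm r0) -sqrtr_sqr /cabs /= ler_wsqrtr//.
have e : (1 + (u * cos t - 0 * sin t)) ^+ 2 + (0 + (u * sin t + 0 * cos t)) ^+ 2 =
   (1 + u) ^+ 2 - 2 * u * (1 - cos t).
  have := cos2Dsin2 t; set c := cos t; set d := sin t => cd.
  transitivity (1 + 2 * u * c + u ^+ 2 * (c ^+ 2 + d ^+ 2)); first by ring.
  by rewrite cd; ring.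
rewrite -/u e exprMn.
have h1 : kappa * t ^+ 2 * 32 <= t ^+ 2 / 16 / 64.
  have := ler_wpM2r (andP t2).1 k1; lra.
have h2 : (1 + u) ^+ 2 <= 9.
  have -> : (9 : R) = 3 ^+ 2 by ring.
  by apply: ge0_lerXn2r; lra.
set y := kappa * t ^+ 2 in kt h1 *; case/andP: kt => y0 y1.
have h3 : (1 + u) ^+ 2 * y <= 9 * y by rewrite ler_wpM2r.
have h4 : 2^-1 * (1 - cos t) <= u * (1 - cos t) by rewrite ler_wpM2r// subr_ge0 cos_le1.
have h5 : 0 <= (1 + u) ^+ 2 * y ^+ 2 by rewrite mulr_ge0 ?exprn_even_ge0.
have -> : (1 + u) ^+ 2 * (1 - y) ^+ 2 = (1 + u) ^+ 2 - 2 * ((1 + u) ^+ 2 * y) + (1 + u) ^+ 2 * y ^+ 2 by ring.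
by lra.
Qed.

End TrigonometricBounds.

(** * Majorants over the full period *)

Section UniformBound.
Local Open Scope complex_scope.
Variable R : realType.
Local Notation C := R[i].
Implicit Types s t : R.

(** The parameter solves [2u(1 - beta) = a], so that the explicit solution starts from the bound [a]
    on [|1 + v|]. *)
Lemma one_corner_pgf_le (v : C) (u a : R) m : cabs v <= u -> cabs (1 + v) <= a ->
  0 < u ->
  cabs (one_corner_pgf v m) <=
    u ^+ m * cabs (one_corner_series (1 - a / (2 * u))%:C m).
Proof.
move=> vu va u0; set beta := 1 - a / (2 * u).
have := ladder_rec_series (u%:C : C) (beta%:C).
have -> : 2 * u%:C * (1 - beta%:C) = (a%:C : C).
  rewrite -(rmorph1 (real_complex R)) -(rmorph_nat (real_complex R) 2) -rmorphB -!rmorphM.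
  by congr (_ %:C); rewrite /beta; field; rewrite gt_eqF.
move=> h; have := ladder_rec_majorant (ladder_pgf_rec v) h.
rewrite !cabs_norm !lecR => /(_ vu va m)[+ _].
set w := u%:C ^+ m * _ => hw; have := le_trans hw (real_ler_norm _).
rewrite !cabs_norm lecR /w cabsM cabsX cabs_real ger0_norm ?(ltW u0)//; apply.
by apply: ger0_real; apply: le_trans hw; rewrite ler0c cabs_ge0.
Qed.

Definition rcumulant s : R := mu R * s + var R / 2 * s ^+ 2.

Lemma cumulant_real s : cumulant s%:C = (rcumulant s)%:C :> C.
Proof. by rewrite /cumulant /rcumulant; move: (var R / 2) (mu R) => a c; rewrite rmorphD !rmorphM expr2. Qed.

Let rtilt s : R := (1 - expR (- s)) / 2.
Let curv : R := einv R * (1 - 2 * einv R).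
Let rrho b : R := 1 - b * einv R - b ^+ 2 * curv.

Let tilt_real s : tilt s%:C = (rtilt s)%:C :> C.
Proof.
by rewrite /tilt -rmorphN cexp_real /rtilt rmorphM rmorphB rmorph1 fmorphV rmorph_nat.
Qed.

Let rho_real b : rho b%:C = (rrho b)%:C :> C.
Proof. by rewrite /rho /rrho !(rmorphB, rmorphM, rmorphXn, rmorph1, rmorph_nat). Qed.

Let cst : R := ratio_const R.
(** In order, the four bounds give: [8 d <= 1]; the shifted parameter inside [ratio_radius]; a
    [kappa] admissible in [cabs_add1_cexp_le]; and a cubic error in [d] smaller than half of the
    linear gain. *)
Let delta0 : R := Num.min (Num.min 8^-1 (ratio_radius R / 4))
   (Num.min (32^-1 / 64) (einv R / (32 * (cst + 1)))).
Let s0 : R := ratio_radius R / 48.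

Let cst0 : 0 <= cst. Proof. exact: ratio_const_ge0. Qed.
Let rr0 : 0 < ratio_radius R.
Proof. by rewrite invr_gt0 mulr_gt0// expR_gt0. Qed.
Let rr1 : ratio_radius R <= 2^-1.
Proof. by have := quasi_radius_le R; rewrite /quasi_radius; lra. Qed.
Let einv0 : 0 < einv R. Proof. exact: expR_gt0. Qed.

Let delta0_gt0 : 0 < delta0.
Proof.
have h0 := rr0; have h1 := cst0.
have p4 : 0 < einv R / (32 * (cst + 1)) by apply: divr_gt0 => //; lra.
by rewrite /delta0 !lt_min p4 andbT; apply/andP; split; [apply/andP; split|]; lra.
Qed.

Let delta0_le : [/\ delta0 <= 8^-1, delta0 <= ratio_radius R / 4, delta0 <= 32^-1 / 64
  & delta0 <= einv R / (32 * (cst + 1))].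
Proof. by rewrite /delta0; split; rewrite !ge_min lexx ?orbT. Qed.

(** As [t^2 <= 16] on the period, [kappa * t^2] never exceeds [delta0]. *)
Let kappa : R := delta0 / 16.

Let H : R := 200.
Let N : R := 4 * 216 * cst.
Let K1 : R := 3 * (H + 3 * N + 3 * cst).
Let c1 : R := einv R / 48.

Let H0 : 0 <= H. Proof. exact: ler0n. Qed.
Let N0 : 0 <= N. Proof. by have := cst0; rewrite /N; lra. Qed.
Let K10 : 0 <= K1.
Proof. by have := cst0; have := N0; have := H0; rewrite /K1; lra. Qed.

Let curv_le : `|curv| <= einv R.
Proof.
rewrite /curv normrM ger0_norm ?(ltW einv0)// ler_piMr ?(ltW einv0)//.
by rewrite ler_norml; have := einv_le1 R; have := einv0; move=> ? ?; apply/andP; split; lra.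
Qed.

(* The parameter of the majorant for [u = e^s] and [a = (1 + e^s) (1 - d)]: a
   defect [d] in |1 + v| <= 1 + |v| lowers the growth rate to first order. *)
Let shifted s d : R := rtilt s + d * (1 - rtilt s).

(** Near 0 the slope of [rrho] is about [-1/e], so the defect lowers the ratio by at least
    [einv R / 4 * d]. Half of this pays for the cubic error in [d]; the factors [expR s >= 1/2] and
    [L^-1 >= 1/3] turn the rest into [c1 * d]. *)
Let ratio_upper s d n (beta := (shifted s d)%:C : C) :
  `|s| <= s0 -> 0 <= d <= delta0 ->
  cabs beta <= ratio_radius R /\
  expR s * cabs (recip beta n.+1 / recip beta n) <=
    expR (rcumulant s - c1 * d + K1 * (`|s| ^+ 3 + 2^-1 ^+ n)).
Proof.
move=> hs /andP[d0 dd].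
have [dd8 ddr _ dde] := delta0_le.
have s1 : `|s| <= 96^-1 by move: hs rr1; rewrite /s0; lra.
have cs : cabs (s%:C : C) = `|s| by rewrite cabs_real.
have hb : `|rtilt s| <= 6 * `|s|.
  by have := @cabs_tilt R s%:C; rewrite tilt_real !cabs_real; apply; lra.
pose b := rtilt s; rewrite -/b in hb.
pose b' := shifted s d.
have b'E : b' = b + d * (1 - b) by [].
have absb : `|b| <= 16^-1 by lra.
have /andP[bl bu] : - (16^-1) <= b <= 16^-1 by rewrite -ler_norml.
have db : `|d * (1 - b)| <= 2 * d.
  rewrite normrM ger0_norm// mulrC ler_wpM2r//.
  by rewrite ler_norml; apply/andP; split; lra.
have hb' : `|b'| <= `|b| + 2 * d by rewrite b'E; apply: le_trans (ler_normD _ _) _; rewrite lerD2l.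
have cb' : cabs beta = `|b'| by rewrite cabs_real.
have hrad : cabs beta <= ratio_radius R.
  by rewrite cb'; move: hs; rewrite /s0; lra.
split=> //.
have hr := recip_ratio hrad n; rewrite rho_real cb' in hr.
have hm := @mul_cexp_rho R s%:C; rewrite cs tilt_real cexp_real cumulant_real cexp_real in hm.
have {}hm : `|expR s * rrho b - expR (rcumulant s)| <= H * `|s| ^+ 3.
  rewrite -[leLHS]cabs_real.
  have -> : (expR s * rrho b - expR (rcumulant s))%:C =
      (expR s)%:C * rho b%:C - (expR (rcumulant s))%:C.
    by rewrite rho_real -rmorphM -rmorphB.
  by apply: hm; lra.
have hcum : `|rcumulant s| <= 2 * `|s|.
  by have := @cabs_cumulant R s%:C; rewrite cumulant_real !cabs_real; apply; lra.
have expbd (y : R) : `|y| <= 6^-1 -> 3^-1 <= expR y <= 3.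
  move=> y6; have := @cabs_cexp_le3 R y%:C; rewrite cexp_real !cabs_real (ger0_norm (expR_ge0 _)).
  move=> /(_ y6) h1; have := @cabs_cexp_le3 R (- y)%:C.
  rewrite cexp_real !cabs_real normrN (ger0_norm (expR_ge0 _)) => /(_ y6) h2.
  rewrite h1 andbT -(opprK y) expRN lef_pV2 ?posrE ?expR_gt0//.
have /andP[u0 u1] : 2^-1 <= expR s <= 3.
  have := expR_ge1Dx s; have /andP[_ ->] := expbd s ltac:(lra).
  move: s1; rewrite ler_norml andbT => /andP[? ?]; lra.
have /andP[l0 l1] := expbd (rcumulant s) ltac:(lra).
have hrho : rrho b' <= rrho b - einv R / 4 * d.
  have -> : rrho b' = rrho b - d * ((1 - b) * (einv R + curv * (b' + b))).
    by rewrite /rrho b'E; ring.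
  rewrite lerD2l lerN2 mulrC ler_wpM2l//.
  have : `|curv * (b' + b)| <= einv R * 2^-1.
    rewrite normrM; apply: ler_pM => //; apply: le_trans (ler_normD _ _) _; lra.
  rewrite ler_norml => /andP[h1 h2].
  have h3 : einv R / 2 <= einv R + curv * (b' + b) by lra.
  have h4 : 15 / 16 <= 1 - b by lra.
  have := ler_pM _ _ h4 h3; have := einv0; lra.
have rho_ge0 : 0 <= rrho b'.
  have hb4 : `|b'| <= 2^-1 by lra.
  have e1 := einv_le1 R.
  have a1 : `|b' * einv R| <= 2^-1 * 1 by rewrite normrM ler_pM// ger0_norm ?(ltW einv0).
  have a2 : `|b' ^+ 2 * curv| <= 2^-1 ^+ 2 * 1.
    rewrite normrM ler_pM// ?normrX ?(le_trans curv_le)// ge0_lerXn2r//.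
  move: a1 a2; rewrite !ler_norml expr2 /rrho => /andP[? ?] /andP[? ?]; lra.
have cub : cst * `|b'| ^+ 3 <= N * `|s| ^+ 3 + einv R / 8 * d.
  have h1 : `|b'| ^+ 3 <= (6 * `|s| + 2 * d) ^+ 3 by apply: ge0_lerXn2r => //; lra.
  have h2 : (6 * `|s| + 2 * d) ^+ 3 <= 4 * 216 * `|s| ^+ 3 + 32 * d ^+ 3.
    (* The identity [4 (a^3 + b^3) - (a + b)^3 = 3 (a + b) (a - b)^2]. *)
    have h0 : 0 <= 3 * (6 * `|s| + 2 * d) * (6 * `|s| - 2 * d) ^+ 2.
      by rewrite mulr_ge0 ?exprn_even_ge0// mulr_ge0// addr_ge0// mulr_ge0.
    rewrite -subr_ge0; apply: le_trans h0 _; rewrite le_eqVlt; apply/orP; left.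
    by apply/eqP; ring.
  have h3 : cst * (32 * d ^+ 3) <= einv R / 8 * d.
    have h4 : d * (32 * (cst + 1)) <= einv R.
      by rewrite -ler_pdivlMr ?(le_trans dd)// mulr_gt0// ltr_wpDl.
    have h5 : 4 * cst * d <= einv R / 8 by lra.
    have -> : cst * (32 * d ^+ 3) = 4 * cst * d * (8 * d) * d by ring.
    rewrite ler_wpM2r//; apply: le_trans (ler_piMr _ _) h5; last by lra.
    by rewrite mulr_ge0// mulr_ge0.
  have := ler_wpM2l cst0 (le_trans h1 h2); rewrite /N; lra.
have p0 : 0 <= 2^-1 ^+ n :> R by rewrite exprn_ge0.
have s3 : 0 <= `|s| ^+ 3 by rewrite exprn_ge0.
set r := _ / _ in hr *.
have hcr : cabs r <= rrho b - einv R / 8 * d + N * `|s| ^+ 3 + cst * 2^-1 ^+ n.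
  have := cabsD (r - (rrho b')%:C) (rrho b')%:C; rewrite subrK cabs_real ger0_norm//.
  have : cst * (`|b'| * 2^-1 ^+ n) <= cst * 2^-1 ^+ n.
    by rewrite ler_wpM2l// ler_piMl//; lra.
  by move: hr; rewrite -/cst mulrDr; lra.
set L := expR (rcumulant s) in hm l0 l1.
set S := `|s| ^+ 3 in hm cub hcr s3 *; set p := 2^-1 ^+ n in hcr p0 *.
have HS : 0 <= H * S := mulr_ge0 H0 s3.
have NS : 0 <= N * S := mulr_ge0 N0 s3.
have CS : 0 <= cst * S := mulr_ge0 cst0 s3.
have Hp : 0 <= H * p := mulr_ge0 H0 p0.
have Np : 0 <= N * p := mulr_ge0 N0 p0.
have Cp : 0 <= cst * p := mulr_ge0 cst0 p0.
have ed : 0 <= einv R * d := mulr_ge0 (ltW einv0) d0.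
pose A := H * S + 3 * (N * S) + 3 * (cst * p); pose B := einv R / 16 * d.
have A0 : 0 <= A by rewrite /A; lra.
have B0 : 0 <= B by rewrite /B; lra.
have L0 : 0 < L by rewrite expR_gt0.
have step : expR s * cabs r <= L + (A - B).
  have w0 := ler_wpM2l (expR_ge0 s) hcr.
  move: hm; rewrite ler_norml => /andP[_ hm].
  have w1 := ler_wpM2r ed u0; have w2 := ler_wpM2r NS u1; have w3 := ler_wpM2r Cp u1.
  by rewrite /A /B; lra.
apply: le_trans step _.
have Linv : 3^-1 <= L^-1 <= 3.
  by rewrite lef_pV2 ?posrE// l1 -[leRHS]invrK lef_pV2 ?posrE ?invr_gt0.
case/andP: Linv => li1 li2.
have -> : L + (A - B) = L * (1 + (A * L^-1 - B * L^-1)).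
  by field; rewrite gt_eqF.
have hA : A * L^-1 <= K1 * (S + p).
  apply: (@le_trans _ _ (A * 3)); first by rewrite ler_wpM2l.
  by rewrite /K1 /A; lra.
have hB : c1 * d <= B * L^-1.
  apply: (@le_trans _ _ (B * 3^-1)); last by rewrite ler_wpM2l.
  by rewrite /B /c1; lra.
apply: (@le_trans _ _ (L * expR (A * L^-1 - B * L^-1))).
  by rewrite ler_wpM2l ?(ltW L0)// expR_ge1Dx.
by rewrite /L -expRD ler_expR; lra.
Qed.

Let growth s t : R := rcumulant s - c1 * (kappa * t ^+ 2) + K1 * `|s| ^+ 3.

(** Product of the one-step bounds; [2 - 2 * 2^-m] is the exact value of the sum of [2^-i] over
    [i < m]. *)
Let recip_upper s d m : `|s| <= s0 -> 0 <= d <= delta0 ->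
  expR s ^+ m * cabs (recip ((shifted s d)%:C : C) m) <=
  expR (m%:R * (rcumulant s - c1 * d + K1 * `|s| ^+ 3)
        + K1 * (2 - 2 * 2^-1 ^+ m)).
Proof.
move=> hs hd; set Y := rcumulant s - _ + _; elim: m => [|m IH].
  by rewrite mul0r expr0 mulr1 subrr mulr0 addr0 expR0 mul1r /recip fps_inv0 cabs1.
have [hr hu] := ratio_upper m hs hd.
have f0 := recip_neq0 hr m.
set f := recip _ in f0 hu IH *.
have -> : f m.+1 = f m.+1 / f m * f m by field.
rewrite cabsM exprS.
have -> : expR s * expR s ^+ m * (cabs (f m.+1 / f m) * cabs (f m)) =
   expR s * cabs (f m.+1 / f m) * (expR s ^+ m * cabs (f m)) by ring.
apply: le_trans (ler_pM _ _ hu IH) _; rewrite ?mulr_ge0 ?exprn_ge0 ?expR_ge0 ?cabs_ge0//.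
rewrite -expRD ler_expR -natr1 (exprS _ m) /Y.
by rewrite le_eqVlt; apply/orP; left; apply/eqP; field.
Qed.

Let K2 : R := (1 + expR 2) * expR (2 * K1).

(** The majorant is used with defect [d = kappa * t^2]. The summed transient errors and the effect
    of the numerator go into [K2]. *)
Lemma one_corner_upper s t m : `|s| <= s0 -> `|t| <= pi ->
  cabs (one_corner_pgf (cexp (s +i* t)) m) <= K2 * expR (m%:R * growth s t).
Proof.
move=> hs tpi.
have [_ _ dd3 _] := delta0_le.
have s1 : `|s| <= 96^-1 by move: hs rr1; rewrite /s0; lra.
have t2 : 0 <= t ^+ 2 <= 4 ^+ 2.
  rewrite exprn_even_ge0//= -(real_normK (num_real t)).
  by apply: ge0_lerXn2r => //; have := pi_lt4 R; lra.
have k0 : 0 <= kappa by rewrite /kappa divr_ge0// ltW.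
have hd : 0 <= kappa * t ^+ 2 <= delta0.
  case/andP: t2 => t20 t21; rewrite mulr_ge0//=.
  apply: le_trans (ler_wpM2l k0 t21) _; rewrite /kappa; lra.
have u12 : 2^-1 <= expR s <= 2.
  have h1 := expR_ge1Dx s; have h2 := expR_ge1Dx (- s).
  move: s1; rewrite ler_norml => /andP[a1 a2]; apply/andP; split; first lra.
  rewrite -[s]opprK expRN -[leRHS]invrK lef_pV2 ?posrE ?expR_gt0 ?invr_gt0//.
  lra.
have ha := cabs_add1_cexp_le u12 tpi (kappa := kappa).
have {}ha := ha ltac:(apply/andP; split => //; rewrite /kappa; lra).
have hv : cabs (cexp (s +i* t)) <= expR s by rewrite cabs_cexp.
apply: le_trans (one_corner_pgf_le m hv ha (expR_gt0 s)) _.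
set d := kappa * t ^+ 2 in hd ha *.
have -> : 1 - (1 + expR s) * (1 - d) / (2 * expR s) = shifted s d.
  rewrite /shifted /rtilt expRN; have := expR_gt0 s; move: (expR s) => u u0.
  by field; rewrite gt_eqF.
have [hr _] := ratio_upper m hs hd.
have f0 := recip_neq0 hr m.
have hq := one_corner_ratio m hr.
have hu := recip_upper m hs hd.
set q := one_corner_series _ m in hq *; set f := recip _ m in f0 hq hu.
have -> : q = q / f * f by field.
rewrite cabsM mulrCA.
have e20 : 0 <= expR 2 :> R := expR_ge0 _.
have b1 : cabs ((shifted s d)%:C : C) <= 1 by have := rr1; lra.
have h1 : cabs (q / f) <= 1 + expR 2.
  have := cabsD (q / f - 1) 1; rewrite subrK cabs1.
  have := ler_wpM2l e20 b1; lra.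
rewrite /K2 -mulrA; apply: ler_pM => //.
- exact: cabs_ge0.
- by rewrite mulr_ge0 ?exprn_ge0 ?expR_ge0 ?cabs_ge0.
- apply: le_trans hu _; rewrite -expRD ler_expR [leRHS]addrC lerD2l.
  rewrite [leRHS]mulrC ler_wpM2l// gerBl mulr_ge0// exprn_ge0//.
Qed.

Lemma full_upper : exists K c r : R, [/\ 0 <= K, 0 < c, 0 < r &
  forall n s t, (0 < n)%N -> `|s| <= r -> `|t| <= pi ->
  cabs (full_pgf (cexp (s +i* t)) n) <=
    K * expR (n%:R * (rcumulant s + K * `|s| ^+ 3 - c * t ^+ 2))].
Proof.
have K20 : 0 <= K2 by rewrite /K2 mulr_ge0 ?expR_ge0// addr_ge0// expR_ge0.
have k0 : 0 < kappa by rewrite /kappa divr_gt0.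
pose K := K1 + 3 * (K2 * K2) * expR 2.
have K0 : 0 <= 3 * (K2 * K2) * expR 2 by rewrite !mulr_ge0// expR_ge0.
have KK1 : K1 <= K by rewrite /K; lra.
exists K, (c1 * kappa), s0; split.
- by rewrite /K addr_ge0.
- by rewrite mulr_gt0// /c1 divr_gt0.
- by rewrite /s0 divr_gt0.
move=> n s t n0 hs tpi.
have s1 : `|s| <= 96^-1 by move: hs rr1; rewrite /s0; lra.
set Y := growth s t.
apply: (@le_trans _ _ (3 * (K2 * K2) * expR 2 * expR (n%:R * Y))); last first.
  apply: ler_pM; rewrite ?expR_ge0//; first by rewrite /K; have := K10; lra.
  rewrite ler_expR ler_wpM2l// /Y /growth -mulrA.
  have : 0 <= `|s| ^+ 3 by rewrite exprn_ge0.
  move=> s3; have := ler_wpM2r s3 KK1; lra.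
have nC : (n%:R : C) != 0 by rewrite pnatr_eq0 -lt0n.
have nR : 0 < n%:R :> R by rewrite ltr0n.
rewrite -(ler_pM2l nR) -{1}(cabs_nat R n) -cabsM full_pgfE cabsM.
have h1 : cabs (cexp (s +i* t)) <= 3.
  have := @cabs_cexp_le3 R s%:C; rewrite cexp_real !cabs_real cabs_cexp.
  by rewrite (ger0_norm (expR_ge0 _)); apply; lra.
have h2 : cabs (\sum_(i < n) one_corner_pgf (cexp (s +i* t)) i *
      one_corner_pgf (cexp (s +i* t)) (n.-1 - i)%N) <=
    n%:R * (K2 * K2 * expR ((n.-1)%:R * Y)).
  apply: le_trans (cabs_sum _ _ _) _.
  rewrite [leRHS]mulr_natl -[X in _ *+ X]card_ord -sumr_const.
  apply: ler_sum => -[i /= lti] _.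
  have g1 := one_corner_upper i hs tpi; have g2 := one_corner_upper (n.-1 - i) hs tpi.
  rewrite cabsM; apply: le_trans (ler_pM (cabs_ge0 _) (cabs_ge0 _) g1 g2) _.
  rewrite mulrACA -expRD -mulrDl -natrD.
  have in1 : (i <= n.-1)%N by rewrite -ltnS prednK.
  by rewrite subnKC.
apply: le_trans (ler_pM (cabs_ge0 _) (cabs_ge0 _) h1 h2) _.
(* The indices in the convolution add up to [n - 1]; passing to [n] costs [expR (- Y)], which is
   bounded. *)
have h3 : expR (n.-1%:R * Y) <= expR 2 * expR (n%:R * Y).
  have nE : n%:R = n.-1%:R + 1 :> R by rewrite natr1 prednK.
  rewrite -expRD ler_expR nE mulrDl mul1r.
  suff : - Y <= 2 by lra.
  have hc : `|rcumulant s| <= 2 * `|s|.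
    by have := @cabs_cumulant R s%:C; rewrite cumulant_real !cabs_real; apply; lra.
  have [dd8 _ _ _] := delta0_le.
  have t2 : t ^+ 2 <= 4 ^+ 2.
    by rewrite -(real_normK (num_real t)); apply: ge0_lerXn2r => //; have := pi_lt4 R; lra.
  have d1 : kappa * t ^+ 2 <= 1.
    by apply: le_trans (ler_wpM2l (ltW k0) t2) _; rewrite /kappa; lra.
  have c11 : c1 * (kappa * t ^+ 2) <= 1.
    have e1 := einv_le1 R; have e0 := einv0.
    apply: mulr_ile1; [by rewrite /c1; lra| |by rewrite /c1; lra|exact: d1].
    by rewrite mulr_ge0 ?(ltW k0) ?exprn_even_ge0.
  have : 0 <= K1 * `|s| ^+ 3 by rewrite mulr_ge0// exprn_ge0.
  move: hc; rewrite ler_norml /Y /growth => /andP[? ?]; lra.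
have := ler_wpM2l (mulr_ge0 (ltW nR) (mulr_ge0 (ler0n R 3) (mulr_ge0 K20 K20))) h3.
lra.
Qed.
End UniformBound.

(** * Local limit theorem *)

Section TiltedCharacteristicFunction.
Local Open Scope complex_scope.
Variable R : realType.
Local Notation C := R[i].
Implicit Types x t y : R.

Lemma sigma_gt0 : 0 < sigma R.
Proof. by rewrite /sigma mulr_gt0 ?expR_gt0// sqrtr_gt0; lra. Qed.

Lemma sigma_sqr : sigma R ^+ 2 = var R.
Proof. by rewrite /sigma /var exprMn sqr_sqrtr//; lra. Qed.

Lemma cube_le_expR (c : R) : 0 < c -> exists2 K : R, 0 <= K &
  forall y, 0 <= y -> y <= K * expR (c * y ^+ 2) /\ y ^+ 3 <= K * expR (c * y ^+ 2).
Proof.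
move=> c0; pose K := 1 + 2 * c^-1 ^+ 2.
have K1 : 0 <= K by rewrite /K addr_ge0// mulr_ge0// exprn_even_ge0.
exists K => // y y0.
have E1 : 1 <= expR (c * y ^+ 2).
  by rewrite -[leLHS]expR0 ler_expR mulr_ge0 ?exprn_even_ge0 ?ltW.
(* [1 + y^4] dominates both [y] and [y^3], and [y^4] is bounded through [w^2 / 2 <= expR w]. *)
have h4 : 1 + y ^+ 4 <= K * expR (c * y ^+ 2).
  rewrite /K mulrDl mul1r; apply: lerD => //.
  set w := c * y ^+ 2.
  have w0 : 0 <= w by rewrite mulr_ge0 ?exprn_even_ge0 ?ltW.
  have hw : w ^+ 2 / 2 <= expR w.
    have h := exp_partial_sum_le 3 w0; rewrite !big_ord_recr big_ord0 /= in h.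
    rewrite fact0 expr0 expr1 divr1 add0r in h.
    have e2 : (2 `!)%:R = 2 :> R by [].
    rewrite e2 in h; apply: le_trans h; rewrite lerDr addr_ge0// divr_ge0//.
  have -> : y ^+ 4 = 2 * c^-1 ^+ 2 * (w ^+ 2 / 2).
    by rewrite /w; field; rewrite gt_eqF.
  by rewrite ler_wpM2l// mulr_ge0// exprn_even_ge0.
have [y1|y1] := leP y 1.
  split; apply: le_trans h4.
    by apply: le_trans y1 _; rewrite lerDl exprn_ge0.
  by apply: (@le_trans _ _ 1); [rewrite exprn_ile1|rewrite lerDl exprn_ge0].
split; apply: le_trans h4.
  by apply: (@le_trans _ _ (y ^+ 4)); [rewrite -{1}[y]expr1 ler_weXn2l// ltW|rewrite lerDr].
by apply: (@le_trans _ _ (y ^+ 4)); [rewrite ler_weXn2l// ltW|rewrite lerDr].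
Qed.

Let saddle x n : R := x / (sigma R * Num.sqrt n%:R).

Let saddleE x n : (0 < n)%N -> x = saddle x n * sigma R * Num.sqrt n%:R.
Proof.
move=> n0; have N0 : 0 < Num.sqrt n%:R :> R by rewrite sqrtr_gt0 ltr0n.
by rewrite /saddle; field; rewrite !gt_eqF ?sigma_gt0.
Qed.

Let Re_realM (a : R) (w : C) : complex.Re (a%:C * w) = a * complex.Re w.
Proof. by case: w => b c /=; rewrite mul0r subr0. Qed.

(* Completing the square: with [s = x / (sigma sqrt n)] the quadratic part of
   the exponent is [- x^2/2 - n sigma^2 t^2/2], and only [th z] is left over. *)
Let exponentE n x th t : (0 < n)%N ->
  n%:R * cumulant (saddle x n +i* t)
    - (mu R * n%:R + x * sigma R * Num.sqrt n%:R - th)%:C * (saddle x n +i* t) =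
  (- (x ^+ 2 / 2) - n%:R * var R / 2 * t ^+ 2)%:C + th%:C * (saddle x n +i* t) :> C.
Proof.
move=> n0; set s := saddle x n; set N := Num.sqrt n%:R.
have N0 : 0 < N by rewrite sqrtr_gt0 ltr0n.
have nE : n%:R = N ^+ 2 by rewrite sqr_sqrtr.
have s0 := sigma_gt0.
have xE : x = s * sigma R * N by rewrite /s /saddle -/N; field; rewrite !gt_eqF.
have xE2 : x ^+ 2 = s ^+ 2 * var R * n%:R by rewrite xE -sigma_sqr nE; ring.
have xE3 : x * sigma R * N = s * var R * n%:R by rewrite xE -sigma_sqr nE; ring.
rewrite xE3 xE2 /cumulant.
have -> : (n%:R : C) = (n%:R : R)%:C by rewrite rmorph_nat.
move: (n%:R : R) (var R) (mu R) => m v u.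
have e2 : (2^-1 : R)%:C = 2^-1 :> C by rewrite fmorphV rmorph_nat.
by apply/eqP; rewrite eq_complex /=; apply/andP; split; apply/eqP; field.
Qed.

(** The integrand of Fourier inversion on the line through the saddle, scaled by [expR (x ^+ 2 / 2)]
    so that its limit is [gauss n t]. The number [th] will be the distance from the real centre down
    to the integer whose probability is extracted. *)
Definition tilted_char n x th t : R :=
  let z := saddle x n +i* t in
  expR (x ^+ 2 / 2) * complex.Re (full_pgf (cexp z) n *
    cexp (- ((mu R * n%:R + x * sigma R * Num.sqrt n%:R - th)%:C * z))).

Let gauss n t : R := expR (- (n%:R * var R / 2) * t ^+ 2).

Let gauss_ge0 n t : 0 <= gauss n t. Proof. exact: expR_ge0. Qed.

Let cube_add (a b : R) : 0 <= a -> 0 <= b -> (a + b) ^+ 3 <= 4 * (a ^+ 3 + b ^+ 3).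
Proof.
move=> a0 b0; have h0 : 0 <= 3 * (a + b) * (a - b) ^+ 2.
  by apply: mulr_ge0; [apply: mulr_ge0 => //; exact: addr_ge0|exact: sqr_ge0].
rewrite -subr_ge0; apply: le_trans h0 _; rewrite le_eqVlt; apply/orP; left.
by apply/eqP; ring.
Qed.

Let cabs_z (s t : R) : cabs (s +i* t) ^+ 3 <= 4 * (`|s| ^+ 3 + `|t| ^+ 3).
Proof.
by apply: le_trans (ge0_lerXn2r 3 (cabs_ge0 _) (cabs_le_ReIm s t)) _; exact: cube_add.
Qed.

Let saddle3 x n : (0 < n)%N -> `|x| ^+ 3 <= Num.sqrt n%:R ->
  n%:R * `|saddle x n| ^+ 3 <= (sigma R)^-1 ^+ 3 * (`|x| ^+ 3 / Num.sqrt n%:R).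
Proof.
move=> n0 _; set N := Num.sqrt n%:R.
have N0 : 0 < N by rewrite sqrtr_gt0 ltr0n.
have nE : n%:R = N ^+ 2 by rewrite sqr_sqrtr.
have s0 := sigma_gt0.
have -> : `|saddle x n| = `|x| / (sigma R * N).
  by rewrite /saddle normrM normfV [X in _ / X]ger0_norm// ltW// mulr_gt0.
by rewrite nE le_eqVlt; apply/orP; left; apply/eqP; field; rewrite !gt_eqF.
Qed.

(** Central range [n |t|^3 <= 1]: with the restriction on [x] it bounds [n |z|^3] by a constant, as
    [full_quasi_power] demands. *)
Let near_bound : exists K n0, 0 <= K /\
  forall n x th t, (n0 <= n)%N -> (0 < n)%N -> `|x| ^+ 3 <= Num.sqrt n%:R ->
  0 <= th <= 1 -> n%:R * `|t| ^+ 3 <= 1 ->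
  `|tilted_char n x th t - gauss n t| <= K * gauss n t *
     (cabs (saddle x n +i* t) + n%:R * cabs (saddle x n +i* t) ^+ 3).
Proof.
have s0 := sigma_gt0.
pose T : R := 4 * ((sigma R)^-1 ^+ 3 + 1).
have T0 : 0 <= T by rewrite mulr_ge0// addr_ge0// exprn_ge0// invr_ge0 ltW.
have [K K0 hK] := full_quasi_power T0.
have q0 := quasi_radius_gt0 R.
(* Beyond this index [n |z|^3 <= T] forces [|z| <= quasi_radius R]. *)
pose n0 := Num.truncn (T / quasi_radius R ^+ 3).
exists (3 * K + 12), n0.+1; split; first by rewrite addr_ge0// mulr_ge0.
move=> n x th t n0n n_gt0 x3 /andP[th0 th1] t3.
have nR : 0 < n%:R :> R by rewrite ltr0n.
set z := saddle x n +i* t.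
have N0 : 0 < Num.sqrt n%:R :> R by rewrite sqrtr_gt0 ltr0n.
have nz : n%:R * cabs z ^+ 3 <= T.
  apply: le_trans (ler_wpM2l (ltW nR) (cabs_z _ _)) _.
  have h := saddle3 n_gt0 x3.
  have h2 : (sigma R)^-1 ^+ 3 * (`|x| ^+ 3 / Num.sqrt n%:R) <= (sigma R)^-1 ^+ 3 * 1.
    rewrite ler_wpM2l ?exprn_ge0 ?invr_ge0 ?(ltW s0)//.
    by rewrite ler_pdivrMr// mul1r.
  by rewrite /T; lra.
have zq : cabs z <= quasi_radius R.
  rewrite -(@ler_pXn2r _ 3)// ?nnegrE ?cabs_ge0 ?(ltW q0)//.
  rewrite -(ler_pM2l nR); apply: le_trans nz _.
  rewrite -ler_pdivrMr ?exprn_gt0//; apply: le_trans (ltW (truncnS_gt _)) _.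
  by rewrite ler_nat.
have z12 := le_trans zq (quasi_radius_le R).
have z1 : cabs z <= 1 by lra.
have := hK z n n_gt0 zq nz.
set W := full_pgf _ n * _ => hW.
set X := cabs z + _ in hW *.
have X0 : 0 <= X by rewrite addr_ge0 ?mulr_ge0 ?exprn_ge0 ?cabs_ge0 ?ler0n.
have e : tilted_char n x th t = gauss n t * complex.Re (W * cexp (th%:C * z)).
  rewrite /tilted_char -/z.
  set k := mu R * _ + _ - th.
  have -> : full_pgf (cexp z) n * cexp (- (k%:C * z)) =
      W * cexp (n%:R * cumulant z - k%:C * z).
    rewrite /W cexpD -mulrA [cexp (- (n%:R * _)) * _]mulrA -cexpD addNr cexp0 mul1r.
    by [].
  rewrite exponentE// cexpD cexp_real mulrCA Re_realM mulrA -expRD.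
  by congr (expR _ * _); ring.
set c := cexp (th%:C * z) in e.
have thz : cabs (th%:C * z) <= cabs z.
  by rewrite cabsM cabs_real ger0_norm// ler_piMl ?cabs_ge0.
have c3 : cabs c <= 3 by apply: cabs_cexp_le3; lra.
have c12 : cabs (c - 1) <= 12 * cabs z.
  by have := @cexp_sub1 R (th%:C * z) (le_trans thz z1); rewrite -/c; lra.
have -> : tilted_char n x th t - gauss n t = gauss n t * complex.Re (W * c - 1).
  by rewrite e raddfB /=; ring.
rewrite normrM (ger0_norm (gauss_ge0 _ _)) [leRHS]mulrAC [leRHS]mulrC ler_wpM2l//.
apply: le_trans (Re_le_cabs _) _.
have -> : W * c - 1 = (W - 1) * c + (c - 1) by ring.
apply: le_trans (cabsD _ _) _; rewrite cabsM.
have h := ler_pM (cabs_ge0 _) (cabs_ge0 _) hW c3.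
have : cabs z <= X by rewrite lerDl mulr_ge0// exprn_ge0// cabs_ge0.
by lra.
Qed.

Let saddle_small (r : R) : 0 < r -> exists n0, forall n x, (n0 <= n)%N -> (0 < n)%N ->
  `|x| ^+ 3 <= Num.sqrt n%:R -> `|saddle x n| <= r.
Proof.
move=> r0; have s0 := sigma_gt0.
exists (Num.truncn ((sigma R)^-1 ^+ 3 / r ^+ 3)).+1 => n x n0n n0 x3.
have nR : 0 < n%:R :> R by rewrite ltr0n.
rewrite -(@ler_pXn2r _ 3)// ?nnegrE ?(ltW r0)//.
rewrite -(ler_pM2l nR); apply: le_trans (saddle3 n0 x3) _.
apply: (@le_trans _ _ ((sigma R)^-1 ^+ 3)).
  rewrite ler_piMr ?exprn_ge0 ?invr_ge0 ?(ltW s0)//.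
  by rewrite ler_pdivrMr ?mul1r// sqrtr_gt0.
rewrite -ler_pdivrMr ?exprn_gt0//; apply: le_trans (ltW (truncnS_gt _)) _.
by rewrite ler_nat.
Qed.

(** At the saddle the real exponents [x^2 / 2 + n * rcumulant s - k s] reduce to [th * s], and
    [n |s|^3] is bounded, so only the decay in [t] of [full_upper] is left. *)
Let far_bound : exists K c n0, [/\ 0 <= K, 0 < c &
  forall n x th t, (n0 <= n)%N -> (0 < n)%N -> `|x| ^+ 3 <= Num.sqrt n%:R ->
  0 <= th <= 1 -> `|t| <= pi ->
  `|tilted_char n x th t| <= K * expR (- (c * n%:R) * t ^+ 2)].
Proof.
have s0 := sigma_gt0.
have [K [c [r [K0 c0 r0 hK]]]] := full_upper R.
have [n0 hn0] := @saddle_small (Num.min r 1) ltac:(by rewrite lt_min r0 ltr01).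
exists (K * expR (K * (sigma R)^-1 ^+ 3 + 1)), c, n0; split=> //.
  by rewrite mulr_ge0 ?expR_ge0.
move=> n x th t n0n n_gt0 x3 /andP[th0 th1] tpi.
have := hn0 n x n0n n_gt0 x3; rewrite le_min => /andP[sr s1].
have hu := hK n (saddle x n) t n_gt0 sr tpi.
rewrite /tilted_char normrM (ger0_norm (expR_ge0 _)).
apply: le_trans (ler_wpM2l (expR_ge0 _) (Re_le_cabs _)) _.
rewrite cabsM cabs_cexp.
set s := saddle x n in sr s1 hu *; set k := mu R * _ + _ - th.
have -> : complex.Re (- (k%:C * (s +i* t))) = - (k * s) by rewrite /= mul0r subr0.
have xE := saddleE x n_gt0; rewrite -/s in xE.
have N0 : 0 < Num.sqrt n%:R :> R by rewrite sqrtr_gt0 ltr0n.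
have nE : n%:R = Num.sqrt n%:R ^+ 2 :> R by rewrite sqr_sqrtr.
have ke : x ^+ 2 / 2 + n%:R * rcumulant s - k * s = th * s.
  rewrite /k /rcumulant -sigma_sqr; move: xE nE.
  move: (x) (s) (Num.sqrt (n%:R : R)) => X S N; move: (n%:R : R) => m -> ->.
  by field.
have ts : th * s <= 1.
  apply: le_trans (ler_norm _) _; rewrite normrM mulr_ile1// ger0_norm//.
have ns : K * (n%:R * `|s| ^+ 3) <= K * (sigma R)^-1 ^+ 3.
  rewrite ler_wpM2l//; apply: le_trans (saddle3 n_gt0 x3) _.
  rewrite ler_piMr ?exprn_ge0 ?invr_ge0 ?(ltW s0)//.
  by rewrite ler_pdivrMr ?mul1r.
rewrite mulrA mulrAC -expRD.
apply: le_trans (ler_wpM2l (expR_ge0 _) hu) _.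
rewrite mulrCA -[leRHS]mulrA ler_wpM2l// -!expRD ler_expR.
by move: ke; lra.
Qed.

(** The bound covers all real [t], with 0 outside the period, so that the integral can be compared
    with the Gaussian integral over the line. The regimes are separated by [n |t|^3 = 1]; in the
    near one, powers of [y = sqrt n |t|] are traded for part of the Gaussian. *)
Lemma tilted_char_bound : exists K c n0, [/\ 0 <= K, 0 < c &
  forall n x th t, (n0 <= n)%N -> (0 < n)%N -> `|x| ^+ 3 <= Num.sqrt n%:R ->
  0 <= th <= 1 ->
  `|(if `|t| <= pi then tilted_char n x th t else 0) - gauss n t| <=
  K * ((1 + `|x| ^+ 3) / Num.sqrt n%:R) * expR (- (c * n%:R) * t ^+ 2)].
Proof.
have s0 := sigma_gt0; have v0 := var_gt0 R.
have [K1 [n1 [K10 h1]]] := near_bound.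
have [K2 [c2 [n2 [K20 c20 h2]]]] := far_bound.
pose c := Num.min (var R / 4) (c2 / 2).
have c0 : 0 < c by rewrite lt_min; apply/andP; split; lra.
have cv : c <= var R / 4 by rewrite ge_min lexx.
have cc2 : c <= c2 / 2 by rewrite ge_min lexx orbT.
have [K3 K30 h3] := @cube_le_expR (var R / 4) ltac:(lra).
have [K4 K40 h4] := cube_le_expR c0.
pose i1 := (sigma R)^-1.
have i10 : 0 < i1 by rewrite invr_gt0.
pose A := K1 * (i1 + 4 * i1 ^+ 3 + 5 * K3).
have A0 : 0 <= A.
  by rewrite /A mulr_ge0// !addr_ge0 ?mulr_ge0 ?exprn_ge0 ?(ltW i10).
have B0 : 0 <= (K2 + 1) * K4 by rewrite mulr_ge0// addr_ge0.
exists (A + (K2 + 1) * K4), c, (maxn n1 n2); split=> //; first by rewrite addr_ge0.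
move=> n x th t; rewrite geq_max => /andP[n1n n2n] n_gt0 x3 th01.
set N := Num.sqrt n%:R in x3 *.
have N0 : 0 < N by rewrite sqrtr_gt0 ltr0n.
have nE : n%:R = N ^+ 2 :> R by rewrite sqr_sqrtr.
set y := N * `|t|.
have y0 : 0 <= y by rewrite mulr_ge0// ltW.
have yE : y ^+ 2 = n%:R * t ^+ 2 by rewrite exprMn nE real_normK ?num_real.
set U := (1 + `|x| ^+ 3) / N.
have ax0 : 0 <= `|x| ^+ 3 by rewrite exprn_ge0.
have U0 : 0 <= U by rewrite divr_ge0 ?addr_ge0// ltW.
have NU : N^-1 <= U by rewrite /U ler_peMl ?invr_ge0 ?(ltW N0)// lerDl.
have gE : gauss n t = expR (- (var R / 2 * y ^+ 2)) by rewrite /gauss yE; congr expR; ring.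
have tgtE : expR (- (c * n%:R) * t ^+ 2) = expR (- (c * y ^+ 2)).
  by rewrite yE; congr expR; ring.
rewrite tgtE.
have y20 : 0 <= y ^+ 2 by rewrite exprn_ge0.
have tgt0 : 0 <= expR (- (c * y ^+ 2)) := expR_ge0 _.
have AU0 : 0 <= A * U := mulr_ge0 A0 U0.
have [t3|t3] := leP (n%:R * `|t| ^+ 3) 1.
  have tpi : `|t| <= pi.
    have t1 : `|t| <= 1.
      rewrite -(@ler_pXn2r _ 3)// ?nnegrE// expr1n; apply: le_trans t3.
      by rewrite ler_peMl ?exprn_ge0// ler1n.
    by apply: le_trans t1 _; have := @pi_ge2 R; lra.
  rewrite tpi; apply: le_trans (h1 n x th t n1n n_gt0 x3 th01 t3) _.
  set z := saddle x n +i* t.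
  set X := cabs z + _.
  have hX : X <= U * (i1 + 4 * i1 ^+ 3) + N^-1 * (y + 4 * y ^+ 3).
    have z1 := cabs_le_ReIm (saddle x n) t.
    have z3 := ler_wpM2l (ler0n R n) (cabs_z (saddle x n) t).
    have s3 := saddle3 n_gt0 x3; rewrite -/N in s3.
    have p3 : (sigma R)^-1 ^+ 3 * (`|x| ^+ 3 / N) <= U * i1 ^+ 3.
      rewrite mulrC ler_wpM2r ?exprn_ge0 ?(ltW i10)//.
      by rewrite /U ler_wpM2r ?invr_ge0 ?(ltW N0)// lerDr.
    have p1 : `|saddle x n| <= U * i1.
      rewrite /saddle -/N invfM normrM [X in _ * X <= _]ger0_norm; last first.
        by rewrite mulr_ge0 ?invr_ge0// ltW.
      rewrite -/i1 [i1 * _]mulrC mulrA ler_wpM2r ?(ltW i10)//.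
      rewrite /U ler_wpM2r ?invr_ge0 ?(ltW N0)//.
      have [x1|x1] := leP `|x| 1; first by apply: le_trans x1 _; rewrite lerDl.
      by apply: (@le_trans _ _ (`|x| ^+ 3)); [rewrite -{1}(expr1 `|x|) ler_weXn2l// ltW|rewrite lerDr].
    have q1 : `|t| = N^-1 * y by rewrite /y mulrA mulVf ?mul1r// gt_eqF.
    have q3 : n%:R * `|t| ^+ 3 = N^-1 * y ^+ 3.
      by rewrite /y nE; field; rewrite gt_eqF.
    have e : n%:R * (4 * (`|saddle x n| ^+ 3 + `|t| ^+ 3)) =
       4 * (n%:R * `|saddle x n| ^+ 3) + 4 * (n%:R * `|t| ^+ 3) by ring.
    rewrite e q3 in z3; rewrite /X -/z q1 in z1 *; rewrite -/z in z3; lra.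
  have [k1 k3] := h3 y y0.
  set E := expR (var R / 4 * y ^+ 2) in k1 k3.
  have E1 : 1 <= E.
    by rewrite /E -[leLHS]expR0 ler_expR mulr_ge0// divr_ge0// ltW.
  have hX2 : X <= U * (i1 + 4 * i1 ^+ 3 + 5 * K3) * E.
    apply: le_trans hX _; rewrite [U * (_ + 5 * _)]mulrDr [leRHS]mulrDl; apply: lerD.
      by rewrite ler_peMr// mulr_ge0// addr_ge0 ?mulr_ge0 ?exprn_ge0 ?(ltW i10).
    rewrite -mulrA; apply: ler_pM => //; rewrite ?invr_ge0 ?(ltW N0)//.
      by rewrite addr_ge0// mulr_ge0// exprn_ge0.
    lra.
  have gEE : gauss n t * E <= expR (- (c * y ^+ 2)).
    rewrite gE /E -expRD ler_expR.
    have := ler_wpM2r y20 cv; lra.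
  apply: (@le_trans _ _ (K1 * gauss n t * (U * (i1 + 4 * i1 ^+ 3 + 5 * K3) * E))).
    by rewrite ler_wpM2l// mulr_ge0.
  have -> : K1 * gauss n t * (U * (i1 + 4 * i1 ^+ 3 + 5 * K3) * E) =
     A * U * (gauss n t * E) by rewrite /A; ring.
  have gE0 : 0 <= gauss n t * E := mulr_ge0 (gauss_ge0 n t) (expR_ge0 _).
  have AB : A * U <= (A + (K2 + 1) * K4) * U by apply: ler_wpM2r => //; rewrite lerDl.
  exact: ler_pM AU0 gE0 AB gEE.
(* In the far regime [y^3 = N * (n |t|^3) >= N], so half of the decay already yields the factor
   [1 / sqrt n]. *)
have hy : N <= K4 * expR (c * y ^+ 2).
  have [_ k] := h4 y y0; apply: le_trans k.
  have -> : y ^+ 3 = N * (n%:R * `|t| ^+ 3) by rewrite /y nE; ring.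
  by rewrite ler_peMr ?(ltW N0)// ltW.
have far : expR (- (c * y ^+ 2)) <= K4 * U.
  apply: (@le_trans _ _ (K4 * N^-1)); last by rewrite ler_wpM2l.
  rewrite expRN -[leLHS]mul1r ler_pdivrMr ?expR_gt0//.
  by rewrite mulrAC ler_pdivlMr// mul1r.
have far2 (w d : R) : c * 2 <= d -> expR (- (d * y ^+ 2)) <=
    K4 * U * expR (- (c * y ^+ 2)).
  move=> cd; apply: le_trans (ler_wpM2r tgt0 far).
  rewrite -expRD ler_expR; have := ler_wpM2r y20 cd; lra.
have fg : gauss n t <= K4 * U * expR (- (c * y ^+ 2)).
  by rewrite gE; apply: far2 => //; lra.
have KU : 0 <= K4 * U by rewrite mulr_ge0.
have -> : (A + (K2 + 1) * K4) * U * expR (- (c * y ^+ 2)) =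
   A * U * expR (- (c * y ^+ 2)) + K2 * (K4 * U * expR (- (c * y ^+ 2)))
   + K4 * U * expR (- (c * y ^+ 2)) by ring.
have P1 : 0 <= A * U * expR (- (c * y ^+ 2)) := mulr_ge0 AU0 tgt0.
have P2 : 0 <= K2 * (K4 * U * expR (- (c * y ^+ 2))) := mulr_ge0 K20 (mulr_ge0 KU tgt0).
apply: le_trans (ler_normB _ _) _; rewrite (ger0_norm (gauss_ge0 _ _)) lerD//.
rewrite -[leLHS]add0r lerD//.
case: ifP => tpi; last by rewrite normr0.
apply: le_trans (h2 n x th t n2n n_gt0 x3 th01 tpi) _.
rewrite ler_wpM2l//; have := far2 0 c2 ltac:(lra).
by apply: le_trans; rewrite ler_expR yE; lra.
Qed.

End TiltedCharacteristicFunction.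

(** * Fourier orthogonality and Gaussian integrals *)

Section FourierGauss.
Local Open Scope complex_scope.
Local Open Scope classical_set_scope.
Local Open Scope ring_scope.
Variable R : realType.
Local Notation C := R[i].
Local Notation leb := (@lebesgue_measure R).

Lemma sin_intmul_pi (k : int) : sin (k%:~R * pi) = 0 :> R.
Proof.
have nat_case (n : nat) : sin (n%:R * pi) = 0 :> R.
  elim: n => [|n IH]; first by rewrite mul0r sin0.
  by rewrite -natr1 mulrDl mul1r sinDpi IH oppr0.
by case: k => n; rewrite ?NegzE ?mulrNz ?mulNr ?sinN nat_case ?oppr0.
Qed.

Let is_derive_linear (m t : R) : is_derive t 1 (fun u : R => m * u) m.
Proof.
have h : is_derive t 1 (m \*: (id : R -> R)) (m *: 1) by apply: is_deriveZ.
by apply: (is_derive_eq h); rewrite /GRing.scale /= mulr1.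
Qed.

Let is_derive_scale (f : R -> R) (df m t : R) : is_derive t 1 f df ->
  is_derive t 1 (fun u : R => m * f u) (m * df).
Proof. by move=> h; exact: (@is_deriveZ _ _ _ f m t 1 df h). Qed.

Lemma derivable_cos_sum (n : nat) (a : nat -> R) (m : nat -> int) (t : R) :
  derivable (fun u : R => \sum_(j < n) a j * cos ((m j)%:~R * u)) t 1.
Proof.
have -> : (fun u : R => \sum_(j < n) a j * cos ((m j)%:~R * u)) =
    \sum_(j < n) (fun u : R => a j * cos ((m j)%:~R * u)).
  by apply/funext => u; rewrite fct_sumE.
apply: derivable_sum => j.
have h : is_derive t 1 (cos \o (fun u : R => (m j)%:~R * u)) (- sin ((m j)%:~R * t) * (m j)%:~R).
  by apply: is_derive1_comp.
by have [] := is_derive_scale (a j) h.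
Qed.

Lemma integral_cos_sum (n : nat) (a : nat -> R) (m : nat -> int) :
  \int[leb]_(t in `[(- pi)%R, pi]) (\sum_(j < n) a j * cos ((m j)%:~R * t))
  = 2 * pi * \sum_(j < n | m j == 0) a j.
Proof.
pose F j (t : R) : R := if m j == 0 then t else (m j)%:~R^-1 * sin ((m j)%:~R * t).
pose G (t : R) : R := \sum_(j < n) a j * F j t.
pose g (t : R) : R := \sum_(j < n) a j * cos ((m j)%:~R * t).
have dG (t : R) : is_derive t 1 G (g t).
  have -> : G = \sum_(j < n) (fun u : R => a j * F j u).
    by apply/funext => u; rewrite fct_sumE.
  apply: is_derive_sum => j; apply: is_derive_scale; rewrite /F.
  case: eqP => [->|/eqP m0]; first by rewrite mul0r cos0; exact: is_derive_id.
  have h : is_derive t 1 (sin \o (fun u : R => (m j)%:~R * u)) (cos ((m j)%:~R * t) * (m j)%:~R).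
    by apply: is_derive1_comp.
  apply: (is_derive_eq (is_derive_scale _ h)).
  by rewrite mulrCA mulVf ?mulr1// intr_eq0.
have cg (t : R) : derivable g t 1 by exact: derivable_cos_sum.
have contG : continuous G.
  by move=> t; apply/differentiable_continuous/derivable1_diffP; case: (dG t).
have pi0 := pi_gt0 R.
rewrite /Rintegral (@continuous_FTC2 _ g G) -?EFinB /=.
- rewrite mulr_sumr -sumrB (big_mkcond (fun j : 'I_n => m j == 0)) /=; apply: eq_bigr => j _.
  rewrite /F; case: ifP => _; first by ring.
  by rewrite mulrN sinN sin_intmul_pi oppr0 !mulr0 subrr.
- by lra.
- by apply: derivable_within_continuous => t _.
- split; first by move=> t _; case: (dG t).
  + by apply: cvg_at_right_filter; exact: contG.
  + by apply: cvg_at_left_filter; exact: contG.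
- by move=> t _; rewrite derive1E; case: (dG t).
Qed.

Section Gauss.
Variable a : R.
Hypothesis a0 : 0 < a.

Let s : R := Num.sqrt (2 * a)^-1.
Let s_gt0 : 0 < s. Proof. by rewrite sqrtr_gt0 invr_gt0 mulr_gt0. Qed.
Let s2 : s ^+ 2 = (2 * a)^-1. Proof. by rewrite sqr_sqrtr// invr_ge0 mulr_ge0// ltW. Qed.

Let gaussE : (fun t => expR (- a * t ^+ 2)) =
  (fun t => Num.sqrt (pi / a) * normal_pdf 0 s t).
Proof.
apply/funext => t; rewrite normal_pdfE ?gt_eqF//.
rewrite /normal_peak /normal_fun subr0 s2.
have -> : (2 * a)^-1 * pi *+ 2 = pi / a by rewrite -mulr_natr; field; rewrite gt_eqF.
have -> : (2 * a)^-1 *+ 2 = a^-1 by rewrite -mulr_natr; field; rewrite gt_eqF.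
rewrite invrK [RHS]mulrA divff ?mul1r ?gt_eqF ?sqrtr_gt0 ?divr_gt0 ?pi_gt0//.
by congr expR; ring.
Qed.

Lemma integrable_gauss :
  leb.-integrable setT (EFin \o (fun t => expR (- a * t ^+ 2))).
Proof.
rewrite gaussE; have := integrableZl measurableT (Num.sqrt (pi / a)) (integrable_normal_pdf 0 s).
by [].
Qed.

Lemma integral_gauss : \int[leb]_t expR (- a * t ^+ 2) = Num.sqrt (pi / a).
Proof.
rewrite gaussE RintegralZl//; last exact: integrable_normal_pdf.
by rewrite /Rintegral integral_normal_pdf mulr1.
Qed.
End Gauss.

Lemma gauss_integral_approx (h : R -> R) (b a c M : R) : {within `[(- b)%R, b], continuous h} ->
  0 < a -> 0 < c -> 0 <= M ->
  (forall t, `|(if `|t| <= b then h t else 0) - expR (- a * t ^+ 2)| <=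
             M * expR (- c * t ^+ 2)) ->
  `|\int[leb]_(t in `[(- b)%R, b]) h t - Num.sqrt (pi / a)| <= M * Num.sqrt (pi / c).
Proof.
move=> ch a0 c0 M0 hM.
have mI : measurable (`[(- b)%R, b] : set (measurableTypeR R)) by exact: measurable_itv.
have ih : leb.-integrable `[(- b)%R, b] (EFin \o h).
  by apply: continuous_compact_integrable => //; exact: segment_compact.
have ih' : leb.-integrable setT (EFin \o (h \_ `[(- b)%R, b])).
  have := (@integrable_mkcond _ _ R leb _ (EFin \o h) mI).1 ih.
  by congr (integrable _ _ _); apply/funext => t; rewrite restrict_EFin.
have ia := integrable_gauss a0; have ic := integrable_gauss c0.
rewrite Rintegral_mkcond -(integral_gauss a0) -RintegralB//.
have ib : leb.-integrable setT (EFin \o (fun t => (h \_ `[(- b)%R, b]) t - expR (- a * t ^+ 2))).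
  exact: (integrableB measurableT ih' ia).
apply: le_trans (le_normr_Rintegral measurableT ib) _.
rewrite -(integral_gauss c0) -RintegralZl//.
apply: le_Rintegral => //.
- exact: (integrable_norm ib).
- exact: (integrableZl measurableT M ic).
- move=> t _; apply: le_trans (hM t); rewrite patchE mem_setE in_itv /= -(ler_norml t b).
  by [].
Qed.

End FourierGauss.

(** * Fourier inversion for the number of occupied seats *)

Section LocalLimit.
Local Open Scope complex_scope.
Variable R : realType.
Local Notation C := R[i].

Definition card_prob (n j : nat) : R :=
  seating_prob R (empty_ladder n) (fun X => #|` X|%fset == j).

Lemma empty_ladderE n : empty_ladder n = two_rows 1 n%:Z 1 n%:Z.
Proof.
apply/fsetP => -[r c]; rewrite in_two_rows /= if_same.
apply/imfset2P/idP => [[r' _ [c' + [_ ->]]]|hc].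
  by rewrite /= mem_iota; lia.
exists r; first by case: r.
exists (absz c); first by rewrite /= mem_iota; lia.
by congr (_, _); lia.
Qed.

Lemma card_empty_ladder n : #|` empty_ladder n|%fset = (n + n)%N.
Proof. by rewrite empty_ladderE (@card_two_rows n n); lia. Qed.

Lemma full_pgf_prob n (v : C) :
  full_pgf v n = \sum_(j < (n + n).+1) (card_prob n j)%:C * v ^+ j.
Proof.
rewrite /card_prob /seating_prob card_empty_ladder.
rewrite (@seating_prob_from_pgf R C (real_complex R)).
- by rewrite cardfs0 mul1r /full_pgf /occupied_pgf -empty_ladderE card_empty_ladder.
- by rewrite cardfs0 card_empty_ladder.
- exact: fdisjoint0X.
Qed.

Lemma card_prob_ge0 n j : 0 <= card_prob n j.
Proof. exact: seating_prob_from_ge0. Qed.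

Lemma seating_prob_card n (e : pred nat) :
  seating_prob R (empty_ladder n) (fun X => e #|` X|%fset) =
  \sum_(j < (n + n).+1 | e j) card_prob n j.
Proof.
by apply: seating_prob_from_card; rewrite cardfs0 card_empty_ladder.
Qed.

Lemma sum_card_prob n : \sum_(j < (n + n).+1) card_prob n j = 1.
Proof. by rewrite -(seating_prob_card n xpredT) seating_prob_total. Qed.

Definition int_prob n (k : int) : R :=
  \sum_(j < (n + n).+1 | j%:Z == k) card_prob n j.

Lemma tilted_charE n x th t (k : int) :
  k%:~R = mu R * n%:R + x * sigma R * Num.sqrt n%:R - th ->
  tilted_char n x th t = \sum_(j < (n + n).+1)
    (expR (x ^+ 2 / 2) * card_prob n j *
     expR ((j%:Z - k)%:~R * (x / (sigma R * Num.sqrt n%:R)))) * cos ((j%:Z - k)%:~R * t).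
Proof.
move=> kE; rewrite /tilted_char -kE; set s := x / _.
rewrite full_pgf_prob mulr_suml raddf_sum mulr_sumr; apply: eq_bigr => j _.
rewrite cexpX -[_%:C * _ * _]mulrA -cexpD.
have -> : j%:R * (s +i* t) - (k%:~R)%:C * (s +i* t) =
    ((j%:Z - k)%:~R * s) +i* ((j%:Z - k)%:~R * t).
  rewrite -mulrBl -(rmorph_nat (real_complex R)) -rmorphB /=.
  have -> : (j%:Z - k)%:~R = j%:R - k%:~R :> R by rewrite rmorphB.
  by apply/eqP; rewrite eq_complex /=; apply/andP; split; apply/eqP; ring.
by rewrite /cexp /=; ring.
Qed.

(** The freedom in [th] serves two purposes: [th = 0] when [x] is the exact standardised position of
    [k], as in the Berry-Esseen sum, and the fractional part when [x] is arbitrary. *)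
Theorem local_limit : exists K n0, 0 <= K /\
  forall n x th (k : int), (n0 <= n)%N -> (0 < n)%N -> `|x| ^+ 3 <= Num.sqrt n%:R ->
  0 <= th <= 1 -> k%:~R = mu R * n%:R + x * sigma R * Num.sqrt n%:R - th ->
  `|int_prob n k * (Num.sqrt (2 * pi * n%:R) * sigma R) * expR (x ^+ 2 / 2) - 1|
   <= K * ((1 + `|x| ^+ 3) / Num.sqrt n%:R).
Proof.
have [K [c [n0 [K0 c0 hK]]]] := tilted_char_bound R.
have s0 := sigma_gt0 R; have v0 := var_gt0 R; have pi0 := pi_gt0 R.
pose L : R := Num.sqrt (2 * pi) * sigma R / (2 * pi) * Num.sqrt (pi / c).
have L0 : 0 <= L.
  by rewrite /L !mulr_ge0 ?invr_ge0 ?sqrtr_ge0 ?mulr_ge0 ?(ltW s0) ?(ltW pi0).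
exists (K * L), n0; split; first exact: mulr_ge0.
move=> n x th k n0n n_gt0 x3 th01 kE.
have nR : 0 < n%:R :> R by rewrite ltr0n.
set N := Num.sqrt n%:R in x3 *.
have N0 : 0 < N by rewrite sqrtr_gt0.
have nE : n%:R = N ^+ 2 :> R by rewrite sqr_sqrtr// ltW.
set U := (1 + `|x| ^+ 3) / N.
have U0 : 0 <= U by rewrite divr_ge0 ?addr_ge0 ?exprn_ge0// ltW.
pose a j := expR (x ^+ 2 / 2) * card_prob n j *
     expR ((j%:Z - k)%:~R * (x / (sigma R * Num.sqrt n%:R))).
pose h (t : R) := \sum_(j < (n + n).+1) a j * cos ((j%:Z - k)%:~R * t).
have ch : continuous h.
  move=> t; apply/differentiable_continuous/derivable1_diffP.
  exact: (@derivable_cos_sum R _ a (fun j => j%:Z - k) t).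
have a0 : 0 < n%:R * var R / 2 by apply: divr_gt0 => //; exact: mulr_gt0.
have cn0 : 0 < c * n%:R by rewrite mulr_gt0.
have := @gauss_integral_approx R h pi _ _ (K * U) (continuous_subspaceT ch) a0 cn0 (mulr_ge0 K0 U0) _.
rewrite (@integral_cos_sum R _ a (fun j => j%:Z - k)).
have -> : \sum_(j < (n + n).+1 | j%:Z - k == 0) a j = expR (x ^+ 2 / 2) * int_prob n k.
  rewrite /int_prob mulr_sumr; apply: eq_big => [j|j]; rewrite subr_eq0// => /eqP jk.
  by rewrite /a jk subrr mul0r expR0 mulr1.
have -> : Num.sqrt (pi / (n%:R * var R / 2)) = Num.sqrt (2 * pi) / (N * sigma R).
  have -> : pi / (n%:R * var R / 2) = 2 * pi * ((N * sigma R)^-1) ^+ 2.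
    by rewrite nE -sigma_sqr; field; rewrite !gt_eqF.
  by rewrite sqrtrM ?mulr_ge0 ?(ltW pi0)// sqrtr_sqr ger0_norm// invr_ge0 ltW// mulr_gt0.
have -> : Num.sqrt (pi / (c * n%:R)) = Num.sqrt (pi / c) / N.
  by rewrite invfM mulrA sqrtrM ?divr_ge0 ?(ltW c0) ?(ltW pi0)// sqrtrV ?(ltW nR).
have -> : Num.sqrt (2 * pi * n%:R) = Num.sqrt (2 * pi) * N.
  by rewrite sqrtrM// mulr_ge0 ?(ltW pi0).
set q := Num.sqrt (2 * pi).
have q0 : 0 < q by rewrite sqrtr_gt0 mulr_gt0.
have qE : q ^+ 2 = 2 * pi by rewrite sqr_sqrtr// mulr_ge0// ltW.
set g := Num.sqrt (pi / c); set E := expR (x ^+ 2 / 2); set P := int_prob n k.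
move=> hI.
have {}hI : `|2 * pi * (E * P) - q / (N * sigma R)| <= K * U * (g / N).
  apply: hI => t; have := hK n x th t n0n n_gt0 x3 th01.
  by rewrite (tilted_charE _ kE).
have m0 : 0 <= q * N * sigma R / (2 * pi).
  by rewrite divr_ge0 ?mulr_ge0 ?(ltW q0) ?(ltW N0) ?(ltW s0) ?(ltW pi0).
have -> : P * (q * N * sigma R) * E - 1 =
   q * N * sigma R / (2 * pi) * (2 * pi * (E * P) - q / (N * sigma R)).
  rewrite -qE; field.
  by rewrite !gt_eqF.
rewrite normrM ger0_norm//.
apply: le_trans (ler_wpM2l m0 hI) _.
rewrite le_eqVlt; apply/orP; left; apply/eqP; rewrite /L -/q -/g.
by clearbody q g; move: (pi : R) pi0 => p p0; field; rewrite !gt_eqF.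
Qed.

End LocalLimit.

(** * Berry-Esseen bound *)

Section NormalCdf.
Local Open Scope classical_set_scope.
Local Open Scope ring_scope.
Variable R : realType.
Local Notation leb := (@lebesgue_measure R).
Local Notation phi := (normal_pdf (0 : R) 1).

Lemma PhiE (x : R) : Phi x = \int[leb]_(t in `]-oo, x]) phi t.
Proof. by []. Qed.

Lemma phiE (t : R) : phi t = expR (- t ^+ 2 / 2) / Num.sqrt (2 * pi).
Proof.
rewrite normal_pdfE ?oner_neq0// /normal_peak /normal_fun subr0 expr1n mul1r.
have -> : pi *+ 2 = 2 * pi :> R by rewrite mulr_natl.
by rewrite mulrC.
Qed.

Let iphi (D : set R) : measurable D -> leb.-integrable D (EFin \o phi).
Proof.
move=> mD; apply: (@integrableS _ _ _ leb setT) => //.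
exact: integrable_normal_pdf.
Qed.

Let phi_ge0 t : 0 <= phi t. Proof. exact: normal_pdf_ge0. Qed.

Lemma Phi_diff (a b : R) : a <= b -> Phi b - Phi a = \int[leb]_(t in `]a, b]) phi t.
Proof.
move=> ab; rewrite !PhiE Rintegral_itvB//.
by apply: iphi.
Qed.

Lemma Phi_mean_value (a b m M : R) : a <= b ->
  (forall t, a <= t <= b -> m <= phi t <= M) ->
  m * (b - a) <= Phi b - Phi a <= M * (b - a).
Proof.
move=> ab hm; rewrite Phi_diff//.
have mD : measurable (`]a, b] : set (measurableTypeR R)) by exact: measurable_itv.
have mu_ab : fine (leb `]a, b]) = b - a.
  rewrite lebesgue_measure_itv /= lte_fin; case: ltP => // ba.
  by rewrite (le_anti (introT andP (conj ab ba))) subrr.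
have ic (r : R) : leb.-integrable `]a, b] (EFin \o cst r).
  apply: (@integrableS _ _ _ leb `[a, b]) => //.
  - by apply: subset_itv; rewrite bnd_simp.
  - apply: continuous_compact_integrable; first exact: segment_compact.
    by apply: continuous_subspaceT => t; exact: cst_continuous.
rewrite -mu_ab -!(Rintegral_cst leb mD); apply/andP; split.
  apply: le_Rintegral; [exact: mD|exact: ic|exact: iphi|].
  move=> t; rewrite /= in_itv /= => /andP[at_ tb].
  by have /andP[] := hm t (introT andP (conj (ltW at_) tb)).
apply: le_Rintegral; [exact: mD|exact: iphi|exact: ic|].
move=> t; rewrite /= in_itv /= => /andP[at_ tb].
by have /andP[] := hm t (introT andP (conj (ltW at_) tb)).
Qed.

Lemma phi_le_expR (t : R) : phi t <= expR (- t ^+ 2 / 2).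
Proof.
rewrite phiE ler_piMr ?expR_ge0// invf_le1 ?sqrtr_gt0 ?mulr_gt0 ?pi_gt0//.
rewrite -[leLHS]sqrtr1 ler_wsqrtr//; have := @pi_ge2 R; lra.
Qed.

Let tail_integral : exists2 K : R, 0 <= K & forall (D : set R) y,
  measurable D -> 0 < y -> (forall t, D t -> y <= `|t|) ->
  \int[leb]_(t in D) phi t <= K / y ^+ 3.
Proof.
have [K K0 hK] := @cube_le_expR R 4^-1 ltac:(by rewrite invr_gt0).
have q0 : 0 < 4^-1 :> R by rewrite invr_gt0.
have ig := integrable_gauss q0.
exists (K * Num.sqrt (pi / 4^-1)); first by rewrite mulr_ge0 ?sqrtr_ge0.
move=> D y mD y0 hD; have y3 : 0 < y ^+ 3 by rewrite exprn_gt0.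
rewrite mulrAC -(integral_gauss q0) -RintegralZl// Rintegral_mkcond.
apply: le_Rintegral => //.
- have := (@integrable_mkcond _ _ R leb _ (EFin \o phi) mD).1 (iphi mD).
  by congr (integrable _ _ _); apply/funext => t; rewrite restrict_EFin.
- exact: (integrableZl measurableT (K / y ^+ 3) ig).
- move=> t _; rewrite patchE; case: ifPn => [|_]; last first.
    by rewrite mulr_ge0 ?expR_ge0// divr_ge0// ltW.
  rewrite inE => /hD yt; apply: le_trans (phi_le_expR t) _.
  rewrite mulrAC ler_pdivlMr//.
  have [_ h] := hK `|t| (normr_ge0 t); rewrite real_normK ?num_real// in h.
  have h2 := ge0_lerXn2r 3 (ltW y0) yt.
  apply: le_trans (ler_wpM2l (expR_ge0 _) (le_trans h2 h)) _.
  by rewrite mulrCA ler_wpM2l// -expRD ler_expR; lra.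
Qed.

Lemma Phi_ge0 (x : R) : 0 <= Phi x.
Proof. by rewrite PhiE; apply: Rintegral_ge0 => t _. Qed.

Lemma Phi_compl (y : R) : 1 - Phi y = \int[leb]_(t in `]y, +oo[) phi t.
Proof.
have e : \int[leb]_(t in `]-oo, +oo[) phi t = 1.
  by rewrite set_itvE /Rintegral integral_normal_pdf.
rewrite -[X in X - _]e PhiE.
by apply: Rintegral_itvB; [exact: iphi|rewrite bnd_simp|rewrite bnd_simp].
Qed.

Lemma Phi_le1 (x : R) : Phi x <= 1.
Proof. by rewrite -subr_ge0 Phi_compl; apply: Rintegral_ge0 => t _. Qed.

Lemma Phi_homo (a b : R) : a <= b -> Phi a <= Phi b.
Proof. by move=> ab; rewrite -subr_ge0 Phi_diff//; apply: Rintegral_ge0 => t _. Qed.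

(** Cubic decay is the rate wanted: at [y] of order [n^(1/6)], the edge of the local range, it is
    [O(1 / sqrt n)]. *)
Lemma Phi_tail : exists2 K : R, 0 <= K & forall y, 0 < y ->
  Phi (- y) <= K / y ^+ 3 /\ 1 - Phi y <= K / y ^+ 3.
Proof.
have [K K0 hK] := tail_integral; exists K => // y y0; split.
  rewrite PhiE; apply: hK => // t; rewrite /= in_itv /= => ty.
  by rewrite -normrN; apply: le_trans (ler_norm _); rewrite lerNr.
rewrite Phi_compl; apply: hK => // t; rewrite /= in_itv /= andbT => ty.
by apply: le_trans (ler_norm _); exact: ltW.
Qed.

End NormalCdf.

(** * From local estimates to the distribution function *)

Section BerryEsseen.
Variable R : realType.
Implicit Types (n : nat) (k : int).
Local Notation phi := (normal_pdf (0 : R) 1).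

Definition card_cdf n k : R := \sum_(j < (n + n).+1 | j%:Z < k) card_prob R n j.

Lemma card_cdf_step n k : card_cdf n (k + 1) - card_cdf n k = int_prob R n k.
Proof.
rewrite /card_cdf (bigID (fun j : 'I_(n + n).+1 => j%:Z < k)) /= addrC.
rewrite (eq_bigl (fun j : 'I_(n + n).+1 => j%:Z == k)); last by move=> j /=; lia.
rewrite [X in _ + X - _](eq_bigl (fun j : 'I_(n + n).+1 => j%:Z < k)); last by move=> j /=; lia.
by rewrite addrK.
Qed.

Lemma card_cdf_ge0 n k : 0 <= card_cdf n k.
Proof. by apply: sumr_ge0 => j _; exact: card_prob_ge0. Qed.

Lemma card_cdf_homo n k k' : k <= k' -> card_cdf n k <= card_cdf n k'.
Proof.
move=> kk; rewrite /card_cdf (big_mkcond (fun j : 'I_ _ => _ < k)) (big_mkcond (fun j : 'I_ _ => _ < k')).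
apply: ler_sum => j _; case: ifPn => h1; case: ifPn => h2 //; first by lia.
exact: card_prob_ge0.
Qed.

Lemma card_cdf_le1 n k : card_cdf n k <= 1.
Proof.
rewrite -(sum_card_prob R n) /card_cdf big_mkcond; apply: ler_sum => j _.
by case: ifP => // _; exact: card_prob_ge0.
Qed.

Let pos n k : R := (k%:~R - mu R * n%:R) / (sigma R * Num.sqrt n%:R).
Let gap n : R := (sigma R * Num.sqrt n%:R)^-1.

(* A bounded increasing function whose increments dominate the errors of the
   local limit theorem, so that their sum telescopes to O(1 / sqrt n). *)
Let squash (x : R) : R := x / (1 + `|x|).

Let squash_le1 x : `|squash x| <= 1.
Proof.
have d0 : 0 < 1 + `|x| by rewrite ltr_pwDl.
by rewrite /squash normrM normfV (ger0_norm (ltW d0)) ler_pdivrMr// mul1r lerDr.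
Qed.

Let squash_diff (a b : R) : a <= b ->
  (b - a) / ((1 + `|a|) * (1 + `|b|)) <= squash b - squash a.
Proof.
move=> ab; have a0 : 0 < 1 + `|a| by rewrite ltr_pwDl.
have b0 : 0 < 1 + `|b| by rewrite ltr_pwDl.
have -> : squash b - squash a = (b * (1 + `|a|) - a * (1 + `|b|)) / ((1 + `|a|) * (1 + `|b|)).
  by rewrite /squash; field; rewrite !gt_eqF.
rewrite ler_wpM2r ?invr_ge0 ?mulr_ge0 ?(ltW a0) ?(ltW b0)//.
rewrite !mulrDr !mulr1 opprD addrACA lerDl.
have [b1|b1] := leP 0 b; have [a1|a1] := leP 0 a.
- by rewrite !ger0_norm// mulrC subrr.
- rewrite (ger0_norm b1) (ltr0_norm a1) -mulNr addr_ge0// mulr_ge0//; lra.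
- lra.
- by rewrite (ltr0_norm b1) (ltr0_norm a1); have -> : b * - a - a * - b = 0 by ring.
Qed.

Let expR_diff (u v m : R) : m <= u -> m <= v ->
  `|expR (- u) - expR (- v)| <= `|u - v| * expR (- m).
Proof.
wlog uv : u v / u <= v => [hw|] mu mv.
  have [/hw->//|/ltW vu] := leP u v.
  by rewrite distrC (distrC u); exact: hw.
rewrite ger0_norm; last by rewrite subr_ge0 ler_expR; lra.
rewrite distrC ger0_norm ?subr_ge0//.
apply: (@le_trans _ _ ((v - u) * expR (- u))).
  have -> : expR (- v) = expR (- u) * expR (u - v) by rewrite -expRD; congr expR; ring.
  have := ler_wpM2l (expR_ge0 (- u)) (expR_ge1Dx (u - v)); lra.
by rewrite ler_wpM2l ?subr_ge0// ler_expR; lra.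
Qed.

Let inv_sqrt2pi_le1 : (Num.sqrt (2 * pi) : R)^-1 <= 1.
Proof.
rewrite invf_le1 ?sqrtr_gt0 ?mulr_gt0 ?pi_gt0//.
by rewrite -[leLHS]sqrtr1 ler_wsqrtr//; have := @pi_ge2 R; lra.
Qed.

Let phi_variation (a xi h : R) : 0 <= h <= 1 -> a <= xi <= a + h ->
  `|phi xi - phi a| <= h * (2 * `|a| + 1) * expR 2^-1 * expR (- (`|a| ^+ 2 / 4)).
Proof.
move=> /andP[h0 h1] /andP[x1 x2].
rewrite !phiE -mulrBl normrM [X in _ * X <= _]ger0_norm ?invr_ge0 ?sqrtr_ge0//.
apply: le_trans (ler_piMr (normr_ge0 _) inv_sqrt2pi_le1) _.
rewrite !mulNr real_normK ?num_real//.
(* Since [a^2 <= 2 xi^2 + 2 (xi - a)^2] and [|xi - a| <= 1], both exponents are at least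
   [a^2 / 4 - 1/2]; the [1/2] becomes the factor [expR 2^-1]. *)
apply: le_trans (@expR_diff _ _ (a ^+ 2 / 4 - 2^-1) _ _) _.
- have e : a ^+ 2 <= 2 * xi ^+ 2 + 2 * (xi - a) ^+ 2.
    rewrite -subr_ge0; have -> : 2 * xi ^+ 2 + 2 * (xi - a) ^+ 2 - a ^+ 2 = (2 * xi - a) ^+ 2 by ring.
    exact: sqr_ge0.
  have : (xi - a) ^+ 2 <= 1 by rewrite exprn_ile1//; lra.
  lra.
- by have := sqr_ge0 a; lra.
rewrite opprB expRD mulrA.
rewrite ler_wpM2r ?expR_ge0// ler_wpM2r ?expR_ge0//.
have -> : xi ^+ 2 / 2 - a ^+ 2 / 2 = (xi - a) * ((xi + a) / 2) by field.
rewrite normrM; apply: ler_pM => //.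
  by rewrite ger0_norm; lra.
rewrite ler_norml; have := ler_norm a; have := ler_norm (- a); rewrite normrN => ? ?.
by apply/andP; split; lra.
Qed.

Let gap_small (r : R) : 0 < r -> exists n0, forall n, (n0 <= n)%N -> (0 < n)%N ->
  0 < gap n <= r.
Proof.
move=> r0; have s0 := sigma_gt0 R.
exists (Num.truncn ((sigma R * r)^-1 ^+ 2)).+1 => n n0n n_gt0.
have N0 : 0 < Num.sqrt n%:R :> R by rewrite sqrtr_gt0 ltr0n.
rewrite /gap invr_gt0 mulr_gt0//=.
set q := (sigma R * r)^-1.
have q0 : 0 <= q by rewrite invr_ge0 ltW// mulr_gt0.
have -> : (sigma R * Num.sqrt n%:R)^-1 = r * (q / Num.sqrt n%:R).
  by rewrite /q; field; rewrite !gt_eqF.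
rewrite ler_piMr ?(ltW r0)// ler_pdivrMr// mul1r -(ger0_norm q0) -sqrtr_sqr.
rewrite ler_wsqrtr//; apply: le_trans (ltW (truncnS_gt _)) _.
by rewrite ler_nat.
Qed.

Let pos_step n k : pos n (k + 1) = pos n k + gap n.
Proof. by rewrite /pos /gap rmorphD rmorph1 /=; ring. Qed.

Let step_bound : exists K n0, 0 <= K /\
  forall n k, (n0 <= n)%N -> (0 < n)%N -> `|pos n k| ^+ 3 <= Num.sqrt n%:R ->
  `|int_prob R n k - (Phi (pos n (k + 1)) - Phi (pos n k))| <=
  K / Num.sqrt n%:R * (squash (pos n (k + 1)) - squash (pos n k)).
Proof.
have s0 := sigma_gt0 R.
have [K1 [n1 [K10 hK]]] := local_limit R.
have [n2 hn2] := gap_small ltr01.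
have [K2 K20 hK2] := @cube_le_expR R 4^-1 ltac:(by rewrite invr_gt0).
pose c := expR 2^-1 : R; have c0 : 0 <= c by exact: expR_ge0.
have i0 : 0 <= (sigma R)^-1 by rewrite invr_ge0 ltW.
(* With [E = expR (- (y^2 / 4))], the three numerical factors bound [(1 + y^3) E],
   [(1 + y)(2 + y) E] and [(2y + 1)(1 + y)(2 + y) E]. The first summand is the error of the local
   theorem, the second that of replacing the normal integral over one lattice step by a
   rectangle. *)
pose K := (1 + K2) * K1 * (3 + 4 * K2) + (sigma R)^-1 * c * (9 + 16 * K2).
have KK0 : 0 <= K by rewrite /K !(mulr_ge0, addr_ge0).
exists K, (maxn n1 n2); split=> //.
move=> n k; rewrite geq_max => /andP[n1n n2n] n_gt0.
set a := pos n k => a3.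
have /andP[h0 h1] := hn2 n n2n n_gt0; set h := gap n in h0 h1.
set N := Num.sqrt n%:R in a3 *.
have N0 : 0 < N by rewrite sqrtr_gt0 ltr0n.
have kE : k%:~R = mu R * n%:R + a * sigma R * Num.sqrt n%:R - 0.
  by rewrite /a /pos -/N; field; rewrite !gt_eqF.
have := hK n a 0 k n1n n_gt0 a3 ltac:(by rewrite lexx ler01) kE.
rewrite -/N; set P := int_prob R n k.
rewrite pos_step -/a -/h; set b := a + h.
have qN : Num.sqrt (2 * pi * n%:R) = Num.sqrt (2 * pi) * N.
  by rewrite sqrtrM// mulr_ge0// pi_ge0.
rewrite qN; set q := Num.sqrt (2 * pi).
have q0 : 0 < q by rewrite sqrtr_gt0 mulr_gt0// pi_gt0.
set F := expR (a ^+ 2 / 2); have F0 : 0 < F by exact: expR_gt0.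
move=> hP.
have phiaE : phi a = F^-1 / q by rewrite phiE mulNr expRN.
have qi : q^-1 <= 1 := inv_sqrt2pi_le1.
clearbody q.
have hE : h = (sigma R * N)^-1 by [].
set y := `|a|; have y0 : 0 <= y := normr_ge0 a.
have U0 : 0 <= 1 + y ^+ 3 by rewrite addr_ge0// exprn_ge0.
have hP2 : `|P - h * phi a| <= h * F^-1 * (K1 * ((1 + y ^+ 3) / N)).
  have -> : P - h * phi a = h * F^-1 * (q^-1 * (P * (q * N * sigma R) * F - 1)).
    by rewrite phiaE hE; field; rewrite !gt_eqF.
  have hF0 : 0 <= h * F^-1 by apply: mulr_ge0; [exact: ltW|rewrite invr_ge0 ltW].
  rewrite normrM (ger0_norm hF0) ler_wpM2l//.
  rewrite normrM ger0_norm ?invr_ge0 ?(ltW q0)//.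
  by apply: le_trans hP; rewrite ler_piMl.
set E := expR (- (y ^+ 2 / 4)).
(* One factor [E] absorbs the [1 + y^3] of the local theorem, the other the denominator [D] of the
   increment of [squash]. *)
have hF : F^-1 = E * E.
  by rewrite /F -expRN /E -expRD /y real_normK ?num_real//; congr expR; field.
pose d := h * (2 * y + 1) * c * E.
have hd t : a <= t <= b -> phi a - d <= phi t <= phi a + d.
  move=> /phi_variation h2; have := h2 ltac:(by rewrite (ltW h0) h1).
  by rewrite ler_norml -/c -/y -/E -/d => /andP[? ?]; apply/andP; split; lra.
have ab : a <= b by rewrite lerDl ltW.
have := Phi_mean_value ab hd.
have -> : b - a = h by rewrite /b; ring.
move=> hPhi.
have hdiff : `|P - (Phi b - Phi a)| <= h * F^-1 * (K1 * ((1 + y ^+ 3) / N)) + h * d.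
  have h3 : `|h * phi a - (Phi b - Phi a)| <= h * d.
    by rewrite ler_norml; case/andP: hPhi => ? ?; apply/andP; split; lra.
  have -> : P - (Phi b - Phi a) = (P - h * phi a) + (h * phi a - (Phi b - Phi a)) by ring.
  by apply: le_trans (ler_normD _ _) _; exact: lerD.
apply: le_trans hdiff _.
have [k1 k3] := hK2 y y0.
have EG : expR (4^-1 * y ^+ 2) * E = 1.
  by rewrite /E -expRD -[RHS]expR0; congr expR; field.
have E0 : 0 <= E by exact: expR_ge0.
have E1 : E <= 1 by rewrite /E -[leRHS]expR0 ler_expR oppr_le0 divr_ge0// exprn_ge0.
have m1 : y * E <= K2 by have := ler_wpM2r E0 k1; rewrite -(mulrA K2) EG mulr1.
have m3 : y ^+ 3 * E <= K2 by have := ler_wpM2r E0 k3; rewrite -(mulrA K2) EG mulr1.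
have y2 : y ^+ 2 <= 1 + y ^+ 3.
  have [y1|y1] := leP y 1.
    by apply: (@le_trans _ _ 1); [rewrite exprn_ile1|rewrite lerDl exprn_ge0].
  by apply: (@le_trans _ _ (y ^+ 3)); [rewrite ler_weXn2l// ltW|rewrite lerDr].
have m2 : y ^+ 2 * E <= 1 + K2 by have := ler_wpM2r E0 y2; lra.
have sq := squash_diff ab.
have hb : b - a = h by rewrite /b; ring.
rewrite hb in sq.
set D := (1 + `|a|) * (1 + `|b|) in sq.
have a1 : 0 < 1 + `|a| by rewrite ltr_pwDl.
have b1 : 0 < 1 + `|b| by rewrite ltr_pwDl.
have D0 : 0 < D by rewrite mulr_gt0.
have D2 : D <= (1 + y) * (2 + y).
  rewrite /D -/y ler_wpM2l//; first by rewrite addr_ge0.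
  have : `|b| <= y + h by rewrite /b; apply: le_trans (ler_normD _ _) _; rewrite lerD2l (ger0_norm (ltW h0)).
  lra.
apply: (@le_trans _ _ (K / N * (h / D))); last first.
  by rewrite ler_wpM2l// divr_ge0// ltW.
have -> : K / N * (h / D) = h / N * (K / D) by ring.
have -> : h * F^-1 * (K1 * ((1 + y ^+ 3) / N)) + h * d =
   h / N * (E * E * K1 * (1 + y ^+ 3) + (sigma R)^-1 * (2 * y + 1) * c * E).
  by rewrite hF /d hE; field; rewrite !gt_eqF.
rewrite ler_wpM2l ?divr_ge0 ?(ltW h0) ?(ltW N0)// ler_pdivlMr//.
have T0 : 0 <= E * E * K1 * (1 + y ^+ 3) + (sigma R)^-1 * (2 * y + 1) * c * E.
  by rewrite !(mulr_ge0, addr_ge0).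
apply: le_trans (ler_wpM2l T0 D2) _.
have -> : (E * E * K1 * (1 + y ^+ 3) + (sigma R)^-1 * (2 * y + 1) * c * E) *
   ((1 + y) * (2 + y)) =
   ((1 + y ^+ 3) * E) * K1 * (((1 + y) * (2 + y)) * E) +
   (sigma R)^-1 * c * (((2 * y + 1) * ((1 + y) * (2 + y))) * E) by ring.
have f1 : (1 + y ^+ 3) * E <= 1 + K2 by lra.
have f2 : ((1 + y) * (2 + y)) * E <= 3 + 4 * K2 by lra.
have f3 : ((2 * y + 1) * ((1 + y) * (2 + y))) * E <= 9 + 16 * K2 by lra.
rewrite /K; apply: lerD.
  have g1 : 0 <= (1 + y ^+ 3) * E * K1 := mulr_ge0 (mulr_ge0 U0 E0) K10.
  have g2 : 0 <= (1 + y) * (2 + y) * E by rewrite !mulr_ge0 ?addr_ge0.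
  exact: ler_pM g1 g2 (ler_wpM2r K10 f1) f2.
have ic0 : 0 <= (sigma R)^-1 * c := mulr_ge0 i0 c0.
exact: (ler_wpM2l ic0 f3).
Qed.

Let discr n k : R := card_cdf n k - Phi (pos n k).

Let discr_window (K : R) n k (i : nat) : 0 <= K -> 0 < gap n ->
  (forall k, `|pos n k| ^+ 3 <= Num.sqrt n%:R ->
    `|int_prob R n k - (Phi (pos n (k + 1)) - Phi (pos n k))| <=
    K * (squash (pos n (k + 1)) - squash (pos n k))) ->
  (forall j, (j < i)%N -> `|pos n (k + j%:Z)| ^+ 3 <= Num.sqrt n%:R) ->
  `|discr n (k + i%:Z) - discr n k| <= 2 * K.
Proof.
move=> K0 g0 hK hw.
suff : `|discr n (k + i%:Z) - discr n k| <= K * (squash (pos n (k + i%:Z)) - squash (pos n k)).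
  move=> /le_trans; apply; rewrite mulrC ler_wpM2r//.
  have := squash_le1 (pos n (k + i%:Z)); have := squash_le1 (pos n k).
  by rewrite !ler_norml => /andP[? ?] /andP[? ?]; lra.
elim: i hw => [|i IH] hw; first by rewrite addr0 !subrr normr0 mulr0.
have {}IH := IH (fun j ji => hw j (ltnW ji)).
have e : k + i.+1%:Z = k + i%:Z + 1 by lia.
have st := hK _ (hw i (ltnSn i)); rewrite -card_cdf_step in st.
rewrite e; set k' := k + i%:Z in IH st *.
have -> : discr n (k' + 1) - discr n k = (card_cdf n (k' + 1) - card_cdf n k' -
   (Phi (pos n (k' + 1)) - Phi (pos n k'))) + (discr n k' - discr n k).
  by rewrite /discr; ring.
by apply: le_trans (ler_normD _ _) _; apply: le_trans (lerD st IH) _; lra.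
Qed.

(** Inside the window the discrepancy varies by [O(1 / sqrt n)]. At the left end it is at least
    minus the normal tail because a distribution function is nonnegative, at the right end at most
    the normal tail because it is at most 1; so it is small at both ends, hence throughout. Outside,
    monotonicity suffices. *)
Theorem berry_esseen_int : exists K n0, 0 <= K /\
  forall n k, (n0 <= n)%N -> (0 < n)%N ->
  `|card_cdf n k - Phi ((k%:~R - mu R * n%:R) / (sigma R * Num.sqrt n%:R))| <=
  K / Num.sqrt n%:R.
Proof.
have s0 := sigma_gt0 R.
have [K1 [n1 [K10 h1]]] := step_bound.
have h20 : 0 < 2^-1 :> R by rewrite invr_gt0.
have [n2 hn2] := gap_small h20.
have [K2 K20 hK2] := Phi_tail R.
pose K := 2 * (2 * K1) + 4 * (8 * K2).
exists K, (maxn n1 n2); split; first by rewrite /K !(mulr_ge0, addr_ge0).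
move=> n k; rewrite geq_max => /andP[n1n n2n] n_gt0.
rewrite -/(pos n k) -/(discr n k).
have /andP[g0 g1] := hn2 n n2n n_gt0.
set N := Num.sqrt n%:R.
have N1 : 1 <= N by rewrite -[leLHS]sqrtr1 ler_wsqrtr// ler1n.
have N0 : 0 < N by lra.
pose B := N `^ 3^-1.
have B3 : B ^+ 3 = N.
  by rewrite /B -powR_mulrn ?powR_ge0// -powRrM mulVf ?powRr1 ?(ltW N0)// pnatr_eq0.
have B1 : 1 <= B by rewrite -(@ler_pXn2r _ 3)// ?nnegrE ?powR_ge0// B3 expr1n.
have kN : 0 <= K1 / N by rewrite divr_ge0 ?(ltW N0).
have hst k' : `|pos n k'| ^+ 3 <= Num.sqrt n%:R ->
    `|int_prob R n k' - (Phi (pos n (k' + 1)) - Phi (pos n k'))| <=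
    K1 / N * (squash (pos n (k' + 1)) - squash (pos n k')) by exact: h1.
have pos_homo i j : i <= j -> pos n i <= pos n j.
  move=> ij; rewrite /pos -/(gap n) ler_wpM2r ?(ltW g0)// lerD2r.
  by rewrite ler_int.
have pos_gt i j : pos n i < pos n j -> i < j.
  by move=> h; rewrite ltNge; apply/negP => /pos_homo; rewrite leNgt h.
(* The extreme integers with position in [[- B, B]], where [B = n^(1/6)]; adding 1 to the floor
   keeps [k0] on the inner side. *)
pose k0 := Num.floor (mu R * n%:R - B * (sigma R * N)) + 1.
pose k1 := Num.floor (mu R * n%:R + B * (sigma R * N)).
have sN : 0 < sigma R * N by rewrite mulr_gt0.
have posE (r : R) : (mu R * n%:R + r * (sigma R * N) - mu R * n%:R) / (sigma R * N) = r.
  by field; rewrite !gt_eqF.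
have gE : gap n = 1 / (sigma R * N) by rewrite mul1r.
have p0l : - B <= pos n k0.
  rewrite -[leLHS]posE /pos -/N ler_wpM2r ?invr_ge0 ?(ltW sN)// lerD2r mulNr.
  by rewrite /k0 ltW// floorD1_gt.
have p0u : pos n k0 <= - B + gap n.
  rewrite /k0 pos_step lerD2r -[leRHS]posE /pos -/N.
  by rewrite ler_wpM2r ?invr_ge0 ?(ltW sN)// lerD2r mulNr floor_le.
have p1u : pos n k1 <= B.
  rewrite -[leRHS]posE /pos -/N.
  by rewrite ler_wpM2r ?invr_ge0 ?(ltW sN)// lerD2r floor_le.
have p1l : B - gap n <= pos n k1.
  rewrite lerBlDr -pos_step -[leLHS]posE /pos -/N ler_wpM2r ?invr_ge0 ?(ltW sN)// lerD2r.
  by rewrite /k1 ltW// floorD1_gt.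
have inB k' : k0 <= k' -> k' <= k1 -> `|pos n k'| ^+ 3 <= N.
  move=> a b; rewrite -B3; apply: ge0_lerXn2r => //.
  by rewrite ler_norml (le_trans p0l (pos_homo _ _ a)) (le_trans (pos_homo _ _ b) p1u).
have k01 : k0 < k1 by apply: pos_gt; lra.
(* As [gap n <= 1/2 <= B / 2], the positions of [k0] and [k1] lie at distance at least [B / 2] from
   0. *)
have B2 : 0 < B / 2 by lra.
have [t0 t1] := hK2 _ B2.
have tE : K2 / (B / 2) ^+ 3 = 8 * K2 / N.
  have -> : (B / 2) ^+ 3 = N / 8 by rewrite -B3; field.
  by field; rewrite gt_eqF.
rewrite tE in t0 t1.
have T0 : Phi (pos n k0) <= 8 * K2 / N.
  by apply: le_trans t0; apply: Phi_homo; lra.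
have T1 : 1 - Phi (pos n k1) <= 8 * K2 / N.
  by apply: le_trans t1; rewrite lerD2l lerN2; apply: Phi_homo; lra.
have win i j : k0 <= i -> i <= j -> j <= k1 -> `|discr n j - discr n i| <= 2 * (K1 / N).
  move=> a b c; have ji : j = i + (absz (j - i))%:Z by clear -b; lia.
  rewrite ji; apply: (@discr_window (K1 / N) n i _ kN g0 hst) => m hm.
  by apply: inB; clear -a b c hm; lia.
have d0 : - (8 * K2 / N) <= discr n k0.
  by rewrite /discr; have := card_cdf_ge0 n k0; lra.
have d1 : discr n k1 <= 8 * K2 / N.
  by rewrite /discr; have := card_cdf_le1 n k1; lra.
have KE : K / N = 2 * (2 * (K1 / N)) + 4 * (8 * K2 / N) by rewrite /K; field; rewrite gt_eqF.
have q1 : 0 <= 8 * K2 / N by rewrite divr_ge0 ?mulr_ge0 ?(ltW N0).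
have w01 := win k0 k1 (lexx _) (ltW k01) (lexx _).
rewrite KE; move: (8 * K2 / N) (K1 / N) q1 kN T0 T1 d0 d1 w01 win {tE t0 t1 hst KE} => b a b0 a0.
move=> T0 T1 d0 d1; rewrite ler_norml => /andP[w1 w2] win.
have [kk0|kk0] := ltP k k0.
  have c1 := card_cdf_homo n (ltW kk0); have c2 := card_cdf_ge0 n k.
  have c3 := Phi_homo (pos_homo _ _ (ltW kk0)); have c4 := Phi_ge0 (pos n k).
  move: w1 w2 d0 d1; rewrite /discr => *; rewrite ler_norml; apply/andP; split; lra.
have [kk1|kk1] := leP k k1.
  have := win k0 k (lexx _) kk0 kk1; have := win k k1 kk0 kk1 (lexx _).
  rewrite !ler_norml => /andP[? ?] /andP[? ?]; apply/andP; split; lra.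
have c1 := card_cdf_homo n (ltW kk1); have c2 := card_cdf_le1 n k.
have c3 := Phi_homo (pos_homo _ _ (ltW kk1)); have c4 := Phi_le1 (pos n k).
move: w1 w2 d0 d1; rewrite /discr => *; rewrite ler_norml; apply/andP; split; lra.
Qed.

End BerryEsseen.

(** * Return to the seating probabilities *)

Local Open Scope classical_set_scope.
Local Open Scope ring_scope.

Lemma seating_cdf (R : realType) n (x : R) : (0 < n)%N ->
  seating_prob R (empty_ladder n)
    (fun X => (#|` X|%fset%:R - mu R * n%:R) / (sigma R * Num.sqrt n%:R) <= x)
  = card_cdf R n (Num.floor (mu R * n%:R + x * (sigma R * Num.sqrt n%:R)) + 1).
Proof.
move=> n0; have sN : 0 < sigma R * Num.sqrt n%:R.
  by rewrite mulr_gt0 ?sigma_gt0// sqrtr_gt0 ltr0n.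
rewrite (seating_prob_card R n (fun j => (j%:R - mu R * n%:R) / (sigma R * Num.sqrt n%:R) <= x)).
apply: eq_bigl => j; rewrite ler_pdivrMr// lerBlDl.
by rewrite ltzD1 floor_ge_int.
Qed.

(** Rounding [x] up to the lattice moves the argument of [Phi] by at most [1 / (sigma sqrt n)], and
    [Phi] is 1-Lipschitz; this accounts for the additional [(sigma R)^-1]. *)
Lemma berry_esseen (R : realType) : exists (K : R) n0, 0 <= K /\
  forall n (x : R), (n0 <= n)%N -> (0 < n)%N ->
  `|seating_prob R (empty_ladder n)
      (fun X => (#|` X|%fset%:R - mu R * n%:R) / (sigma R * Num.sqrt n%:R) <= x)
    - Phi x| <= K / Num.sqrt n%:R.
Proof.
have [K [n0 [K0 hK]]] := @berry_esseen_int R.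
have s0 := sigma_gt0 R.
exists (K + (sigma R)^-1), n0; split; first by rewrite addr_ge0// invr_ge0 ltW.
move=> n x n0n n_gt0; rewrite seating_cdf//.
have N0 : 0 < Num.sqrt n%:R :> R by rewrite sqrtr_gt0 ltr0n.
set N := Num.sqrt n%:R in N0 *.
set k := (Num.floor _ + 1)%R.
have := hK n k n0n n_gt0; rewrite -/N.
have sN : 0 < sigma R * N by rewrite mulr_gt0.
set p := (k%:~R - _) / _ => hp.
have xp : x <= p.
  rewrite /p ler_pdivlMr// lerBrDl ltW// /k.
  exact: floorD1_gt.
have px : p - x <= (sigma R)^-1 / N.
  rewrite lerBlDl /p ler_pdivrMr// [leRHS]mulrDl.
  have -> : (sigma R)^-1 / N * (sigma R * N) = 1 by field; rewrite !gt_eqF.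
  rewrite lerBlDl addrA /k rmorphD /= lerD2r.
  exact: floor_le.
have hphi t : x <= t <= p -> 0 <= normal_pdf (0 : R) 1 t <= 1.
  move=> _; rewrite normal_pdf_ge0 /= phiE ler_pdivrMr ?sqrtr_gt0 ?mulr_gt0 ?pi_gt0//.
  rewrite mul1r; apply: (@le_trans _ _ 1).
    rewrite -[leRHS]expR0 ler_expR; have := sqr_ge0 t; lra.
  rewrite -[leLHS]sqrtr1 ler_wsqrtr//; have := @pi_ge2 R; lra.
have /andP[P0 P1] := Phi_mean_value xp hphi.
rewrite mul0r mul1r in P0 P1.
rewrite mulrDl; move: hp; rewrite !ler_norml => /andP[h1 h2].
have i0 : 0 <= (sigma R)^-1 / N by rewrite divr_ge0 ?invr_ge0 ?(ltW s0) ?(ltW N0).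
by apply/andP; split; lra.
Qed.

Lemma seating_local (R : realType) (eps : nat -> R) :
  eps n @[n --> \oo] --> (0 : R) ->
  exists C : R, \forall n \near \oo, forall x : R,
    `|x| <= eps n * n%:R `^ (6%:R^-1) ->
    exists2 r : R, `|r| <= C * ((1 + `|x| ^+ 3) / Num.sqrt n%:R) &
      seating_prob R (empty_ladder n)
        (fun X => (#|` X|%fset : int)
                    == Num.floor (mu R * n%:R + x * sigma R * Num.sqrt n%:R))
      = expR (- x ^+ 2 / 2) / (Num.sqrt (2 * pi * n%:R) * sigma R)
        * (1 + r).
Proof.
move=> epsl; have [K [n0 [K0 hK]]] := local_limit R.
exists K; near=> n => x hx.
have n_gt0 : (0 < n)%N by near: n; exact: nbhs_infty_gt.
have n0n : (n0 <= n)%N by near: n; exact: nbhs_infty_ge.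
(* Then [|x| <= n^(1/6)], which is the range [|x|^3 <= sqrt n] of [local_limit]. *)
have e1 : eps n <= 1.
  near: n; move/cvgrPdist_le: epsl => /(_ 1 ltr01); apply: filterS => n.
  rewrite sub0r normrN; exact: le_trans (ler_norm _).
have w0 : 0 <= n%:R `^ 6%:R^-1 :> R by exact: powR_ge0.
have x3 : `|x| ^+ 3 <= Num.sqrt n%:R.
  have -> : Num.sqrt n%:R = (n%:R `^ 6%:R^-1) ^+ 3 :> R.
    rewrite -powR12_sqrt// -powR_mulrn// -powRrM; congr (_ `^ _).
    by field.
  apply: ge0_lerXn2r => //; apply: le_trans hx _; rewrite -[leRHS]mul1r.
  by rewrite ler_wpM2r.
set y := mu R * n%:R + x * sigma R * Num.sqrt n%:R.
set k := Num.floor y.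
have th : 0 <= y - k%:~R <= 1.
  have := floor_le y; have := floorD1_gt y; rewrite -/k rmorphD /= => *.
  by apply/andP; split; lra.
have kE : k%:~R = y - (y - k%:~R) by ring.
have hr := hK n x _ k n0n n_gt0 x3 th kE.
rewrite (seating_prob_card R n (fun j => j%:Z == k)) -/(int_prob R n k).
move: hr; set P := int_prob R n k; set q := Num.sqrt _ * sigma R => hr.
exists (P * q * expR (x ^+ 2 / 2) - 1) => //.
have q0 : 0 < q.
  by rewrite mulr_gt0 ?sigma_gt0// sqrtr_gt0 !mulr_gt0 ?pi_gt0 ?ltr0n.
have e0 := expR_gt0 (x ^+ 2 / 2).
rewrite mulNr expRN; move: (expR _) e0 => E e0; clearbody q P.
by field; rewrite !gt_eqF.
Unshelve. all: by end_near.
Qed.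

Theorem theorem3 (R : realType) :
  (fun n : nat =>
     sup [set `| seating_prob R (empty_ladder n)
                   (fun X => (#|` X|%:R - mu R * n%:R)
                               / (sigma R * Num.sqrt n%:R) <= x)
                 - Phi x | | x in [set: R]])
    =O_\oo (fun n : nat => (Num.sqrt (n%:R : R))^-1)
  /\
  (forall eps : nat -> R,
     (forall n, 0 < eps n) -> eps n @[n --> \oo] --> (0 : R) ->
     exists C : R, \forall n \near \oo, forall x : R,
       `|x| <= eps n * n%:R `^ (6%:R^-1) ->
       exists2 r : R, `|r| <= C * ((1 + `|x| ^+ 3) / Num.sqrt n%:R) &
         seating_prob R (empty_ladder n)
           (fun X => (#|` X| : int)
                       == Num.floor (mu R * n%:R + x * sigma R * Num.sqrt n%:R))
         = expR (- x ^+ 2 / 2) / (Num.sqrt (2 * pi * n%:R) * sigma R)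
           * (1 + r)).
Proof.
split; last by move=> eps _; exact: seating_local.
have [K [n0 [K0 hK]]] := berry_esseen R.
(* The constant must be positive, whereas [K] may vanish. *)
apply/eqO_exP; exists (K + 1); first by rewrite ltr_wpDl.
near=> n.
have n_gt0 : (0 < n)%N by near: n; exact: nbhs_infty_gt.
have n0n : (n0 <= n)%N by near: n; exact: nbhs_infty_ge.
have N0 : 0 <= (Num.sqrt n%:R)^-1 :> R by rewrite invr_ge0 sqrtr_ge0.
set S := [set _ | _ in _].
have S0 : S !=set0 by eexists; exists 0.
have ubS : ubound S (K / Num.sqrt n%:R) by move=> _ [x _ <-]; exact: hK.
have supS0 : 0 <= sup S.
  case: S0 => s Ss; have s0 : 0 <= s by case: Ss => x _ <-.
  apply: le_trans s0 _; apply: ub_le_sup => //; by exists (K / Num.sqrt n%:R).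
rewrite ger0_norm// (ger0_norm N0).
apply: le_trans (ge_sup S0 ubS) _.
by rewrite ler_wpM2r// lerDl.
Unshelve. all: by end_near.
Qed.
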